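(* There exists a configuration of nine points $\{p_j\}_{j=1}^9\subset\mathbb{P}^2$ such that the anti-canonical bundle $K_X^{-1}$ of the blow-up $X$ of $\mathbb{P}^2$ at $\{p_j\}_{j=1}^9$ is nef, but $K_X^{-1}$ admits no $C^\infty$ Hermitian metric with semi-positive curvature.
   Context: $\mathbb{P}^2$ is the complex projective plane; the nine points are different from each other. *)

(* Defs.v *)
From HB Require Import structures.
From mathcomp Require Import all_boot all_order all_algebra.
From mathcomp Require Import complex.
From mathcomp Require Import all_classical all_reals all_analysis.

Set Implicit Arguments.
Unset Strict Implicit.
Unset Printing Implicit Defensive.

Import Order.TTheory GRing.Theory Num.Theory.
Import numFieldNormedType.Exports.

Local Open Scope classical_set_scope.
Local Open Scope ring_scope.

(* Packing [R[i]] as a numeric closed field lets type inference find the norm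
   topology that the analysis library puts on every numeric field. *)
Definition Cx (R : realType) : numClosedFieldType := R[i]%C.

(* Charts are given by their inverses: [par c] is a homeomorphism from the open
   set [dom c] of C^n onto an open subset of the manifold.  Differentiability is
   Frechet differentiability over the complex numbers, i.e. holomorphy.
   Second countability is not required: it is automatic for compact manifolds. *)
Record complex_manifold (R : realType) (n : nat) := ComplexManifold {
  carrier :> topologicalType;
  chart : Type;
  dom : chart -> set 'rV[Cx R]_n;
  par : chart -> 'rV[Cx R]_n -> carrier;
  manifold_hausdorff : hausdorff_space carrier;
  dom_open : forall c, open (dom c);
  par_inj : forall c, set_inj (dom c) (par c);
  par_homeo : forall c (W : set 'rV[Cx R]_n), W `<=` dom c ->
    open W <-> open (par c @` W);
  par_cover : forall x, exists c, (par c @` dom c) x;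
  par_holo : forall c c' z, dom c z -> (par c' @` dom c') (par c z) ->
    differentiable
      (fun w => xget 0 [set w' | dom c' w' /\ par c' w' = par c w]) z
}.

Section Manifolds.
Variable R : realType.
Local Notation C := (Cx R).

Definition patch n (X : complex_manifold R n) (c : chart X) : set X :=
  par c @` dom c.

Definition coord n (X : complex_manifold R n) (c : chart X) (x : X) : 'rV[C]_n :=
  xget 0 [set z | dom c z /\ par c z = x].

Definition transition n (X : complex_manifold R n) (c c' : chart X)
  (z : 'rV[C]_n) : 'rV[C]_n := coord c' (par c z).

Definition holomorphic_map m n (S : complex_manifold R m)
    (X : complex_manifold R n) (f : S -> X) : Prop :=
  continuous f /\
  forall (b : chart S) (c : chart X) z, dom b z -> patch c (f (par b z)) ->
    differentiable (fun w => coord c (f (par b w))) z.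

(* A line bundle trivialised over every chart, encoded by its transition
   functions: [L c c' z] is evaluated at the coordinate [z] in chart [c], and
   the components of a section satisfy s_c' = (L c c') * s_c. *)
Definition cocycle n (X : complex_manifold R n) :=
  chart X -> chart X -> 'rV[C]_n -> C.

(* With w = transition c c' z, the local frames of the top exterior power of the
   holomorphic tangent bundle satisfy
     d/dz_1 ^ .. ^ d/dz_n = det (dw/dz) * d/dw_1 ^ .. ^ d/dw_n. *)
Definition anticanonical n (X : complex_manifold R n) : cocycle X :=
  fun c c' z => \det ('J (transition c c') z).

(* A nonzero meromorphic section of the pull-back of [L] to a Riemann surface,
   with order [D s] at each point s. *)
Definition meromorphic_section n (X : complex_manifold R n) (L : cocycle X)
    (S : complex_manifold R 1) (f : S -> X)
    (sigma : chart X -> S -> C) (D : S -> int) : Prop :=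
  (forall c c' s, patch c (f s) -> patch c' (f s) ->
     sigma c' s = L c c' (coord c (f s)) * sigma c s) /\
  (forall (b : chart S) a (c : chart X), dom b a -> patch c (f (par b a)) ->
     exists u : 'rV[C]_1 -> C,
       [/\ \forall z \near a, differentiable u z, u a != 0 &
           \forall z \near a^',
             sigma c (par b z) = (z 0 0 - a 0 0) ^ D (par b a) * u z]).

(* deg (f^* L) is the degree of the divisor of any nonzero meromorphic section. *)
Definition pullback_degree n (X : complex_manifold R n) (L : cocycle X)
    (S : complex_manifold R 1) (f : S -> X) (d : int) : Prop :=
  exists sigma D, [/\ meromorphic_section L f sigma D,
    finite_set [set s | D s != 0] & d = \sum_(s \in [set: S]) D s].

(* (L . Y) >= 0 for every irreducible compact curve Y: the compact connected
   Riemann surfaces S with a generically injective holomorphic map f to X are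
   the normalisations of such curves Y = f(S), and (L . Y) = deg (f^* L). *)
Definition nef n (X : complex_manifold R n) (L : cocycle X) : Prop :=
  forall (S : complex_manifold R 1) (f : S -> X),
    compact [set: S] -> connected [set: S] -> holomorphic_map f ->
    (exists F : set S, finite_set F /\ set_inj (~` F) f) ->
    exists2 d, pullback_degree L f d & 0 <= d.

(* C^n is identified with R^(2n) by z_k = x_k + i x_(n+k). *)
Definition real_to_cplx n (x : 'rV[R]_(n + n)) : 'rV[C]_n :=
  \row_k (x 0 (lshift n k) +i* x 0 (rshift n k))%C.

Definition cplx_to_real n (z : 'rV[C]_n) : 'rV[R]_(n + n) :=
  row_mx (\row_k complex.Re (z 0 k)) (\row_k complex.Im (z 0 k)).

Definition partials n (s : seq 'I_(n + n)) (F : 'rV[C]_n -> R) :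
    'rV[R]_(n + n) -> R :=
  foldr (fun k G => 'D_(delta_mx 0 k) G) (F \o @real_to_cplx n) s.

Definition smooth_on n (V : set 'rV[C]_n) (F : 'rV[C]_n -> R) : Prop :=
  forall s z, V z -> differentiable (partials s F) (cplx_to_real z).

(* [h c z] is the squared norm of the local frame of [L] over the chart [c]. *)
Definition smooth_hermitian_metric n (X : complex_manifold R n) (L : cocycle X)
    (h : chart X -> 'rV[C]_n -> R) : Prop :=
  [/\ forall c z, dom c z -> 0 < h c z,
      forall c, smooth_on (dom c) (h c) &
      forall c c' z, dom c z -> patch c' (par c z) ->
        h c z = complex.Re (`|L c c' z| ^+ 2) * h c' (transition c c' z)].

(* The coefficients d^2 F / dz_a d(bar z_b), from d/dz = (d/dx - i d/dy) / 2 and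
   d/d(bar z) = (d/dx + i d/dy) / 2. *)
Definition levi n (F : 'rV[C]_n -> R) (z : 'rV[C]_n) : 'M[C]_n :=
  \matrix_(a, b)
    let x := lshift n in let y := @rshift n n in
    let D k l := partials [:: k; l] F (cplx_to_real z) in
    (((D (x a) (x b) + D (y a) (y b)) / 4) +i*
     ((D (x a) (y b) - D (y a) (x b)) / 4))%C.

(* Positive semi-definiteness of the Chern curvature form
   i Theta_h = - i d d-bar log h. *)
Definition semipositive_curvature n (X : complex_manifold R n)
    (h : chart X -> 'rV[C]_n -> R) : Prop :=
  forall c z, dom c z -> forall xi : 'rV[C]_n,
    0 <= \sum_a \sum_b
           levi (fun w => - ln (h c w)) z a b * xi 0 a * (xi 0 b)^*.

End Manifolds.
Arguments anticanonical {R n} X c c' z.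

Section ProjectivePlane.
Variable R : realType.
Local Notation C := (Cx R).

Definition vec3 (a b c : C) : 'rV[C]_3 := \row_k [:: a; b; c]`_k.

Definition P2 : Type := {x : {vspace 'rV[C]_3} | \dim x == 1%N}.

Variable p : 'I_9 -> P2.

(* The blow-up at p_0, .., p_8 is the incidence variety of all (x, l_0, .., l_8)
   where x is a point and l_i is a line through p_i and x.  Points and lines of
   the plane are subspaces of C^3 of dimension 1 and 2. *)
Definition on_blowup
    (P : {vspace 'rV[C]_3} * {ffun 'I_9 -> {vspace 'rV[C]_3}}) : bool :=
  (\dim P.1 == 1%N) &&
  [forall i, (\dim (P.2 i) == 2%N) && (sval (p i) + P.1 <= P.2 i)%VS].

Definition blowup_pt : Type := {P | on_blowup P}.

(* Charts: a basis of C^3 (the rows of M), and either no centre ([None]) or a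
   centre p_j ([Some j]), spanned by the first row of M. *)
Definition is_frame (c : 'M[C]_3 * option 'I_9) : bool :=
  (c.1 \in unitmx) &&
  (if c.2 is Some j then sval (p j) == <[row ord0 c.1]>%VS else true).

Definition frame : Type := {c | is_frame c}.

(* Affine coordinates (s, t) away from the points p_i, and (s, s t) near p_j. *)
Definition bpoint (c : frame) (z : 'rV[C]_2) : 'rV[C]_3 :=
  (if (sval c).2 is Some _ then vec3 1 (z 0 0) (z 0 0 * z 0 1)
   else vec3 1 (z 0 0) (z 0 1)) *m (sval c).1.

(* A second point, besides p_i, of the line l_i. *)
Definition bdir (c : frame) (z : 'rV[C]_2) (i : 'I_9) : 'rV[C]_3 :=
  if (sval c).2 == Some i then vec3 0 1 (z 0 1) *m (sval c).1 else bpoint c z.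

Definition bdom (c : frame) : set 'rV[C]_2 :=
  [set z | forall i, (sval c).2 != Some i -> <[bpoint c z]>%VS != sval (p i)].

Definition bpair (c : frame) (z : 'rV[C]_2) :=
  (<[bpoint c z]>%VS, [ffun i => (sval (p i) + <[bdir c z i]>)%VS]).

Lemma vec3E0 a b c : vec3 a b c 0 0 = a. Proof. by rewrite mxE. Qed.
Lemma vec3E1 a b c : vec3 a b c 0 1 = b. Proof. by rewrite mxE. Qed.
Lemma vec3E2 a b c : vec3 a b c 0 2%:R = c. Proof. by rewrite mxE. Qed.
Definition vec3E := (vec3E0, vec3E1, vec3E2).

Lemma vec3_eta (v : 'rV[C]_3) : v = vec3 (v 0 0) (v 0 1) (v 0 2%:R).
Proof.
apply/rowP => k; rewrite !mxE.
case: k => -[|[|[|//]]] /= i; congr (v _ _); exact: val_inj.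
Qed.

Lemma frame_unit (c : frame) : (sval c).1 \in unitmx.
Proof. by case: c => c /= /andP[]. Qed.

Lemma frame_center (c : frame) j : (sval c).2 = Some j ->
  sval (p j) = <[row ord0 (sval c).1]>%VS.
Proof. by case: c => -[M o] /= /andP[_ /[swap]] ->  /eqP. Qed.

Lemma mulmx_unit_eq0 (M : 'M[C]_3) (v : 'rV[C]_3) : M \in unitmx ->
  (v *m M == 0) = (v == 0).
Proof.
move=> uM; apply/eqP/eqP => [h|->]; last by rewrite mul0mx.
by rewrite -[v](mulmxK uM) h mul0mx.
Qed.

Lemma P2_gen (x : P2) : exists2 v, v != 0 & sval x = <[v]>%VS.
Proof.
case: x => U /= /eqP dU.
exists (vpick U).
  by rewrite vpick0 -dimv_eq0 dU.
apply/esym/eqP; rewrite eqEdim -memvE memv_pick /= dU dim_vline.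
by rewrite vpick0 -dimv_eq0 dU.
Qed.

Lemma vline_eqP (v w : 'rV[C]_3) : v != 0 -> w != 0 ->
  <[v]>%VS = <[w]>%VS -> exists2 a, a != 0 & v = a *: w.
Proof.
move=> v0 w0 e; have : v \in <[w]>%VS by rewrite -e memv_line.
move=> /vlineP[a va]; exists a => //; apply: contra_neq v0 => a0.
by rewrite va a0 scale0r.
Qed.

Lemma vlineZ (a : C) (w : 'rV[C]_3) : a != 0 -> <[a *: w]>%VS = <[w]>%VS.
Proof.
move=> a0; apply/eqP; rewrite eqEsubv -!memvE memvZ ?memv_line //=.
by apply/vlineP; exists a^-1; rewrite scalerA mulVf// scale1r.
Qed.

Lemma dim_line2 (v w : 'rV[C]_3) : v != 0 -> w != 0 ->
  <[v]>%VS != <[w]>%VS -> \dim (<[v]> + <[w]>) = 2%N.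
Proof.
move=> v0 w0 ne; have := dimv_add_leqif <[v]>%VS <[w]>%VS.
rewrite !dim_vline v0 w0 => -[_]; suff -> : (<[v]> :&: <[w]> <= 0)%VS by move=> /eqP.
apply/subvP => u; rewrite memv_cap memv0 => /andP[/vlineP[a ->] /vlineP[b e]].
apply: contraNT ne => av0.
have a0 : a != 0 by apply: contraNN av0 => /eqP->; rewrite scale0r.
have b0 : b != 0 by apply: contraNN av0; rewrite e => /eqP->; rewrite scale0r.
by rewrite -(vlineZ v a0) e vlineZ.
Qed.

Lemma bpoint_neq0 c z : bpoint c z != 0.
Proof.
rewrite /bpoint mulmx_unit_eq0 ?frame_unit//.
apply/eqP; case: ((sval c).2) => [j|] /rowP/(_ 0);
  by rewrite vec3E mxE => /eqP; rewrite oner_eq0.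
Qed.

Lemma bpoint_some c z j : (sval c).2 = Some j ->
  bpoint c z = row ord0 (sval c).1 + z 0 0 *: bdir c z j.
Proof.
move=> e; rewrite /bpoint /bdir e eqxx.
have -> : row ord0 (sval c).1 = vec3 1 0 0 *m (sval c).1.
  rewrite -[in LHS](mul1mx (sval c).1) row_mul; congr (_ *m _).
  rewrite [LHS]vec3_eta; congr vec3; by rewrite !mxE.
rewrite scalemxAl -mulmxDl; congr (_ *m _).
rewrite [RHS]vec3_eta; congr vec3; rewrite !mxE /=.
- by rewrite mulr0 addr0.
- by rewrite mulr1 add0r.
- by rewrite add0r.
Qed.

Lemma row0_neq0 (M : 'M[C]_3) : M \in unitmx -> row ord0 M != 0.
Proof.
move=> uM; rewrite rowE mulmx_unit_eq0//; apply/eqP => /rowP/(_ 0).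
by rewrite !mxE !eqxx => /eqP; rewrite oner_eq0.
Qed.

Lemma bdir_center c z j : (sval c).2 = Some j ->
  bdir c z j != 0 /\ <[row ord0 (sval c).1]>%VS != <[bdir c z j]>%VS.
Proof.
move=> e; have uM := frame_unit c.
have d0 : bdir c z j != 0.
  rewrite /bdir e eqxx mulmx_unit_eq0//; apply/eqP => /rowP/(_ 1).
  by rewrite vec3E mxE => /eqP; rewrite oner_eq0.
split=> //; apply/eqP => /(vline_eqP (row0_neq0 uM) d0)[a a0].
rewrite /bdir e eqxx rowE scalemxAl => /(can_inj (mulmxK uM))/rowP/(_ 0).
by rewrite !mxE !eqxx /= mulr0 => /eqP; rewrite oner_eq0.
Qed.

Lemma bpairP c z : bdom c z -> on_blowup (bpair c z).
Proof.
move=> dz; rewrite /on_blowup /= dim_vline bpoint_neq0 eqxx /=.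
apply/forallP => i; rewrite ffunE.
have [e|ne] := eqVneq (sval c).2 (Some i).
  have [d0 dn] := bdir_center z e.
  rewrite (frame_center e) dim_line2 ?row0_neq0 ?frame_unit// eqxx /=.
  rewrite subv_add addvSl /= -memvE (bpoint_some z e).
  by apply: memv_add; rewrite ?memvZ ?memv_line.
rewrite /bdir (negbTE ne) subvv andbT.
have [q q0 pq] := P2_gen (p i).
by rewrite pq dim_line2 ?bpoint_neq0// eq_sym -pq dz.
Qed.

Lemma blowup_inhabited : exists P, on_blowup P.
Proof.
pose x := <[(vec3 1 0 0)%R]>%VS.
exists (x, [ffun i => if sval (p i) == x then (x + <[(vec3 0 1 0)%R]>)%VS
                      else (sval (p i) + x)%VS]).
have v0 : vec3 1 0 0 != 0.
  by apply/eqP => /rowP/(_ 0); rewrite vec3E mxE => /eqP; rewrite oner_eq0.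
have w0 : vec3 0 1 0 != 0.
  by apply/eqP => /rowP/(_ 1); rewrite vec3E mxE => /eqP; rewrite oner_eq0.
rewrite /on_blowup /= dim_vline v0 /=; apply/forallP => i; rewrite ffunE.
have [->|ne] := eqVneq (sval (p i)) x; last first.
  have [q q0 pq] := P2_gen (p i).
  by rewrite subvv andbT pq dim_line2// -?pq// eqxx.
rewrite addvv addvSl andbT dim_line2//.
apply/eqP => /(vline_eqP v0 w0)[a _ /rowP/(_ 0)]; rewrite !mxE /= mulr0.
by move=> /eqP; rewrite oner_eq0.
Qed.

Definition blowup_pt0 : blowup_pt :=
  exist _ (xchoose blowup_inhabited) (xchooseP blowup_inhabited).

(* Only the values on [bdom c] matter. *)
Definition bpar (c : frame) (z : 'rV[C]_2) : blowup_pt :=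
  insubd blowup_pt0 (bpair c z).

Lemma bparE c z : bdom c z -> sval (bpar c z) = bpair c z.
Proof. by move=> /bpairP h; rewrite /bpar [LHS](insubdK _ h). Qed.

(* A point of the blow-up is determined by its image x in the plane, and by l_i
   when x = p_i. *)
Lemma blowup_pt_eq (P Q : blowup_pt) : (sval P).1 = (sval Q).1 ->
  (forall i, (sval P).1 = sval (p i) -> (sval P).2 i = (sval Q).2 i) -> P = Q.
Proof.
case: P => -[x l] /= hP; have /andP[/= dx /forallP hl] := hP.
case: Q => -[x' m] /= hQ xx'; subst x'; move=> e.
suff lm : l = m by subst m; congr exist; exact: bool_irrelevance.
apply/ffunP => i; case: (eqVneq x (sval (p i))) => [/e//|ne].
have /andP[_ /forallP hm] := hQ.
have [q q0 pq] := P2_gen (p i).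
have [v v0 xv] := P2_gen (exist _ x dx).
have d2 : \dim (sval (p i) + x) = 2%N.
  by rewrite /= in xv; rewrite xv pq dim_line2// -pq -xv eq_sym.
have := hl i; have := hm i; rewrite /= => /andP[/eqP dm sm] /andP[/eqP dl sl].
transitivity (sval (p i) + x)%VS; last first.
  by apply/eqP; rewrite eqEdim sm dm d2.
by apply/esym/eqP; rewrite eqEdim sl dl d2.
Qed.

Lemma mulmx3E (u : 'rV[C]_3) (N : 'M[C]_3) k :
  (u *m N) 0 k = u 0 0 * N 0 k + u 0 1 * N 1 k + u 0 2%:R * N 2%:R k.
Proof.
rewrite mxE !big_ord_recl big_ord0 addr0 addrA.
by congr (_ * N _ _ + _ * N _ _ + _ * N _ _); try congr (u _ _); exact: val_inj.
Qed.

Lemma differentiable_vec3_mul (a b d : 'rV[C]_2 -> C) (N : 'M[C]_3) k z :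
  differentiable a z -> differentiable b z -> differentiable d z ->
  differentiable (fun w => (vec3 (a w) (b w) (d w) *m N) 0 k) z.
Proof.
move=> da db dd.
rewrite (_ : (fun w => _) = (fun w => a w * N 0 k + b w * N 1 k + d w * N 2%:R k)); last first.
  by apply/funext => w; rewrite mulmx3E !vec3E.
apply: differentiableD; last by apply: differentiableM => //; exact: differentiable_cst.
by apply: differentiableD; apply: differentiableM => //; exact: differentiable_cst.
Qed.

Lemma differentiable_bpoint c (N : 'M[C]_3) k z :
  differentiable (fun w => (bpoint c w *m N) 0 k) z.
Proof.
have d1 (i : 'I_2) : differentiable (fun w : 'rV[C]_2 => w 0 i : C) z.
  exact: differentiable_coord.
have dc (a : C) : differentiable (fun w : 'rV[C]_2 => a) z by exact: differentiable_cst.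
rewrite /bpoint; case: ((sval c).2) => [j|];
  under eq_fun do rewrite -mulmxA.
- apply: (differentiable_vec3_mul (a := fun=> 1)); [exact: dc | exact: d1 |].
  by apply: differentiableM; exact: d1.
- by apply: (differentiable_vec3_mul (a := fun=> 1));
    [exact: dc | exact: d1 | exact: d1].
Qed.

Lemma differentiable_bdir c (N : 'M[C]_3) i k z :
  differentiable (fun w => (bdir c w i *m N) 0 k) z.
Proof.
rewrite /bdir; case: (_ == _); last exact: differentiable_bpoint.
under eq_fun do rewrite -mulmxA.
apply: (differentiable_vec3_mul (a := fun=> 0) (b := fun=> 1)).
- exact: differentiable_cst.
- exact: differentiable_cst.
- exact: differentiable_coord.
Qed.

Lemma differentiable_near_neq0 (f : 'rV[C]_2 -> C) z :
  differentiable f z -> f z != 0 -> \forall w \near z, f w != 0.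
Proof.
by move=> /differentiable_continuous cf fz; exact: (cvgr_neq0 _ cf fz).
Qed.

Lemma bpoint_coords c z : bpoint c z *m invmx (sval c).1 =
  if (sval c).2 is Some _ then vec3 1 (z 0 0) (z 0 0 * z 0 1)
  else vec3 1 (z 0 0) (z 0 1).
Proof. by rewrite /bpoint mulmxK ?frame_unit. Qed.

Lemma vline_minorsP (v w : 'rV[C]_3) : v != 0 -> w != 0 ->
  (forall a b, v 0 a * w 0 b = v 0 b * w 0 a) -> <[v]>%VS = <[w]>%VS.
Proof.
move=> v0 w0 h.
have [b wb] : exists b, w 0 b != 0.
  apply/existsP; apply: contraNT w0 => /existsPn e; apply/eqP/rowP => b.
  by rewrite mxE; apply/eqP; rewrite -[_ == _]negbK e.
have e : v = (v 0 b / w 0 b) *: w.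
  by apply/rowP => a; rewrite mxE mulrAC -h mulfK.
rewrite e vlineZ//; apply: contraNN v0 => /eqP c0.
by rewrite e c0 scale0r.
Qed.

Lemma near_bpoint_neq c z i : <[bpoint c z]>%VS != sval (p i) ->
  \forall w \near z, <[bpoint c w]>%VS != sval (p i).
Proof.
have [q q0 ->] := P2_gen (p i) => ne.
have [[a b] /= hab] : exists ab : 'I_3 * 'I_3,
    bpoint c z 0 ab.1 * q 0 ab.2 - bpoint c z 0 ab.2 * q 0 ab.1 != 0.
  apply/existsP; apply: contraNT ne => /existsPn e; apply/eqP.
  apply: vline_minorsP => //; first exact: bpoint_neq0.
  by move=> a b; apply/eqP; rewrite -subr_eq0 -[_ == _]negbK (e (a, b)).
have df k : differentiable (fun w => bpoint c w 0 k) z.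
  by have := differentiable_bpoint c 1%:M k z; under eq_fun do rewrite mulmx1.
have : \forall w \near z, bpoint c w 0 a * q 0 b - bpoint c w 0 b * q 0 a != 0.
  apply: (@differentiable_near_neq0
    (fun w => bpoint c w 0 a * q 0 b - bpoint c w 0 b * q 0 a)); last exact: hab.
  by apply: differentiableB; apply: differentiableM;
    [exact: df | exact: differentiable_cst | exact: df | exact: differentiable_cst].
apply: filterS => w; apply: contra_neq.
move=> /(vline_eqP (bpoint_neq0 c w) q0)[d _ ->]; rewrite !mxE; apply/eqP.
by rewrite subr_eq0 mulrAC.
Qed.

Lemma near_bdom (o : option 'I_9) c z :
  (forall i, o != Some i -> <[bpoint c z]>%VS != sval (p i)) ->
  \forall w \near z, forall i, o != Some i -> <[bpoint c w]>%VS != sval (p i).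
Proof.
move=> h.
pose f i : set 'rV[C]_2 := [set w | o != Some i -> <[bpoint c w]>%VS != sval (p i)].
have h' : \forall w \near z, forall i, f i w; last exact: h'.
have h2 := @filter_forall _ _ f (nbhs z) _ _; apply: h2 => i.
have [e|oi] := eqVneq o (Some i).
  by apply: nearW => w; rewrite /f /= e eqxx.
by have := near_bpoint_neq (h i oi); apply: filterS => w hw _.
Qed.

Lemma bdom_open c : open (bdom c).
Proof.
rewrite openE => z dz; exact: (near_bdom dz).
Qed.

Lemma mem_line2_coords (M : 'M[C]_3) t (v : 'rV[C]_3) : M \in unitmx ->
  v \in (<[row ord0 M]> + <[(vec3 0 1 t *m M)%R]>)%VS ->
  (v *m invmx M) 0 2%:R = t * (v *m invmx M) 0 1.
Proof.
move=> uM /memv_addP[_ /vlineP[a ->] [_ /vlineP[b ->] ->]].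
by rewrite rowE !scalemxAl -mulmxDl mulmxK// !mxE /= !mulr0 !add0r mulr1 mulrC.
Qed.

Lemma line2_eq (u v : 'rV[C]_3) a b : b != 0 ->
  (<[v]> + <[(a *: v + b *: u)%R]> = <[v]> + <[u]>)%VS.
Proof.
move=> b0; apply/eqP; rewrite eqEsubv !subv_add !addvSl /= -!memvE.
apply/andP; split; first by apply: memv_add; rewrite ?memvZ ?memv_line.
suff e : u = - (a / b) *: v + b^-1 *: (a *: v + b *: u).
  by rewrite {1}e; apply: memv_add; rewrite ?memvZ ?memv_line.
by rewrite scalerDr !scalerA mulVf// scale1r [b^-1 * a]mulrC addrA -scalerDl addNr scale0r add0r.
Qed.

Lemma bpar_line c z : bdom c z -> (sval (bpar c z)).1 = <[bpoint c z]>%VS.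
Proof. by move=> dz; rewrite bparE. Qed.

Lemma bpar_dir c z i : bdom c z ->
  (sval (bpar c z)).2 i = (sval (p i) + <[bdir c z i]>)%VS.
Proof. by move=> dz; rewrite bparE//= ffunE. Qed.

Lemma row2P (z w : 'rV[C]_2) : z 0 0 = w 0 0 -> z 0 1 = w 0 1 -> z = w.
Proof.
move=> e0 e1; apply/rowP => -[[|[|//]]] h.
- by rewrite [Ordinal h](_ : _ = 0)//; exact: val_inj.
- by rewrite [Ordinal h](_ : _ = 1)//; exact: val_inj.
Qed.

Lemma bpar_inj c : set_inj (bdom c) (bpar c).
Proof.
move=> z w /set_mem dz /set_mem dw e.
have := bpar_line dz; rewrite e (bpar_line dw).
move=> /(vline_eqP (bpoint_neq0 _ _) (bpoint_neq0 _ _))[a a0].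
move=> /(congr1 (mulmx^~ (invmx (sval c).1))).
rewrite -scalemxAl !bpoint_coords.
case E : ((sval c).2) => [j|] /rowP h.
- have := h 0; have := h 1; rewrite !mxE /= mulr1 => zw a1.
  move: zw; rewrite -a1 mul1r => zw; apply: row2P; first exact: esym zw.
  have dj : bdir c w j \in (sval (bpar c z)).2 j.
    by rewrite e (bpar_dir _ dw) memvE addvSr.
  move: dj; rewrite (bpar_dir _ dz) (frame_center E) {2}/bdir E eqxx.
  move=> /(mem_line2_coords (frame_unit c)).
  rewrite /bdir E eqxx (mulmxK (frame_unit c)) vec3E2 vec3E1 mulr1. exact: esym.
- have := h 0; have := h 1; have := h 2%:R; rewrite !mxE /= mulr1 => e2 e1 a1'.
  by move: e2 e1; rewrite -a1' !mul1r => e2 e1; apply: row2P; apply: esym.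
Qed.

Lemma bpar_trans_aux c c' z z' (g1 : 'rV[C]_2 -> C) :
  let n w k := (bpoint c' w *m invmx (sval c).1) 0 k in
  bdom c z -> bdom c' z' -> bpar c' z' = bpar c z ->
  differentiable g1 z' ->
  (\forall w \near z',
    let g := \row_k [:: n w 1 / n w 0; g1 w]`_k in
    (if (sval c).2 is Some _ then n w 1 / n w 0 * g1 w else g1 w) = n w 2%:R / n w 0 /\
    forall j, (sval c).2 = Some j -> <[bpoint c' w]>%VS = sval (p j) ->
      (sval (p j) + <[bdir c g j]>)%VS = (sval (p j) + <[bdir c' w j]>)%VS) ->
  exists g, [/\ differentiable g z', g z' = z &
    \forall w \near z', bdom c (g w) /\ bpar c (g w) = bpar c' w].
Proof.
move=> n dz dz' e dg1 hg.
pose g w : 'rV[C]_2 := \row_k [:: n w 1 / n w 0; g1 w]`_k.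
have dn k : differentiable (n ^~ k) z' by exact: differentiable_bpoint.
have ee : <[bpoint c' z']>%VS = <[bpoint c z]>%VS.
  by rewrite -(bpar_line dz') e (bpar_line dz).
have n0 : n z' 0 != 0.
  have [a a0 ea] := vline_eqP (bpoint_neq0 _ _) (bpoint_neq0 _ _) ee.
  rewrite /n ea -scalemxAl mxE bpoint_coords.
  by case: ((sval c).2) => [j|]; rewrite vec3E mulr1.
have dg : differentiable g z'.
  rewrite (_ : g = (fun w => (n w 1 / n w 0) *: delta_mx 0 0 + g1 w *: delta_mx 0 1)); last first.
    by apply/funext => w; apply: row2P; rewrite !mxE /= ?(mulr0, mulr1, addr0, add0r).
  apply: differentiableD; apply: differentiableZl; last exact: dg1.
  by apply: differentiableM; [exact: dn | apply: differentiableV; [exact: dn | done]].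
have hnear : \forall w \near z', bdom c (g w) /\ bpar c (g w) = bpar c' w.
  have h1 : \forall w \near z', n w 0 != 0.
    exact: (differentiable_near_neq0 (dn 0) n0).
  have h2 : \forall w \near z', forall i, (sval c).2 != Some i -> <[bpoint c' w]>%VS != sval (p i).
    by apply: near_bdom => i; rewrite ee; exact: dz.
  have h3 : \forall w \near z', bdom c' w by exact: near_bdom dz'.
  near=> w.
  have nw : n w 0 != 0 by near: w; exact: h1.
  have [gw1 gw2] : let g := \row_k [:: n w 1 / n w 0; g1 w]`_k in
    (if (sval c).2 is Some _ then n w 1 / n w 0 * g1 w else g1 w) = n w 2%:R / n w 0 /\
    forall j, (sval c).2 = Some j -> <[bpoint c' w]>%VS = sval (p j) ->
      (sval (p j) + <[bdir c g j]>)%VS = (sval (p j) + <[bdir c' w j]>)%VS by near: w.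
  rewrite -/(g w) in gw2.
  have pw : bpoint c (g w) = (n w 0)^-1 *: bpoint c' w.
    apply: (can_inj (mulmxKV (frame_unit c))).
    rewrite -scalemxAl bpoint_coords [X in _ = _ *: X]vec3_eta.
    rewrite -/(n w 0) -/(n w 1) -/(n w 2%:R).
    have -> : (if (sval c).2 is Some _ then vec3 1 (g w 0 0) (g w 0 0 * g w 0 1)
       else vec3 1 (g w 0 0) (g w 0 1)) =
      vec3 1 (n w 1 / n w 0) (n w 2%:R / n w 0).
      by rewrite -gw1; case: ((sval c).2) => [j|]; rewrite !mxE.
    rewrite [RHS]vec3_eta; congr vec3; rewrite [RHS]mxE.
    + by rewrite vec3E0 mulVf.
    + by rewrite vec3E1 mulrC.
    + by rewrite vec3E2 mulrC.
  have lw : <[bpoint c (g w)]>%VS = <[bpoint c' w]>%VS by rewrite pw vlineZ// invr_eq0.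
  have dw : forall i, (sval c).2 != Some i -> <[bpoint c' w]>%VS != sval (p i) by near: w.
  have dgw : bdom c (g w) by move=> i; rewrite lw; exact: dw.
  have dw' : bdom c' w by near: w.
  split; first exact: dgw.
  apply: blowup_pt_eq; first by rewrite (bpar_line dgw) (bpar_line dw').
  move=> i; rewrite (bpar_line dgw) lw => xi.
  have /eqP ci : (sval c).2 == Some i.
    by apply: contraT => /dw; rewrite xi eqxx.
  rewrite (bpar_dir _ dgw) (bpar_dir _ dw'); exact: gw2.
exists g; split; [exact: dg | | exact: hnear].
have [dgz egz] := nbhs_singleton hnear.
by apply: (@bpar_inj c); [exact: mem_set | exact: mem_set | rewrite egz].
Unshelve. all: by end_near. Qed.

Lemma bpar_trans c c' z z' : bdom c z -> bdom c' z' -> bpar c' z' = bpar c z ->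
  exists g, [/\ differentiable g z', g z' = z &
    \forall w \near z', bdom c (g w) /\ bpar c (g w) = bpar c' w].
Proof.
move=> dz dz' e.
pose n w k : C := (bpoint c' w *m invmx (sval c).1) 0 k.
have dn k : differentiable (n ^~ k) z' by exact: differentiable_bpoint.
have ee : <[bpoint c' z']>%VS = <[bpoint c z]>%VS.
  by rewrite -(bpar_line dz') e (bpar_line dz).
have [a a0 ea] := vline_eqP (bpoint_neq0 _ _) (bpoint_neq0 _ _) ee.
have n0 : n z' 0 != 0.
  rewrite /n ea -scalemxAl mxE bpoint_coords.
  by case: ((sval c).2) => [j|]; rewrite vec3E mulr1.
have n0near : \forall w \near z', n w 0 != 0.
  exact: (differentiable_near_neq0 (dn 0) n0).
case E : ((sval c).2) => [j|]; last first.
  apply: (bpar_trans_aux dz dz' e (g1 := fun w => n w 2%:R / n w 0)).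
    by apply: differentiableM; [exact: dn | apply: differentiableV; [exact: dn | done]].
  by near=> w; rewrite E; split.
have [E'|E'] := eqVneq (sval c').2 (Some j); last first.
  have xj : <[bpoint c' z']>%VS != sval (p j) by exact: dz'.
  have n1 : n z' 1 != 0.
    rewrite /n ea -scalemxAl mxE bpoint_coords E vec3E mulf_neq0//.
    apply: contraNN xj => /eqP z0.
    by rewrite ee (frame_center E) (bpoint_some z E) z0 scale0r addr0.
  have n1near : \forall w \near z', n w 1 != 0.
    exact: (differentiable_near_neq0 (dn 1) n1).
  have xnear := near_bpoint_neq xj.
  apply: (bpar_trans_aux dz dz' e (g1 := fun w => n w 2%:R / n w 1)).
    by apply: differentiableM; [exact: dn | apply: differentiableV; [exact: dn | done]].
  near=> w; rewrite E; split.
    rewrite -/(n w 1) -/(n w 0) -/(n w 2%:R).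
    have nw : n w 1 != 0 by near: w.
    by rewrite mulrC mulrA divfK.
  move=> _ [<-] xw; exfalso.
  have : <[bpoint c' w]>%VS != sval (p j) by near: w.
  by rewrite xw eqxx.
pose m w k : C := (bdir c' w j *m invmx (sval c).1) 0 k.
have dm k : differentiable (m ^~ k) z' by exact: differentiable_bdir.
have mE w : bdir c' w j = m w 0 *: row ord0 (sval c).1 + vec3 0 (m w 1) (m w 2%:R) *m (sval c).1.
  rewrite -[LHS](mulmxKV (frame_unit c)) rowE scalemxAl -mulmxDl; congr (_ *m _).
  rewrite [RHS]vec3_eta [LHS]vec3_eta -/(m w 0) -/(m w 1) -/(m w 2%:R).
  by congr vec3; rewrite !mxE /= ?(mulr0, mulr1, addr0, add0r).
have pj : <[row ord0 (sval c').1]>%VS = <[row ord0 (sval c).1]>%VS.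
  by rewrite -(frame_center E) -(frame_center E').
have m2 : m z' 2%:R = z 0 1 * m z' 1.
  apply: mem_line2_coords; first exact: frame_unit.
  have : bdir c' z' j \in (sval (bpar c' z')).2 j.
    by rewrite (bpar_dir _ dz') memvE addvSr.
  by rewrite e (bpar_dir _ dz) (frame_center E) {2}/bdir E eqxx.
have m1 : m z' 1 != 0.
  have [d0 dn'] := bdir_center z' E'.
  apply: contraNN dn' => /eqP m10; move: d0.
  have -> : bdir c' z' j = m z' 0 *: row ord0 (sval c).1.
    rewrite mE m2 m10 mulr0 [vec3 _ _ _](_ : _ = 0) ?mul0mx ?addr0//.
    by rewrite [RHS]vec3_eta; congr vec3; rewrite mxE.
  move=> d0; rewrite vlineZ ?pj//; apply: contraNN d0 => /eqP ->.
  by rewrite scale0r.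
have m1near : \forall w \near z', m w 1 != 0.
  exact: (differentiable_near_neq0 (dm 1) m1).
apply: (bpar_trans_aux dz dz' e (g1 := fun w => m w 2%:R / m w 1)).
  by apply: differentiableM; [exact: dm | apply: differentiableV; [exact: dm | done]].
have [l l0 el] := vline_eqP (row0_neq0 (frame_unit c')) (row0_neq0 (frame_unit c)) pj.
have nE w : n w 1 = w 0 0 * m w 1 /\ n w 2%:R = w 0 0 * m w 2%:R.
  have e0 : row ord0 (sval c).1 *m invmx (sval c).1 = delta_mx 0 0.
    by rewrite rowE (mulmxK (frame_unit c)).
  have nk k : n w k = l * (delta_mx 0 0 : 'rV[C]_3) 0 k + w 0 0 * m w k.
    rewrite /n (bpoint_some w E') el mulmxDl -!scalemxAl e0 mxE.
    by congr (_ + _); rewrite [LHS]mxE.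
  by rewrite !nk [X in l * X]mxE [X in _ /\ l * X + _ = _]mxE /= mulr0 !add0r; split; reflexivity.
near=> w; rewrite E /=; rewrite -/(n w 1) -/(n w 0) -/(n w 2%:R).
have mw : m w 1 != 0 by near: w.
have [-> ->] := nE w.
split.
  by rewrite mulrAC; congr (_ / _); rewrite -mulrA [m w 1 * _]mulrC divfK.
move=> _ [<-] _; rewrite (frame_center E) (mE w) /bdir E eqxx.
have -> : vec3 0 (m w 1) (m w 2%:R) = m w 1 *: vec3 0 1 (m w 2%:R / m w 1).
  rewrite [RHS]vec3_eta; congr vec3; rewrite !mxE /= ?mulr0 ?mulr1//.
  by rewrite mulrC divfK.
rewrite -scalemxAl line2_eq; last exact: mw.
by congr (_ + <[_ *m _]>)%VS; congr vec3; rewrite mxE.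
Unshelve. all: by end_near. Qed.

Lemma frame3 (v w u : 'rV[C]_3) : v != 0 -> w \notin <[v]>%VS ->
  u \notin (<[v]> + <[w]>)%VS ->
  exists M : 'M[C]_3, [/\ M \in unitmx, row ord0 M = v, row 1 M = w & row 2%:R M = u].
Proof.
move=> v0 wv uU.
pose M : 'M[C]_3 := \matrix_(i, j) [:: v; w; u]`_i 0 j.
have r0 : row ord0 M = v by apply/rowP => k; rewrite !mxE.
have r1 : row 1 M = w by apply/rowP => k; rewrite !mxE.
have r2 : row 2%:R M = u by apply/rowP => k; rewrite !mxE.
exists M; split => //.
rewrite -row_free_unit; apply: inj_row_free => a.
rewrite mulmx_sum_row !big_ord_recl big_ord0 addr0.
have -> : lift ord0 (ord0 : 'I_2) = 1 by exact: val_inj.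
have -> : lift ord0 (lift ord0 (ord0 : 'I_1)) = 2%:R by exact: val_inj.
rewrite r0 r1 r2 addrA => e.
have a2 : a 0 2%:R = 0.
  apply/eqP; apply: contraNT uU => a2.
  have -> : u = (a 0 2%:R)^-1 *: (- (a 0 0 *: v + a 0 1 *: w)).
    rewrite -[- _](addKr (a 0 0 *: v + a 0 1 *: w)) subrr addr0 in e *.
    have -> : - (a 0 0 *: v + a 0 1 *: w) = a 0 2%:R *: u.
      by apply/eqP; rewrite eq_sym -addr_eq0 addrC e.
    by rewrite scalerA mulVf// scale1r.
  by rewrite memvZ// memvN memv_add// memvZ// memv_line.
move: e; rewrite a2 scale0r addr0 => e.
have a1 : a 0 1 = 0.
  apply/eqP; apply: contraNT wv => a1.
  have -> : w = (a 0 1)^-1 *: (- (a 0 0 *: v)).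
    have -> : - (a 0 0 *: v) = a 0 1 *: w.
      by apply/eqP; rewrite eq_sym -addr_eq0 addrC e.
    by rewrite scalerA mulVf// scale1r.
  by rewrite memvZ// memvN memvZ// memv_line.
move: e; rewrite a1 scale0r addr0 => /eqP; rewrite scaler_eq0 (negbTE v0) orbF => /eqP a0.
by rewrite [a]vec3_eta a0 a1 a2; apply/rowP => k; rewrite !mxE; case: k => -[|[|[|]]].
Qed.

Lemma complete_frame (v w : 'rV[C]_3) : v != 0 -> w \notin <[v]>%VS ->
  exists M : 'M[C]_3, [/\ M \in unitmx, row ord0 M = v & row 1 M = w].
Proof.
move=> v0 wv.
have w0 : w != 0 by apply: contraNneq wv => ->; rewrite mem0v.
have d2 : \dim (<[v]> + <[w]>) = 2%N.
  by apply: dim_line2 => //; apply: contraNneq wv => ->; rewrite memv_line.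
have /subvPn[u _ uU] : ~~ (fullv <= <[v]> + <[w]>)%VS.
  by apply/negP => /dimvS; rewrite d2 dimvf.
by have [M [uM r0 r1 _]] := frame3 v0 wv uU; exists M.
Qed.

Lemma line2_gen (l : {vspace 'rV[C]_3}) v : \dim l = 2%N -> v != 0 -> v \in l ->
  exists2 w, w \notin <[v]>%VS & l = (<[v]> + <[w]>)%VS.
Proof.
move=> dl v0 vl.
have /subvPn[w wl wv] : ~~ (l <= <[v]>)%VS.
  by apply/negP => /dimvS; rewrite dl dim_vline v0.
exists w => //; apply/esym/eqP; rewrite eqEdim subv_add -!memvE vl wl dl /=.
rewrite dim_line2//; last by apply: contraNneq wv => ->; rewrite memv_line.
by apply: contraNneq wv => ->; rewrite mem0v.
Qed.

Lemma bpoint0 c (z : 'rV[C]_2) :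
  z 0 0 = 0 -> ((sval c).2 = None -> z 0 1 = 0) -> bpoint c z = row ord0 (sval c).1.
Proof.
move=> z0 z1; rewrite rowE /bpoint.
have -> : delta_mx 0 ord0 = vec3 1 0 0 by rewrite [LHS]vec3_eta !mxE.
by case: ((sval c).2) z1 => [j _|->//]; rewrite z0 ?mul0r.
Qed.

Lemma near_eq_diff (V W : normedModType C) (f g : V -> W) x :
  (\forall w \near x, f w = g w) -> differentiable g x -> differentiable f x.
Proof.
move=> fg dg.
have fgx : f x = g x by exact: nbhs_singleton fg.
have [dgc dge] := (diff_locallyP _ _).1 dg.
have e : f \o shift x = cst (f x) + 'd g x +o_ 0 id.
  apply/eqaddoP => eps eps0.
  move/eqaddoP : dge => /(_ eps eps0).
  apply: filter_app; move: fg; rewrite (near_shift 0 x) subr0.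
  apply: filter_app; near=> h => /= fgh.
  by rewrite !fctE /= /cst /= fgx -fgh.
apply/diff_locallyP; rewrite (diff_unique dgc e); split; [exact: dgc | exact: e].
Unshelve. all: by end_near. Qed.

Lemma bpar_diff c c' z : bdom c z -> (bpar c' @` bdom c') (bpar c z) ->
  differentiable
    (fun w => xget 0 [set w' | bdom c' w' /\ bpar c' w' = bpar c w]) z.
Proof.
move=> dz [z' dz' e].
have [g [dg _ ng]] := bpar_trans dz' dz (esym e).
apply: near_eq_diff dg; apply: filterS ng => w [dgw gw].
apply: xget_unique; first by [].
move=> w' [dw' e'].
exact: (bpar_inj (mem_set dw') (mem_set dgw) (etrans e' (esym gw))).
Qed.

(* The topology for which all charts are homeomorphisms onto open subsets. *)
Definition bopen (U : set blowup_pt) : Prop :=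
  forall c, open (bdom c `&` bpar c @^-1` U).

Lemma bopenT : bopen setT.
Proof. by move=> c; rewrite preimage_setT setIT; exact: bdom_open. Qed.

Lemma bopenI : setI_closed bopen.
Proof. by move=> A B oA oB c; rewrite preimage_setI setIIr; exact: openI. Qed.

Lemma bopen_bigU (I : Type) (f : I -> set blowup_pt) :
  (forall i, bopen (f i)) -> bopen (\bigcup_i f i).
Proof.
move=> of_ c; rewrite preimage_bigcup setI_bigcupr.
by apply: bigcup_open => i _; exact: of_.
Qed.

HB.instance Definition _ := Choice.copy blowup_pt {P | on_blowup P}.
HB.instance Definition _ :=
  isOpenTopological.Build blowup_pt bopenT bopenI bopen_bigU.

Lemma bopenE (U : set blowup_pt) : open U = bopen U.
Proof. by []. Qed.

Lemma bpar_homeo c (W : set 'rV[C]_2) : W `<=` bdom c ->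
  open W <-> open (bpar c @` W).
Proof.
move=> Wc; rewrite bopenE; split; last first.
  move=> /(_ c); congr open; rewrite eqEsubset; split => [z [dz [w Ww e]]|z Wz].
    suff -> : z = w by [].
    exact: (bpar_inj (mem_set dz) (mem_set (Wc _ Ww)) (esym e)).
  by split; [exact: Wc | exists z].
move=> oW c'; rewrite openE => z' [dz' [z Wz e]].
have [g [dg gz ng]] := bpar_trans (Wc _ Wz) dz' (esym e).
have nW : \forall w \near z', W (g w).
  apply: (differentiable_continuous dg); rewrite gz; exact: open_nbhs_nbhs.
have nd : \forall w \near z', bdom c' w by apply: open_nbhs_nbhs; split=> //; exact: bdom_open.
near=> w; split; first by near: w.
exists (g w); first by near: w.
by have [] : bdom c (g w) /\ bpar c (g w) = bpar c' w by near: w.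
Unshelve. all: by end_near. Qed.

Hypothesis p_inj : injective p.

Lemma sval_p_inj i j : sval (p i) = sval (p j) -> i = j.
Proof. by move=> e; apply/p_inj/val_inj. Qed.

Lemma bpar_cover P : exists c, (bpar c @` bdom c) P.
Proof.
have /andP[dx /forallP hl] := valP P.
have [v v0 /= xv] := P2_gen (exist _ (sval P).1 dx).
have [/existsP[j /eqP xj]|] := boolP [exists j, sval (p j) == (sval P).1].
- have /andP[/eqP dl sl] := hl j.
  have vl : v \in (sval P).2 j.
    by apply: (subvP sl); rewrite memvE -xv -xj addvv subvv.
  have [w wv lw] := line2_gen dl v0 vl.
  have [M [uM r0 r1]] := complete_frame v0 wv.
  have fM : is_frame (M, Some j) by rewrite /is_frame /= uM r0 -xv xj eqxx.
  pose c : frame := exist _ (M, Some j) fM.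
  have b0 : bpoint c 0 = v by rewrite bpoint0 ?mxE.
  have dz : bdom c 0.
    move=> i; rewrite b0 -xv -xj => ij; apply: contraNneq ij => /sval_p_inj <-.
    by rewrite /= eqxx.
  exists c, 0 => //; apply: blowup_pt_eq; rewrite (bpar_line dz) b0 -xv// => i.
  rewrite -xj => /sval_p_inj <-; rewrite (bpar_dir _ dz) xj xv lw.
  congr (_ + <[_]>)%VS; rewrite /bdir eqxx -r1 rowE; congr (_ *m _).
  by rewrite [RHS]vec3_eta !mxE.
- rewrite negb_exists => /forallP ne.
  have /subvPn[w _ wv] : ~~ (fullv <= <[v]>)%VS.
    by apply/negP => /dimvS; rewrite dim_vline v0 dimvf.
  have [M [uM r0 r1]] := complete_frame v0 wv.
  have fM : is_frame (M, None) by rewrite /is_frame /= uM.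
  pose c : frame := exist _ (M, None) fM.
  have b0 : bpoint c 0 = v by rewrite bpoint0 ?mxE.
  have dz : bdom c 0 by move=> i _; rewrite b0 -xv eq_sym.
  exists c, 0 => //; apply: blowup_pt_eq; rewrite (bpar_line dz) b0 -xv// => i xi.
  by have := ne i; rewrite -xi eqxx.
Qed.

(* The points x for which the a-th coordinate dominates the b-th one. *)
Let dominated (M : 'M[C]_3) (a b : 'I_3) : set blowup_pt :=
  [set P | exists v, [/\ (sval P).1 = <[v]>%VS, (v *m invmx M) 0 a != 0 &
     `|(v *m invmx M) 0 b| < `|(v *m invmx M) 0 a|]].

Let dominated_open M a b : open (dominated M a b).
Proof.
rewrite bopenE => c; rewrite openE => z [dz [v [/= ev va vab]]].
pose n k w := (bpoint c w *m invmx M) 0 k : C.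
have dn k : differentiable (n k) z by exact: differentiable_bpoint.
have v0 : v != 0 by apply: contraNneq va => ->; rewrite mul0mx mxE.
have [l l0 el] := vline_eqP (bpoint_neq0 c z) v0
  (etrans (esym (bpar_line dz)) ev).
have nz k : n k z = l * (v *m invmx M) 0 k by rewrite /n el -scalemxAl mxE.
have na : n a z != 0 by rewrite nz mulf_neq0.
have dq : differentiable (fun w => n b w / n a w) z.
  by apply: differentiableM; [exact: dn | apply: differentiableV; [exact: dn | exact: na]].
have q1 : `|n b z / n a z| < 1.
  rewrite normf_div ltr_pdivrMr ?normr_gt0// mul1r !nz !normrM.
  by rewrite ltr_pM2l ?normr_gt0.
have nq : \forall w \near z, `|n b w / n a w| < 1.
  exact: (cvgr_norm_lt _ (differentiable_continuous dq) _ q1).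
have nna : \forall w \near z, n a w != 0 by exact: (differentiable_near_neq0 (dn a) na).
have nd : \forall w \near z, bdom c w by apply: open_nbhs_nbhs; split=> //; exact: bdom_open.
near=> w.
have dw : bdom c w by near: w.
have naw : n a w != 0 by near: w.
split=> //; exists (bpoint c w); split; [exact: (bpar_line dw) | exact: naw |].
have : `|n b w / n a w| < 1 by near: w.
by rewrite normf_div ltr_pdivrMr ?normr_gt0// mul1r.
Unshelve. all: by end_near. Qed.

Let dominated_disj M a b : dominated M a b `&` dominated M b a = set0.
Proof.
rewrite -subset0 => P [[v [ev va hv]] [w [ew wb hw]]].
have v0 : v != 0 by apply: contraNneq va => ->; rewrite mul0mx mxE.
have w0 : w != 0 by apply: contraNneq wb => ->; rewrite mul0mx mxE.
have [l l0 el] := vline_eqP v0 w0 (etrans (esym ev) ew).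
have nv k : (v *m invmx M) 0 k = l * (w *m invmx M) 0 k by rewrite el -scalemxAl mxE.
move: hv; rewrite !nv !normrM ltr_pM2l ?normr_gt0//.
by move=> /(lt_trans hw); rewrite ltxx.
Qed.

Lemma blowup_hausdorff : hausdorff_space blowup_pt.
Proof.
rewrite open_hausdorff => P Q PQ.
have /andP[dxP _] := valP P; have /andP[dxQ _] := valP Q.
have [v v0 /= xv] := P2_gen (exist _ (sval P).1 dxP).
have [w w0 /= xw] := P2_gen (exist _ (sval Q).1 dxQ).
have [xx|xx] := eqVneq (sval P).1 (sval Q).1; last first.
  have wv : w \notin <[v]>%VS.
    apply: contraNN xx => /vlineP[k wk]; rewrite xv xw wk vlineZ//.
    by apply: contraNneq w0 => k0; rewrite wk k0 scale0r.
  have [M [uM r0 r1]] := complete_frame v0 wv.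
  have nv : v *m invmx M = delta_mx 0 0 by rewrite -r0 rowE mulmxK.
  have nw : w *m invmx M = delta_mx 0 1 by rewrite -r1 rowE mulmxK.
  exists (dominated M 0 1, dominated M 1 0).
    split; apply: mem_set.
      by exists v; rewrite nv !mxE /= normr1 normr0 ltr01 oner_neq0.
    by exists w; rewrite nw !mxE /= normr1 normr0 ltr01 oner_neq0.
  by split=> /=; [exact: dominated_open | exact: dominated_open |
    rewrite dominated_disj].
have [j xj lj] : exists2 j, (sval P).1 = sval (p j) & (sval P).2 j <> (sval Q).2 j.
  apply: contrapT => h; move/eqP: PQ; apply; apply: blowup_pt_eq => // i xi.
  by apply: contrapT => hi; apply: h; exists i.
have /andP[_ /forallP/(_ j)/andP[/eqP dP sP]] := valP P.
have /andP[_ /forallP/(_ j)/andP[/eqP dQ sQ]] := valP Q.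
have vP : v \in (sval P).2 j by apply: (subvP sP); rewrite memvE -xv -xj addvv subvv.
have vQ : v \in (sval Q).2 j.
  by apply: (subvP sQ); rewrite memvE -xv -xx -xj addvv subvv.
have [a av lP] := line2_gen dP v0 vP.
have [b bv lQ] := line2_gen dQ v0 vQ.
have bP : b \notin (<[v]> + <[a]>)%VS.
  apply/negP => bl; apply: lj; apply/esym/eqP; rewrite eqEdim dP dQ andbT lP lQ.
  by rewrite subv_add addvSl -memvE.
have ba : b - a \notin (<[v]> + <[a]>)%VS.
  apply: contraNN bP => h; rewrite -[b](subrK a) memvD//.
  by rewrite memvE addvSr.
have [M [uM r0 r1 r2]] := frame3 v0 av ba.
have fM : is_frame (M, Some j) by rewrite /is_frame /= uM r0 -xv xj eqxx.
pose c : frame := exist _ (M, Some j) fM.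
pose zt (t : C) : 'rV[C]_2 := t *: delta_mx 0 1.
have b0 t : bpoint c (zt t) = v by rewrite bpoint0 ?mxE//= mulr0.
have dz t : bdom c (zt t).
  move=> i; rewrite b0 -xv xj => ij; apply: contraNneq ij => /sval_p_inj <-.
  by rewrite /= eqxx.
have bd t : bdir c (zt t) j = a + t *: (b - a).
  rewrite /bdir eqxx -r2 -r1 !rowE scalemxAl -mulmxDl; congr (_ *m _).
  by rewrite [RHS]vec3_eta; congr vec3; rewrite !mxE /= ?mulr0 ?mulr1 ?addr0 ?add0r.
have eP : P = bpar c (zt 0).
  apply: blowup_pt_eq; first by rewrite (bpar_line (dz 0)) b0 xv.
  move=> i; rewrite xj => /sval_p_inj <-.
  by rewrite (bpar_dir _ (dz 0)) bd scale0r addr0 -xj xv.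
have eQ : Q = bpar c (zt 1).
  apply: blowup_pt_eq; first by rewrite (bpar_line (dz 1)) b0 xw -xv xx -xw.
  move=> i; rewrite -xx xj => /sval_p_inj <-.
  by rewrite (bpar_dir _ (dz 1)) bd scale1r [a + _]addrC subrK -xj xv.
have ne : zt 0 != zt 1.
  by apply: contraNneq PQ => e; rewrite eP eQ e.
have : hausdorff_space 'rV[C]_2 by exact: norm_hausdorff.
rewrite open_hausdorff => /(_ _ _ ne)[[A B] /= [/set_mem hA /set_mem hB] [oA oB /eqP AB]].
have sub (D : set 'rV[C]_2) : bdom c `&` D `<=` bdom c by exact: subIsetl.
have od (D : set 'rV[C]_2) : open D -> open (bpar c @` (bdom c `&` D)).
  by move=> oD; apply/(bpar_homeo (@sub D)); apply: openI => //; exact: bdom_open.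
exists (bpar c @` (bdom c `&` A), bpar c @` (bdom c `&` B)).
  split; apply: mem_set; rewrite /=.
    by exists (zt 0); [split; [exact: dz | exact: hA] | exact: esym eP].
  by exists (zt 1); [split; [exact: dz | exact: hB] | exact: esym eQ].
split; [exact: od | exact: od |].
apply/eqP; rewrite /= -subset0 => _ [[z [dzA zA] <-] [w' [dw wB] e]].
have ew : w' = z by exact: (bpar_inj (mem_set dw) (mem_set dzA) e).
suff : (A `&` B) z by rewrite AB.
by split; [exact: zA | rewrite -ew].
Qed.

Definition blowup : complex_manifold R 2 :=
  @ComplexManifold R 2 blowup_pt frame bdom bpar blowup_hausdorff bdom_open
    bpar_inj bpar_homeo bpar_cover bpar_diff.

End ProjectivePlane.

(* Main.v *)
Require Import Defs.
From HB Require Import structures.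
From mathcomp Require Import all_boot all_order all_algebra.
From mathcomp Require Import complex.
From mathcomp Require Import all_classical all_reals all_analysis.
From mathcomp Require Import ring lra.
Require Import Defs.

(** The nine points lie by threes on three lines through one point O =
    [1:0:0]: with the directions e_0 = (1, 0), e_1 = (0, 1) and e_2 = (-1,
    -1) they are [a : e_k] for a = 0, 1, 2. The point O is not one of the
    nine.

    Why the anti-canonical bundle is nef. Cubic forms that vanish at the
    nine points are sections of it; products of three linear forms are the
    only ones needed, and [cubic_section] writes them in every chart. The
    product of the equations of the three lines is one such section, and its
    zero divisor is the union of the strict transforms of the lines. Let a
    curve map to the blow-up. If it is contained in none of these strict
    transforms, the pull-back of the section does not vanish identically
    near any point ([line_dichotomy], by isolation of zeros), so the degree
    is a finite sum of nonnegative orders ([degree_of_section]). If it is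
    contained in the strict transform of one of the lines, consider the
    product of three other lines which meet that line in its three centres
    ([transversals]): after blowing up they are disjoint from it, so this
    section has no zero along the curve and the degree is 0
    ([transversals_nowhere_zero], [degree_of_nowhere_zero]).

    Why there is no smooth metric of semi-positive curvature. The strict
    transform of each line is a projective line on which the bundle has
    degree 0. The trivialising section found above turns the weight of a
    semi-positive metric into a subharmonic function on that projective
    line, hence into a constant ([weight_constant], by the Liouville theorem
    [liouville] in the affine coordinate t of the point [t : e_k]). Near O
    put u = 1 / t, and let h be the weight in the affine chart around O,
    which serves all three lines at once. Constancy reads h (u e_k) |1 -
    u|^2 |1 - 2 u|^2 = h (0) for small u ([metric_on_line]). Differentiating
    at u = 0, the differential of h at O takes the value 6 h (0) on each of
    the vectors e_0, e_1, e_2 ([metric_derivative_dir]). These vectors have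
    sum zero, so 18 h (0) = 0, while h (0) > 0.

    The function theory of one variable is obtained without integral
    formulas. Goursat's subdivision argument gives primitives; the modulus
    squared of a function with two complex derivatives has nonnegative
    Laplacian and so obeys the maximum principle; difference quotients carry
    the principle from second primitives down to holomorphic functions; and
    the maximum principle gives removable singularities and isolated zeros. *)

Set Implicit Arguments.
Unset Strict Implicit.
Unset Printing Implicit Defensive.
Import Order.TTheory GRing.Theory Num.Theory.
Import numFieldNormedType.Exports.
Local Open Scope classical_set_scope.
Local Open Scope ring_scope.

(** * Moduli of complex numbers and complex derivatives *)

Section Basics.
Variable R : realType.
Local Notation C := (Cx R).

(** The norm of [C] takes its values in [C]; inequalities between real
    numbers need its real part. *)
Definition nm (z : C) : R := complex.Re `|z|.

Lemma nmE (z : C) : (@Num.norm C C z) = (nm z)%:C%C.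
Proof. by rewrite /nm normc_def. Qed.

Lemma nm_ge0 z : 0 <= nm z.
Proof. by rewrite -ler0c -nmE normr_ge0. Qed.

Lemma nmM z w : nm (z * w) = nm z * nm w.
Proof. apply: complexI; rewrite -nmE normrM !nmE. by rewrite -rmorphM. Qed.

Lemma nmD z w : nm (z + w) <= nm z + nm w.
Proof. by rewrite -lecR -nmE rmorphD /= -!nmE ler_normD. Qed.

Lemma nm_eq0 z : (nm z == 0) = (z == 0).
Proof.
transitivity ((nm z)%:C%C == 0 :> C); first by rewrite eq_complex /= eqxx andbT.
rewrite -nmE; exact: normr_eq0.
Qed.
Lemma nmN z : nm (- z) = nm z. Proof. by rewrite /nm normrN. Qed.
Lemma nmB z w : nm (z - w) = nm (w - z). Proof. by rewrite /nm distrC. Qed.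
Lemma nm0 : nm 0 = 0. Proof. by rewrite /nm normr0. Qed.
Lemma nm1 : nm 1 = 1. Proof. by rewrite /nm normr1. Qed.
Lemma nmV z : nm z^-1 = (nm z)^-1.
Proof. by apply: complexI; rewrite -nmE normfV nmE fmorphV. Qed.
Lemma nmX z n : nm (z ^+ n) = nm z ^+ n.
Proof. by apply: complexI; rewrite -nmE normrX nmE rmorphXn. Qed.
Lemma nmR (x : R) : nm (x%:C)%C = `|x|.
Proof. rewrite /nm normc_def /= expr0n addr0 sqrtr_sqr //. Qed.
Lemma Re_le_nm z : `|complex.Re z| <= nm z.
Proof. by rewrite -lecR -nmE normc_ge_Re. Qed.
Lemma nm_sq z : nm z ^+ 2 = complex.Re z ^+ 2 + complex.Im z ^+ 2.
Proof. by apply: complexI; rewrite add_Re2_Im2 nmE rmorphXn. Qed.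

Lemma Im_le_nm z : `|complex.Im z| <= nm z.
Proof.
rewrite -ler_sqr ?nnegrE ?nm_ge0 // nm_sq -[X in X <= _]normrX ger0_norm ?sqr_ge0 //.
by rewrite lerDr sqr_ge0.
Qed.
Lemma nmi : nm ('i%C : C) = 1.
Proof. by rewrite /nm normc_def /= expr0n add0r expr1n sqrtr1. Qed.
Lemma nm_le_ReIm (x y : R) : nm ((x +i* y)%C : C) <= `|x| + `|y|.
Proof.
have -> : (x +i* y)%C = (x%:C)%C + 'i%C * (y%:C)%C :> C.
  by apply/eqP; rewrite eq_complex /=; apply/andP; split; apply/eqP; ring.
by apply: (le_trans (nmD _ _)); rewrite nmM nmi mul1r !nmR.
Qed.
Lemma nm_gt0 z : (0 < nm z) = (z != 0).
Proof. by rewrite lt_def nm_eq0 nm_ge0 andbT. Qed.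

(** In [C] the order compares real numbers only. *)
Lemma gt0_complex (e : C) : 0 < e -> e = ((complex.Re e)%:C)%C /\ 0 < complex.Re e.
Proof.
case: e => a b; rewrite ltcE /= => /andP[/eqP -> a0].
by split.
Qed.

Lemma nbhsC z (A : set C) : nbhs z A <-> exists2 d : R, 0 < d
  & forall w, nm (w - z) < d -> A w.
Proof.
split.
  move=> /nbhs_ballP[e /= /gt0_complex[er e0] sA].
  exists (complex.Re e) => //.
  by move=> w wz; apply: sA; rewrite -ball_normE /= distrC er nmE ltcR.
move=> [d d0 sA]; apply/nbhs_ballP; exists (d%:C)%C; first by rewrite /= ltcR.
by move=> w; rewrite -ball_normE /= distrC nmE ltcR => /sA.
Qed.

Lemma is_deriveP (K : numFieldType) (f : K -> K) (x d : K) :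
  is_derive x (1 : K) f d <-> forall e : K, 0 < e ->
    \forall h \near (0 : K), `|f (x + h) - f x - d * h| <= e * `|h|.
Proof.
have E h : h != 0 ->
    `|f (x + h) - f x - d * h| = `|d - h^-1 *: (f (h *: 1 + x) - f x)| * `|h|.
  move=> h0; rewrite -normrM mulrBl /GRing.scale /= mulr1 [h +
    x]addrC [h^-1 * _]mulrC divfK //.
  exact: distrC.
split.
  move=> [/cvg_ex[l hl] ed] e e0.
  have {ed}ld : l = d by rewrite -ed; exact: esym (norm_cvg_lim hl).
  rewrite {l}ld in hl; have /cvgrPdist_le/(_ _ e0) := hl.
  rewrite near_withinE; apply: filterS => h hh.
  have [->|h0] := eqVneq h 0; first by rewrite addr0 subrr mulr0 subrr normr0 mulr0.
  by rewrite E // ler_wpM2r //; exact: hh.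
move=> H; have hl : (fun h => h^-1 *: (f (h *: 1 + x) - f x)) @ (0 : K)^' --> d.
  apply/cvgrPdist_le => e e0; rewrite near_withinE; apply: filterS (H _ e0) => h hh h0.
  by move: hh; rewrite E // ler_pM2r // normr_gt0.
split; first by apply/cvg_ex; exists d.
exact: (norm_cvg_lim hl).
Qed.

Definition hderiv (f : C -> C) (z d : C) := is_derive z (1 : C) f d.

Lemma hderivP (f : C -> C) z d : hderiv f z d <->
  forall e : R, 0 < e -> exists2 r : R, 0 < r &
    forall h, nm h < r -> nm (f (z + h) - f z - d * h) <= e * nm h.
Proof.
apply: (iff_trans (is_deriveP f z d)); split=> H e.
  move=> e0; have /nbhsC[r r0 hr] : \forall h \near (0 : C),
    `|f (z + h) - f z - d * h| <= (e%:C)%C * `|h|.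
    by apply: H; rewrite ltcR.
  by exists r => // h hh; have := hr h; rewrite subr0 !nmE -rmorphM lecR; exact.
move=> /gt0_complex[er e0]; have [r r0 hr] := H _ e0.
by apply/nbhsC; exists r => // h; rewrite subr0 er !nmE -rmorphM lecR; exact: hr.
Qed.
End Basics.

(** * Second derivatives and Laplacians *)

Section Real.
Variable R : realType.
Local Notation C := (Cx R).

Lemma nbhsR (x : R) (A : set R) : nbhs x A <-> exists2 d : R, 0 < d
  & forall y, `|y - x| < d -> A y.
Proof.
split.
  move=> /nbhs_ballP[e /= e0 sA]; exists e => // y yx; apply: sA.
  by rewrite -ball_normE /= distrC.
move=> [d d0 sA]; apply/nbhs_ballP; exists d => // y.
by rewrite -ball_normE /= distrC => /sA.
Qed.

Lemma rderivP (g : R -> R) (x d : R) : is_derive (x : R) (1 : R) g d <->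
  forall e : R, 0 < e -> exists2 r : R, 0 < r &
    forall h, `|h| < r -> `|g (x + h) - g x - d * h| <= e * `|h|.
Proof.
apply: (iff_trans (is_deriveP g x d)); split=> H e e0.
  have /nbhsR[r r0 hr] := H _ e0.
  by exists r => // h hh; apply: hr; rewrite subr0.
by have [r r0 hr] := H _ e0; apply/nbhsR; exists r => // h; rewrite subr0; exact: hr.
Qed.

Lemma is_derive_continuous (g : R -> R) (x d : R) : is_derive (x : R) (1 : R) g d ->
  {for x, continuous g}.
Proof.
move=> [dg _]; apply: differentiable_continuous.
exact/derivable1_diffP.
Qed.

(** The value [l] is recorded by a relation, so that sums, multiples and
    local changes of functions need no differentiability side conditions on
    totalised derivatives. *)
Definition is_deriv2 (g : R -> R) (x l : R) := exists2 g' : R -> R,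
  (\forall y \near x, is_derive (y : R) (1 : R) g (g' y))
    & is_derive (x : R) (1 : R) g' l.

(** At a maximum the first derivative vanishes; a positive second derivative
    makes the first derivative positive just to the right, so the function
    increases there by the mean value theorem. *)
Lemma is_deriv2_gt0_not_max g (x l : R) : is_deriv2 g x l -> 0 < l ->
  ~ (\forall y \near x, g y <= g x).
Proof.
move=> [g' ng dg'] l0 nm.
have /nbhsR[d d0 hd] : \forall y \near x, is_derive (y : R) (1 : R) g (g' y) /\
  g y <= g x.
  by apply: filterI.
have hx h : `|h| < d -> `|x + h - x| < d by rewrite addrAC subrr add0r.
have g'x : g' x = 0.
  have H t : t \in `](x - d), (x + d)[ -> `|t - x| < d.
    by rewrite in_itv /= ltr_norml => /andP[h1 h2]; rewrite ltrBlDl h2 ltrBrDl h1.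
  have [_ e0] : is_derive x (1 : R) g 0.
    apply: (@derive1_at_max _ g (x - d) (x + d) x).
    - by rewrite lerBlDr -addrA lerDl ltW // addr_gt0.
    - by move=> t /H/hd[[]].
    - by rewrite in_itv /= ltrBlDr !ltrDl d0.
    - by move=> t /H/hd[_].
  by have /hd[[_ <-] _] : `|x - x| < d by rewrite subrr normr0.
have /rderivP/(_ (l / 2)) := dg'; case; first by rewrite divr_gt0.
move=> r r0 hr.
pose h := Num.min d r / 2.
have h0 : 0 < h by rewrite divr_gt0 // lt_min d0 r0.
have hd' : h < d /\ h < r.
  have : h < Num.min d r by rewrite ltr_pdivrMr // ltr_pMr ?lt_min ?d0 ?r0 // ltr1n.
  by rewrite lt_min => /andP.
have := @MVT _ g g' x (x + h); rewrite ltrDl => /(_ h0); case.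
- move=> t; rewrite in_itv /= => /andP[h1 h2]; have [] := hd t; last by [].
  by rewrite gtr0_norm ?subr_gt0 // ltrBlDl (lt_trans h2) // ltrD2l; case: hd'.
- apply: continuous_in_subspaceT => t; rewrite inE /= in_itv /= => /andP[h1 h2].
  have [|dt _] := hd t; last exact: is_derive_continuous dt.
  by rewrite ger0_norm ?subr_ge0 // ltrBlDl (le_lt_trans h2) // ltrD2l; case: hd'.
move=> c; rewrite in_itv /= => /andP[c1 c2].
rewrite [x + h]addrC addrK => e.
have /hd[_] : `|h + x - x| < d by rewrite addrK gtr0_norm //; case: hd'.
rewrite -subr_le0 e leNgt => /negP; apply; rewrite mulr_gt0 //.
have := hr (c - x).
have cx0 : 0 < c - x by rewrite subr_gt0.
rewrite (gtr0_norm cx0) [x + _]addrC subrK g'x subr0.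
have -> : c - x < r by rewrite ltrBlDr (lt_trans c2) // addrC ltrD2r; case: hd'.
move=> /(_ isT); rewrite ler_norml => /andP[+ _].
nra.
Qed.

Lemma is_deriv2D f g x a b : is_deriv2 f x a -> is_deriv2 g x b ->
  is_deriv2 (fun t => f t + g t) x (a + b).
Proof.
move=> [f' nf df] [g' ng dg]; exists (fun t => f' t + g' t); last exact: is_deriveD.
by apply: filterS2 nf ng => y h1 h2; exact: is_deriveD.
Qed.

Lemma is_deriv2Z f x a k : is_deriv2 f x a -> is_deriv2 (fun t => k * f t) x (k * a).
Proof.
move=> [f' nf df]; exists (fun t => k * f' t); last exact: is_deriveZ.
by apply: filterS nf => y h1; exact: is_deriveZ.
Qed.

Lemma is_deriv2_near f g x a : (\forall y \near x, f y = g y) -> is_deriv2 f x a ->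
  is_deriv2 g x a.
Proof.
move=> fg [f' nf df]; exists f' => //.
move: fg => /near_join nn; apply: filterS2 nn nf => y h1 h2.
exact: (near_eq_is_derive h1 h2).
Qed.

Definition is_lap (u : C -> R) (x y l : R) := exists lx ly,
  [/\ is_deriv2 (fun s => u (s +i* y)%C) x lx, is_deriv2 (fun s => u (x +i* s)%C) y ly
    & l = lx + ly].

Lemma is_lapD u v x y a b : is_lap u x y a -> is_lap v x y b ->
  is_lap (fun z => u z + v z) x y (a + b).
Proof.
move=> [ax [ay [h1 h2 ->]]] [bx [by_ [k1 k2 ->]]].
exists (ax + bx), (ay + by_); split; [exact: is_deriv2D | exact: is_deriv2D |
  by rewrite addrACA].
Qed.

Lemma is_lapZ u x y a k : is_lap u x y a -> is_lap (fun z => k * u z) x y (k * a).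
Proof.
move=> [ax [ay [h1 h2 ->]]]; exists (k * ax), (k * ay); split;
  [exact: is_deriv2Z | exact: is_deriv2Z |].
by rewrite mulrDr.
Qed.

Lemma nm_line_x (x y s : R) : nm ((s +i* y)%C - (x +i* y)%C : C) = `|s - x|.
Proof. by rewrite -nmR; congr nm; apply/eqP; rewrite eq_complex /= subrr !eqxx. Qed.
Lemma nm_line_y (x y s : R) : nm ((x +i* s)%C - (x +i* y)%C : C) = `|s - y|.
Proof.
rewrite -[RHS]nmR -[RHS]mul1r -nmi -nmM.
by congr nm; apply/eqP; rewrite eq_complex /=; apply/andP; split; apply/eqP; ring.
Qed.

Lemma near_line_x (x y : R) (P : C -> Prop) : (\forall z \near ((x +i* y)%C : C), P z) ->
  \forall s \near x, P (s +i* y)%C.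
Proof.
move=> /nbhsC[d d0 h]; apply/nbhsR; exists d => // s hs; apply: h.
by rewrite nm_line_x.
Qed.
Lemma near_line_y (x y : R) (P : C -> Prop) : (\forall z \near ((x +i* y)%C : C), P z) ->
  \forall s \near y, P (x +i* s)%C.
Proof.
move=> /nbhsC[d d0 h]; apply/nbhsR; exists d => // s hs; apply: h.
by rewrite nm_line_y.
Qed.

Lemma is_lap_near (u v : C -> R) (x y l : R) :
  (\forall z \near ((x +i* y)%C : C), u z = v z) -> is_lap u x y l -> is_lap v x y l.
Proof.
move=> uv [lx [ly [h1 h2 ->]]]; exists lx, ly; split => //.
  by apply: is_deriv2_near h1; exact: near_line_x uv.
by apply: is_deriv2_near h2; exact: near_line_y uv.
Qed.

(** One of the two pure second derivatives is positive. *)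
Lemma is_lap_gt0_not_max (u : C -> R) (x y l : R) : is_lap u x y l -> 0 < l ->
  ~ (\forall z \near ((x +i* y)%C : C), u z <= u (x +i* y)%C).
Proof.
move=> [lx [ly [h1 h2 ->]]] l0 nn.
have [lx0|lx0] := ltP 0 lx.
  by apply: (is_deriv2_gt0_not_max h1 lx0); exact: near_line_x nn.
apply: (is_deriv2_gt0_not_max h2); last exact: near_line_y nn.
by lra.
Qed.

Lemma continuous_nm (a : C) : continuous (fun z : C => nm (z - a)).
Proof.
move=> z; apply/(@cvgrPdist_lt _ _ _ _ (nbhs_filter z)) => e e0; apply/nbhsC;
  exists e => // w wz.
apply: le_lt_trans wz.
have h1 : nm (w - a) <= nm (z - a) + nm (w - z).
  by rewrite [w - a](_ : _ = (z - a) + (w - z)) ?nmD //; ring.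
have h2 : nm (z - a) <= nm (w - a) + nm (w - z).
  by rewrite [nm (w - z)]nmB [z - a](_ : _ = (w - a) + (z - w)) ?nmD //; ring.
by rewrite ler_norml; apply/andP; split; lra.
Qed.

(** A closed disc is a closed part of the image of a compact rectangle of
    real coordinates. *)
Lemma compact_disc (a : C) (r : R) : compact [set z : C | nm (z - a) <= r].
Proof.
pose ra := complex.Re a; pose ia := complex.Im a.
pose f (v : R * R) : C := (v.1 +i* v.2)%C.
have cf : continuous f.
  move=> [x y]; apply/cvgrPdist_lt => e /gt0_complex[er e0].
  have e2 : 0 < complex.Re e / 2 by rewrite divr_gt0.
  have nn : \forall v \near (x, y), `|v.1 - x| < complex.Re e / 2 /\
    `|v.2 - y| < complex.Re e / 2.
    exists ([set p | `|p - x| < complex.Re e / 2],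
      [set q | `|q - y| < complex.Re e / 2]) => /=.
      by split; apply/nbhsR; exists (complex.Re e / 2).
    by move=> [p q] [].
  apply: filterS nn => v [h1 h2]; rewrite er nmE ltcR nmB.
  have -> : f v - f (x, y) = ((v.1 +i* v.2)%C - (x +i* v.2)%C) +
    ((x +i* v.2)%C - (x +i* y)%C).
    by rewrite /f addrA subrK.
  by apply: (le_lt_trans (nmD _ _)); rewrite nm_line_x nm_line_y; lra.
apply: (@subclosed_compact _ _ (f @` (`[ra - r, ra + r] `*` `[ia - r, ia + r]))).
- rewrite (_ : [set z : C | nm (z - a) <= r] = (fun z : C =>
    nm (z - a)) @^-1` [set x | x <= r]) //.
  by apply: closed_comp; [move=> z _; exact: continuous_nm | exact: closed_le].
- apply: continuous_compact; first exact: continuous_subspaceT.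
  by apply: compact_setX; exact: segment_compact.
- move=> z /= zr; exists (complex.Re z, complex.Im z); last by rewrite /f /=;
    case: z {zr}.
  have := Re_le_nm (z - a); have := Im_le_nm (z - a).
  move: zr; rewrite /ra /ia; case: z => p q; case: (a) => p' q' /=.
  rewrite !in_itv /= => h /le_trans/(_ h) + /le_trans/(_ h).
  by rewrite !ler_norml => /andP[h1 h2] /andP[h3 h4]; split; apply/andP; split; lra.
Qed.

(** The maximum over the compact set exists, and a positive Laplacian keeps
    it out of the open set. *)
Lemma max_on_boundary (K U : set C) (u : C -> R) : K !=set0 -> compact K -> open U ->
  U `<=` K -> {within K, continuous u} ->
  (forall x y, U (x +i* y)%C -> exists2 l, is_lap u x y l & 0 < l) ->
  exists z, [/\ K z, ~ U z & forall w, K w -> u w <= u z].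
Proof.
move=> K0 cK oU UK cu hl.
have [z /set_mem Kz hz] := compact_EVT_max K0 cK cu.
exists z; split => // [|w Kw]; last by apply: hz; exact: mem_set.
case: z Kz hz => x y Kz hz Uz; have [l ll l0] := hl _ _ Uz.
apply: (is_lap_gt0_not_max ll l0).
have : nbhs ((x +i* y)%C : C) U by exact: open_nbhs_nbhs.
by apply: filterS => w /UK/mem_set; exact: hz.
Qed.

End Real.

(** * Calculus with complex derivatives *)

Section Holo.
Variable R : realType.
Local Notation C := (Cx R).

Lemma near_everywhere (z : C) (P : C -> Prop) : (forall w, P w) -> \forall w \near z, P w.
Proof. by move=> h; apply/nbhsC; exists 1. Qed.

Lemma near_eq_continuous (T : topologicalType) (f g : C -> T) z :
  (\forall t \near z, f t = g t) -> {for z, continuous f} -> {for z, continuous g}.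
Proof.
move=> fg cf; have e : f z = g z := nbhs_singleton fg.
have cg : g @ z --> f z := cvg_trans (near_eq_cvg fg) cf.
rewrite e in cg; exact: cg.
Qed.

(** Two limits of the same function on a punctured neighbourhood agree. *)
Lemma continuous_eq (K : numFieldType) (V : normedModType K) (f g : C -> V) (z : C) :
  {for z, continuous f} -> {for z, continuous g} ->
  (\forall t \near z, t != z -> f t = g t) -> f z = g z.
Proof.
move=> cf cg fg.
have h1 : f @ z^' --> f z := cvg_trans (cvg_app f (cvg_within _)) cf.
have h2 : g @ z^' --> g z := cvg_trans (cvg_app g (cvg_within _)) cg.
have fg' : \forall t \near z^', f t = g t by rewrite near_withinE.
have h3 : g @ z^' --> f z := cvg_trans (near_eq_cvg fg') (h1 (nbhs_filter z)).
exact: (norm_cvg_unique (h3 _) (h2 (nbhs_filter z))).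
Qed.

Lemma hderivD (f g : C -> C) z a b : hderiv f z a -> hderiv g z b ->
  hderiv (fun w => f w + g w) z (a + b).
Proof. by move=> h1 h2; exact: is_deriveD. Qed.
Lemma hderivB (f g : C -> C) z a b : hderiv f z a -> hderiv g z b ->
  hderiv (fun w => f w - g w) z (a - b).
Proof. by move=> h1 h2; exact: is_deriveB. Qed.
Lemma hderivM (f g : C -> C) z a b : hderiv f z a -> hderiv g z b ->
  hderiv (fun w => f w * g w) z (f z * b + g z * a).
Proof. by move=> h1 h2; exact: is_deriveM. Qed.
Lemma hderiv_cst (k z : C) : hderiv (fun=> k) z 0.
Proof. exact: is_derive_cst. Qed.
Lemma hderiv_id (z : C) : hderiv id z 1.
Proof. exact: is_derive_id. Qed.
Lemma hderivZ (k : C) (f : C -> C) z a : hderiv f z a ->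
  hderiv (fun w => k * f w) z (k * a).
Proof. by move=> h; have := hderivM (hderiv_cst k z) h; rewrite mulr0 addr0. Qed.
Lemma hderivV (f : C -> C) z a : f z != 0 -> hderiv f z a ->
  hderiv (fun w => (f w)^-1) z (- (f z)^-2 * a).
Proof.
move=> h0 [h1 h2]; constructor; first exact: derivableV.
by rewrite deriveV // h2.
Qed.
Lemma hderiv_near (f g : C -> C) z a : (\forall w \near z, f w = g w) -> hderiv f z a ->
  hderiv g z a.
Proof. by move=> fg h; exact: (near_eq_is_derive fg h). Qed.
Lemma hderiv_subc (z c : C) : hderiv (fun w => w - c) z 1.
Proof. by have := hderivB (hderiv_id z) (hderiv_cst c z); rewrite subr0. Qed.
Lemma hderivX (f : C -> C) z a n : hderiv f z a ->
  exists b, hderiv (fun w => f w ^+ n) z b.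
Proof.
move=> h; elim: n => [|n [b hb]]; first by exists 0; exact: hderiv_cst.
exists (f z * b + f z ^+ n * a); have := hderivM h hb.
by apply: hderiv_near; apply: near_everywhere => w; rewrite exprS.
Qed.
Lemma hderiv_shift (f : C -> C) z c a : hderiv f (z + c) a ->
  hderiv (fun w => f (w + c)) z a.
Proof.
move=> /hderivP H; apply/hderivP => e /H[r r0 hr]; exists r => // h /hr.
by rewrite [z + c + h]addrAC.
Qed.
Lemma hderiv_cont (f : C -> C) z a : hderiv f z a ->
  forall e : R, 0 < e -> exists2 r : R, 0 < r & forall w, nm (w - z) < r ->
    nm (f w - f z) < e.
Proof.
move=> /hderivP H e e0; have [r r0 hr] := H 1 ltr01.
have k0 : 0 < 2 + nm a by rewrite ltr_wpDr ?nm_ge0.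
exists (Num.min r (e / (2 + nm a))); first by rewrite lt_min r0 divr_gt0.
move=> w; rewrite lt_min => /andP[h1 h2].
have := hr _ h1; rewrite [z + _]addrC subrK mul1r => h3.
rewrite [f w - f z](_ : _ = (f w - f z - a * (w - z)) + a * (w - z)); last by ring.
apply: (le_lt_trans (nmD _ _)); rewrite nmM.
move: h2; rewrite ltr_pdivlMr // => h2; have := nm_ge0 (w - z).
have := nm_ge0 a; nra.
Qed.
Lemma hderiv_continuous (f : C -> C) z a : hderiv f z a -> {for z, continuous f}.
Proof. by move=> [df _]; apply: differentiable_continuous; exact/derivable1_diffP. Qed.

Definition curve_deriv (p : R -> C) (s : R) (d : C) :=
  is_derive s (1 : R) (fun t => complex.Re (p t)) (complex.Re d) /\
  is_derive s (1 : R) (fun t => complex.Im (p t)) (complex.Im d).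

Lemma curve_derivP (p : R -> C) s d :
  (forall e : R, 0 < e -> exists2 r : R, 0 < r &
    forall h : R, `|h| < r -> nm (p (s + h) - p s - d * (h%:C)%C) <= e * `|h|) ->
  curve_deriv p s d.
Proof.
move=> H; split; apply/rderivP => e /H[r r0 hr]; exists r => // h /hr.
  apply: le_trans; apply: le_trans (Re_le_nm _).
  case: (p (s + h)) => a b; case: (p s) => a' b'; case: d {H hr} => u v /=.
  by rewrite mulr0 subr0.
apply: le_trans; apply: le_trans (Im_le_nm _).
case: (p (s + h)) => a b; case: (p s) => a' b'; case: d {H hr} => u v /=.
by rewrite mulr0 add0r.
Qed.

Lemma hderiv_line_x (f : C -> C) x y d : hderiv f (x +i* y)%C d ->
  curve_deriv (fun s => f (s +i* y)%C) x d.
Proof.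
move=> /hderivP H; apply: curve_derivP => e /H[r r0 hr]; exists r => // h hh.
have := hr (h%:C)%C; rewrite nmR => /(_ hh).
by rewrite (_ : (x +i* y)%C + (h%:C)%C = ((x + h) +i* y)%C :> C)//; apply/eqP;
  rewrite eq_complex /= addr0 !eqxx.
Qed.

Lemma hderiv_line_y (f : C -> C) x y d : hderiv f (x +i* y)%C d ->
  curve_deriv (fun s => f (x +i* s)%C) y ('i%C * d).
Proof.
move=> /hderivP H; apply: curve_derivP => e /H[r r0 hr]; exists r => // h hh.
have ni : nm ('i%C * (h%:C)%C : C) = `|h|.
  by rewrite nmM nmR nmi mul1r.
have := hr ('i%C * (h%:C)%C); rewrite ni => /(_ hh).
rewrite (_ : (x +i* y)%C + 'i%C * (h%:C)%C = (x +i* (y + h))%C :> C); last first.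
  by apply/eqP; rewrite eq_complex /=; apply/andP; split; apply/eqP; ring.
by rewrite mulrA [d * _]mulrC.
Qed.

Lemma curve_deriv_continuous p s d : curve_deriv p s d ->
  {for s, continuous (fun t => complex.Re (p t))} /\
    {for s, continuous (fun t => complex.Im (p t))}.
Proof. by move=> [h1 h2]; split; exact: is_derive_continuous. Qed.

Lemma curve_derivB p q s d e : curve_deriv p s d -> curve_deriv q s e ->
  curve_deriv (fun t => p t - q t) s (d - e).
Proof.
move=> [p1 p2] [q1 q2]; split.
  have -> : (fun t => complex.Re (p t - q t)) = (fun t =>
    complex.Re (p t) - complex.Re (q t)).
    by apply/funext => t; case: (p t) => ??; case: (q t).
  rewrite (_ : complex.Re (d - e) = complex.Re d - complex.Re e); last by case: (d);
    case: (e).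
  exact: is_deriveB.
have -> : (fun t => complex.Im (p t - q t)) = (fun t =>
  complex.Im (p t) - complex.Im (q t)).
  by apply/funext => t; case: (p t) => ??; case: (q t).
rewrite (_ : complex.Im (d - e) = complex.Im d - complex.Im e); last by case: (d);
  case: (e).
exact: is_deriveB.
Qed.

Lemma curve_derivZ (k : C) p s d : curve_deriv p s d ->
  curve_deriv (fun t => k * p t) s (k * d).
Proof.
move=> [p1 p2]; case: k => a b; split.
  have -> : (fun t => complex.Re ((a +i* b)%C * p t))
    = (fun t => a * complex.Re (p t) - b * complex.Im (p t)).
    by apply/funext => t; case: (p t) => ??.
  rewrite (_ : complex.Re ((a +i* b)%C * d) = a * complex.Re d - b * complex.Im d);
    last by case: (d).
  by apply: is_deriveB; exact: is_deriveZ.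
have -> : (fun t => complex.Im ((a +i* b)%C * p t))
  = (fun t => a * complex.Im (p t) + b * complex.Re (p t)).
  by apply/funext => t; case: (p t) => ??.
rewrite (_ : complex.Im ((a +i* b)%C * d) = a * complex.Im d + b * complex.Re d);
  last by case: (d).
by apply: is_deriveD; exact: is_deriveZ.
Qed.

(** The real mean value theorem applied to the component of [p] in the
    direction of its total increment. *)
Lemma mean_value_ineq_le (p dp : R -> C) (K a b : R) : a <= b ->
  (forall s, a <= s <= b -> curve_deriv p s (dp s)) ->
  (forall s, a <= s <= b -> nm (dp s) <= K) ->
  nm (p b - p a) <= K * (b - a).
Proof.
move=> ab hd hK.
pose v := p b - p a.
have [v0|v0] := eqVneq (nm v) 0.
  rewrite -/v v0 mulr_ge0 ?subr_ge0 //; apply: (le_trans (nm_ge0 (dp a))).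
  by apply: hK; rewrite lexx.
have vpos : 0 < nm v by rewrite lt_def v0 nm_ge0.
(* Multiplication by the conjugate of the increment turns it into a positive real
   number. *)
pose q s := (v^* )%C * p s.
have hq s : a <= s <= b -> curve_deriv q s ((v^* )%C * dp s) by move=> /hd;
  exact: curve_derivZ.
have := @MVT_segment _ (fun t => complex.Re (q t)) (fun t =>
  complex.Re ((v^* )%C * dp t)) a b ab.
case.
- by move=> s; rewrite in_itv /= => /andP[/ltW h1 /ltW h2]; case: (hq s); rewrite ?h1.
- apply: continuous_in_subspaceT => t; rewrite inE /= in_itv /= => h.
  by have [] := curve_deriv_continuous (hq _ h).
move=> c; rewrite in_itv /= => hc.
have -> : complex.Re (q b) - complex.Re (q a) = nm v ^+ 2.
  rewrite nm_sq /q /v; case: (p b) => x1 y1; case: (p a) => x2 y2 /=; ring.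
move=> e; rewrite -(ler_pM2l vpos) -expr2 e mulrA ler_wpM2r ?subr_ge0 //.
apply: (le_trans (ler_norm _)); apply: (le_trans (Re_le_nm _)).
rewrite nmM (_ : nm (v^* )%C = nm v); last by rewrite /nm normcJ.
by rewrite ler_wpM2l ?nm_ge0 // hK.
Qed.

Lemma mean_value_ineq (p dp : R -> C) (K a b : R) :
  (forall s, Num.min a b <= s <= Num.max a b -> curve_deriv p s (dp s) /\
    nm (dp s) <= K) ->
  nm (p b - p a) <= K * `|b - a|.
Proof.
case: (leP a b) => [ab|/ltW ab] h.
  by rewrite ger0_norm ?subr_ge0 //; apply: (@mean_value_ineq_le p dp) => // s /h[].
by rewrite distrC ger0_norm ?subr_ge0 // nmB; apply: (@mean_value_ineq_le p dp) =>
  // s /h[].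
Qed.

Lemma is_deriv2_sq (g g' : R -> R) (x l : R) : (\forall y \near x,
  is_derive y (1 : R) g (g' y)) ->
  is_derive x (1 : R) g' l -> is_deriv2 (fun t => g t ^+ 2) x (2 * g' x ^+ 2 +
    2 * g x * l).
Proof.
move=> ng dg'; have dg := nbhs_singleton ng.
have e : (fun t => g t ^+ 2) = (fun t => g t * g t) by apply/funext => t; rewrite expr2.
exists (fun t => 2 * (g t * g' t)).
  rewrite e; apply: filterS ng => y h.
  have hh : is_derive y (1 : R) (fun t => g t * g t) _ := is_deriveM h h.
  apply: (is_derive_eq hh).
  by rewrite /GRing.scale /=; ring.
have hh : is_derive x (1 : R) (fun t => 2 * (g t * g' t)) _ :=
  is_deriveZ 2 (is_deriveM dg dg').
apply: (is_derive_eq hh).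
by rewrite /GRing.scale /=; ring.
Qed.

Lemma near_and1 (x : R) (P Q : R -> Prop) : (\forall s \near x, P s /\ Q s) ->
  \forall s \near x, P s.
Proof. by apply: filterS => s []. Qed.
Lemma near_and2 (x : R) (P Q : R -> Prop) : (\forall s \near x, P s /\ Q s) ->
  \forall s \near x, Q s.
Proof. by apply: filterS => s []. Qed.

(** With F = a + i b, the Cauchy-Riemann equations cancel the terms in F
    times the second derivative between the two coordinate directions; what
    remains is four times the squared modulus of the derivative. *)
Lemma is_lap_nm_sq (F F1 : C -> C) (f : C) x y :
  (\forall z \near ((x +i* y)%C : C), hderiv F z (F1 z)) -> hderiv F1 (x +i* y)%C f ->
  is_lap (fun z => nm (F z) ^+ 2) x y (4 * nm (F1 (x +i* y)%C) ^+ 2).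
Proof.
move=> nF dF1; set z0 := (x +i* y)%C : C in nF dF1 *.
have nx := near_line_x nF; have ny := near_line_y nF.
have d1x : \forall s \near x, curve_deriv (fun s => F (s +i* y)%C) s (F1 (s +i* y)%C).
  by apply: filterS nx => s; exact: hderiv_line_x.
have d1y : \forall s \near y, curve_deriv (fun s =>
  F (x +i* s)%C) s ('i%C * F1 (x +i* s)%C).
  by apply: filterS ny => s; exact: hderiv_line_y.
have d2x := hderiv_line_x dF1.
have d2y := curve_derivZ 'i%C (hderiv_line_y dF1).
exists (2 * nm (F1 z0) ^+ 2 + 2 * (complex.Re (F z0) * complex.Re f +
  complex.Im (F z0) * complex.Im f)).
exists (2 * nm (F1 z0) ^+ 2 - 2 * (complex.Re (F z0) * complex.Re f +
  complex.Im (F z0) * complex.Im f)).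
split; last by ring.
- have -> : (fun s => nm (F (s +i* y)%C) ^+ 2) =
     (fun s => complex.Re (F (s +i* y)%C) ^+ 2 + complex.Im (F (s +i* y)%C) ^+ 2).
    by apply/funext => s; rewrite nm_sq.
  have := is_deriv2D (is_deriv2_sq (near_and1 d1x) d2x.1) (is_deriv2_sq (near_and2
    d1x) d2x.2).
  by congr is_deriv2; rewrite nm_sq -/z0; ring.
- have -> : (fun s => nm (F (x +i* s)%C) ^+ 2) =
     (fun s => complex.Re (F (x +i* s)%C) ^+ 2 + complex.Im (F (x +i* s)%C) ^+ 2).
    by apply/funext => s; rewrite nm_sq.
  have := is_deriv2D (is_deriv2_sq (near_and1 d1y) d2y.1) (is_deriv2_sq (near_and2
    d1y) d2y.2).
  by congr is_deriv2; rewrite nm_sq -/z0; move: (F1 z0) (F z0) (f) =>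
    [? ?] [? ?] [? ?] /=; ring.
Qed.

Lemma open_disc (a : C) (r : R) : open [set z : C | nm (z - a) < r].
Proof.
rewrite (_ : [set z : C | nm (z - a) < r] = (fun z : C =>
  nm (z - a)) @^-1` [set x | x < r]) //.
by apply: open_comp; [move=> z _; exact: continuous_nm | exact: open_lt].
Qed.

Lemma continuous_nm_comp (F : C -> C) z : {for z, continuous F} ->
  {for z, continuous (fun w => nm (F w))}.
Proof.
move=> cF; apply: (@continuous_comp _ _ _ F (fun w => nm w) z cF).
rewrite (_ : (fun w => nm w) = (fun w => nm (w - 0))); first exact: continuous_nm.
by apply/funext => w; rewrite subr0.
Qed.

Lemma contM (F G : C -> C) (a : C) : {for a, continuous F} -> {for a, continuous G} ->
  {for a, continuous (fun t => F t * G t)}.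
Proof. by move=> cF cG; exact: (@continuousM C C F G a cF cG). Qed.

Lemma contX (F : C -> C) (a : C) n : {for a, continuous F} ->
  {for a, continuous (fun t => F t ^+ n)}.
Proof.
move=> cF; elim: n => [|n IH].
  rewrite (_ : (fun t => F t ^+ 0) = (fun=> 1)); first exact: cst_continuous.
  by apply/funext => t; rewrite expr0.
rewrite (_ : (fun t => F t ^+ n.+1) = (fun t => F t * F t ^+ n)); first exact: contM.
by apply/funext => t; rewrite exprS.
Qed.

Lemma contB (F G : C -> C) (a : C) : {for a, continuous F} -> {for a, continuous G} ->
  {for a, continuous (fun t => F t - G t)}.
Proof. by move=> cF cG; exact: (@continuousB C C C F G a cF cG). Qed.

Lemma cont_subc (F : C -> C) (c a : C) : {for a, continuous F} ->
  {for a, continuous (fun t => F t - c)}.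
Proof. by move=> cF; apply: contB cF _; exact: cst_continuous. Qed.

Lemma bounded_on_disc (f : C -> R) (a : C) r : 0 <= r ->
  (forall z, nm (z - a) <= r -> {for z, continuous f}) ->
  exists B, forall z, nm (z - a) <= r -> f z <= B.
Proof.
move=> r0 cf; have := @compact_EVT_max _ R f [set w : C | nm (w - a) <= r].
case.
- by exists a; rewrite /= subrr nm0.
- exact: compact_disc.
- by apply: continuous_in_subspaceT => w; rewrite inE /= => /cf.
by move=> c _ hc; exists (f c) => w hw; apply: hc; rewrite inE.
Qed.

(** Adding a small multiple of |z - a|^2 to |F|^2 makes the Laplacian
    positive, so that the maximum sits on the circle; the multiple then
    tends to 0. *)
Lemma max_principle_deriv2 (F F1 F2 : C -> C) (a : C) (r r' M : R) : 0 < r -> r < r' ->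
  (forall z, nm (z - a) < r' -> hderiv F z (F1 z) /\ hderiv F1 z (F2 z)) ->
  (forall z, nm (z - a) = r -> nm (F z) <= M) ->
  forall z, nm (z - a) <= r -> nm (F z) <= M.
Proof.
move=> r0 rr hF hM z hz.
have M0 : 0 <= M.
  apply: (le_trans (nm_ge0 _) (hM (a + (r%:C)%C) _)).
  by rewrite addrAC subrr add0r nmR gtr0_norm.
rewrite -ler_sqr ?nnegrE ?nm_ge0 //.
apply/ler_addgt0Pr => e e0.
pose eps := e / r ^+ 2.
have eps0 : 0 < eps by rewrite divr_gt0 ?exprn_gt0.
pose u w := nm (F w) ^+ 2 + eps * nm (w - a) ^+ 2.
have := @max_on_boundary R [set w | nm (w - a) <= r] [set w | nm (w - a) < r] u.
case.
- by exists a; rewrite /= subrr nm0 ltW.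
- exact: compact_disc.
- exact: open_disc.
- by move=> w /= /ltW.
- apply: continuous_in_subspaceT => w; rewrite inE /= => hw.
  have cF : {for w, continuous (fun w => nm (F w))}.
    by apply: continuous_nm_comp; have [/hderiv_continuous] := hF w (le_lt_trans hw rr).
  have cn : {for w, continuous (fun w => nm (w - a))} by exact: continuous_nm.
  by apply: (@continuousD _ _ _ (fun w => nm (F w) ^+ 2) (fun w =>
    eps * nm (w - a) ^+ 2));
    [exact: continuousM | apply: continuousM; [exact: cst_continuous |
      exact: continuousM]].
- move=> x y /= hxy; have hlt := lt_trans hxy rr.
  have h1 := @is_lap_nm_sq F F1 (F2 (x +i* y)%C) x y.
  have h2 := @is_lap_nm_sq (fun w => w - a) (fun=> 1) 0 x y.
  exists (4 * nm (F1 (x +i* y)%C) ^+ 2 + eps * (4 * nm (1 : C) ^+ 2)).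
    apply: is_lapD; last apply: is_lapZ.
      apply: h1; last by have [] := hF _ hlt.
      have : nbhs ((x +i* y)%C : C) [set z : C | nm (z - a) < r'].
        by apply: open_nbhs_nbhs; split => //; exact: open_disc.
      by apply: filterS => w /hF[].
    apply: h2; last exact: hderiv_cst.
    by apply: near_everywhere => w; exact: hderiv_subc.
  by rewrite nm1 expr1n mulr1; apply: ltr_wpDl; [rewrite mulr_ge0 ?sqr_ge0 |
    rewrite mulr_gt0].
move=> w [/= w1 w2 w3].
have wr : nm (w - a) = r by apply/eqP; rewrite eq_le w1 leNgt; apply/negP.
have := w3 _ hz; rewrite /u wr /eps divfK ?gt_eqF ?exprn_gt0 // => h.
apply: le_trans (_ : nm (F z) ^+ 2 + eps * nm (z - a) ^+ 2 <= _).
  by rewrite lerDl mulr_ge0 ?sqr_ge0 // ltW.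
apply: (le_trans h); rewrite lerD2r ler_sqr ?nnegrE ?nm_ge0 //; exact: hM.
Qed.

End Holo.

(** * Subdivision of squares and primitives on intervals *)

Section Bisect.
Variable R : realType.

(** The left end points increase and stay below all right end points: their
    supremum lies in every interval. *)
Lemma nested_dyadic (d : nat -> R) : (forall n, d n <= d n.+1 /\
  d n.+1 + 2^-1 ^+ n.+1 <= d n + 2^-1 ^+ n) ->
  exists X, forall n, d n <= X <= d n + 2^-1 ^+ n.
Proof.
move=> hd.
have mono n k : d n <= d (n + k)%N /\ d (n + k)%N + 2^-1 ^+ (n + k) <= d n + 2^-1 ^+ n.
  elim: k => [|k [h1 h2]]; first by rewrite addn0.
  by have [h3 h4] := hd (n + k)%N; rewrite addnS; split;
    [exact: le_trans h3 | exact: le_trans h2].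
have pos n : 0 < 2^-1 ^+ n :> R by rewrite exprn_gt0 // invr_gt0.
have cross m n : d m <= d n + 2^-1 ^+ n.
  have [mn|/ltnW nm] := leqP m n.
    have [+ _] := mono m (n - m)%N; rewrite subnKC // => h.
    by apply: (le_trans h); rewrite lerDl ltW.
  have [_] := mono n (m - n)%N; rewrite subnKC //; apply: le_trans.
  by rewrite lerDl ltW.
exists (sup (range d)) => n; apply/andP; split.
  apply: ub_le_sup; last by exists n.
  by exists (d 0%N + 2^-1 ^+ 0) => _ [m _ <-].
by apply: ge_sup; [exists (d 0%N); exists 0%N | move=> _ [m _ <-]].
Qed.

(** Subdivision of a square: a property which passes from the four quarters
    to the whole, and holds for all small squares around each point, holds
    for the unit square. Otherwise some quarter fails at each step, and the
    failing squares shrink to a point. *)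
Lemma square_bisection (P : R -> R -> R -> Prop) :
  (forall d e s, 0 < s -> P d e s -> P (d + s) e s -> P d (e + s) s ->
    P (d + s) (e + s) s ->
    P d e (s * 2)) ->
  (forall X Y, 0 <= X <= 1 -> 0 <= Y <= 1 -> exists2 r, 0 < r & forall d e s, 0 < s ->
    s < r ->
    0 <= d -> d + s <= 1 -> 0 <= e -> e + s <= 1 ->
    d <= X <= d + s -> e <= Y <= e + s -> P d e s) -> P 0 0 1.
Proof.
move=> split small; apply: contrapT => nP.
pose ok (s : R) (u v : R * R) := [/\ ~ P v.1 v.2 s, v.1 = u.1 \/ v.1 = u.1 + s & v.2
  = u.2 \/ v.2 = u.2 + s].
have step u s : exists v, 0 < s -> ~ P u.1 u.2 (s * 2) -> ok s u v.
  have [s0|s0] := pselect (0 < s); last by exists u.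
  have [nPu|nPu] := pselect (~ P u.1 u.2 (s * 2)); last by exists u.
  have H : exists v, ok s u v.
    apply: contrapT => nv; apply: nPu; apply: split => //;
      apply: contrapT => nq; apply: nv.
    - by exists (u.1, u.2); split => //=; left.
    - by exists (u.1 + s, u.2); split => //=; [right | left].
    - by exists (u.1, u.2 + s); split => //=; [left | right].
    - by exists (u.1 + s, u.2 + s); split => //=; right.
  by have [v hv] := H; exists v.
have [nxt hn] : exists nxt : R * R -> R -> R * R, forall u s, 0 < s ->
  ~ P u.1 u.2 (s * 2) -> ok s u (nxt u s).
  have /choice[F hF] : forall us : (R * R) * R, exists v, 0 < us.2 ->
    ~ P us.1.1 us.1.2 (us.2 * 2) -> ok us.2 us.1 v.
    by move=> [u s]; exact: step.
  by exists (fun u s => F (u, s)) => u s; exact: (hF (u, s)).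
pose u := fix u n := if n is m.+1 then nxt (u m) (2^-1 ^+ m.+1) else (0, 0).
have pos n : 0 < 2^-1 ^+ n :> R by rewrite exprn_gt0 // invr_gt0.
have half n : 2^-1 ^+ n.+1 * 2 = 2^-1 ^+ n :> R by rewrite exprSr mulfVK.
have nPn n : ~ P (u n).1 (u n).2 (2^-1 ^+ n).
  elim: n => [|n IH] /=; first by rewrite expr0.
  by have := hn (u n) _ (pos n.+1); rewrite half => /(_ IH)[].
have okn n : ok (2^-1 ^+ n.+1) (u n) (u n.+1).
  by have := hn (u n) _ (pos n.+1); rewrite half => /(_ (nPn n)).
have d1 n : (u n).1 <= (u n.+1).1 /\ (u n.+1).1 + 2^-1 ^+ n.+1 <= (u n).1 + 2^-1 ^+ n.
  have [_ h _] := okn n; have := half n; have := pos n.+1.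
  by case: h => -> *; split; lra.
have d2' n : (u n).2 <= (u n.+1).2 /\ (u n.+1).2 + 2^-1 ^+ n.+1 <= (u n).2 + 2^-1 ^+ n.
  have [_ _ h] := okn n; have := half n; have := pos n.+1.
  by case: h => -> *; split; lra.
have b1 n : 0 <= (u n).1 /\ (u n).1 + 2^-1 ^+ n <= 1.
  elim: n => [|n [h1 h2]]; first by rewrite /= expr0 add0r.
  by have [h3 h4] := d1 n; split; [exact: le_trans h3 | exact: le_trans h2].
have b2 n : 0 <= (u n).2 /\ (u n).2 + 2^-1 ^+ n <= 1.
  elim: n => [|n [h1 h2]]; first by rewrite /= expr0 add0r.
  by have [h3 h4] := d2' n; split; [exact: le_trans h3 | exact: le_trans h2].
have [X hX] := nested_dyadic d1; have [Y hY] := nested_dyadic d2'.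
have := small X Y; have := hX 0%N; have := hY 0%N;
  rewrite /= expr0 add0r => -> -> /(_ isT isT)[r r0 hr].
have [n hnr] : exists n, 2^-1 ^+ n < r.
  have c0 : (GRing.exp (2^-1 : R)) @ \oo --> (0 : R) by apply: cvg_expr;
    rewrite ger0_norm; lra.
  have [N _ /(_ N (leqnn N))] := (@cvgrPdist_lt _ _ _ _ _ _ _).1 c0 _ r0.
  by rewrite sub0r normrN ger0_norm ?ltW // => h; exists N.
apply: (nPn n); apply: hr => //; by [case: (b1 n) | case: (b2 n)].
Qed.
End Bisect.

Section Prim.
Variable R : realType.
Local Notation C := (Cx R).

Lemma real_primitive (p : R -> R) (a b : R) :
  (forall x, a <= x <= b -> {for x, continuous p}) ->
  exists P : R -> R, forall x, a < x < b -> is_derive x (1 : R) P (p x).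
Proof.
move=> cp; exists (fun x => \int[lebesgue_measure]_(t in `[a,
  x]) p t)%R => x /andP[ax xb].
have ip : lebesgue_measure.-integrable `[a, b] (EFin \o p).
  apply: continuous_compact_integrable; first exact: segment_compact.
  by apply: continuous_in_subspaceT => t; rewrite inE /= in_itv /=; exact: cp.
have cx : {for x, continuous p} by apply: cp; rewrite !ltW.
have [h1 h2] := continuous_FTC1_closed xb ip ax cx.
by split; [exact: h1 | rewrite -derive1E; exact: h2].
Qed.

Lemma cplx_primitive (p : R -> C) (a b : R) :
  (forall x, a <= x <= b -> exists d, curve_deriv p x d) ->
  exists P : R -> C, forall x, a < x < b -> curve_deriv P x (p x).
Proof.
move=> cp.
have [|P hP] := @real_primitive (fun t => complex.Re (p t)) a b.
  by move=> x /cp[d /curve_deriv_continuous[]].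
have [|Q hQ] := @real_primitive (fun t => complex.Im (p t)) a b.
  by move=> x /cp[d /curve_deriv_continuous[]].
by exists (fun t => (P t +i* Q t)%C) => x hx; split; [exact: hP | exact: hQ].
Qed.
End Prim.

(** * Goursat: integrals over rectangles vanish *)

Section Goursat.
Variable R : realType.
Local Notation C := (Cx R).
Variables (f df : C -> C) (w : R).
Hypothesis w0 : 0 < w.
Hypothesis hf : forall x y, `|x| <= w -> `|y| <= w ->
  hderiv f (x +i* y)%C (df (x +i* y)%C).

Lemma norm_le_segment (x : R) : - w <= x <= w -> `|x| <= w. Proof.
  by rewrite ler_norml. Qed.

Lemma horizontal_primitive : exists H : R -> R -> C, forall y x, `|y| <= w -> `|x| < w ->
  curve_deriv (H y) x (f (x +i* y)%C).
Proof.
have /choice[H hH] : forall y, exists P : R -> C, `|y| <= w -> forall x, - w < x < w ->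
  curve_deriv P x (f (x +i* y)%C).
  move=> y; have [hy|] := boolP (`|y| <= w); last by exists (fun=> 0).
  have [|P hP] := @cplx_primitive R (fun x => f (x +i* y)%C) (- w) w; last by exists P.
  move=> x /norm_le_segment hx; exists (df (x +i* y)%C).
  by apply: hderiv_line_x; exact: hf.
by exists H => y x hy; rewrite ltr_norml; exact: hH.
Qed.

Lemma vertical_primitive : exists V : R -> R -> C, forall x y, `|x| <= w -> `|y| < w ->
  curve_deriv (V x) y (f (x +i* y)%C).
Proof.
have /choice[H hH] : forall x, exists P : R -> C, `|x| <= w -> forall y, - w < y < w ->
  curve_deriv P y (f (x +i* y)%C).
  move=> x; have [hx|] := boolP (`|x| <= w); last by exists (fun=> 0).
  have [|P hP] := @cplx_primitive R (fun y => f (x +i* y)%C) (- w) w; last by exists P.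
  move=> y /norm_le_segment hy; exists ('i%C * df (x +i* y)%C).
  by apply: hderiv_line_y; exact: hf.
by exists H => y x hy; rewrite ltr_norml; exact: hH.
Qed.

Section withHV.
Variables H V : R -> R -> C.
Hypothesis hH : forall y x, `|y| <= w -> `|x| < w -> curve_deriv (H y) x (f (x +i* y)%C).
Hypothesis hV : forall x y, `|x| <= w -> `|y| < w -> curve_deriv (V x) y (f (x +i* y)%C).

(** The integral of [f] along the boundary of a rectangle, with both
    horizontal and vertical integrals expressed by primitives on segments. *)
Definition rect_integral (x1 x2 y1 y2 : R) : C :=
  (H y1 x2 - H y1 x1) - (H y2 x2 - H y2 x1)
  + 'i%C * (V x2 y2 - V x2 y1) - 'i%C * (V x1 y2 - V x1 y1).

Lemma between (a b s c r : R) : Num.min a b <= s <= Num.max a b -> `|a - c| <= r ->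
  `|b - c| <= r -> `|s - c| <= r.
Proof.
by case: (leP a b) => _ /andP[h1 h2]; rewrite !ler_norml => /andP[? ?] /andP[? ?];
  apply/andP; split; lra.
Qed.

Lemma between_lt (a b s : R) : Num.min a b <= s <= Num.max a b -> `|a| < w -> `|b| < w ->
  `|s| < w.
Proof.
by case: (leP a b) => _ /andP[h1 h2]; rewrite !ltr_norml => /andP[? ?] /andP[? ?];
  apply/andP; split; lra.
Qed.

Lemma hderiv_quad (c d z0 z : C) :
  hderiv (fun z => c * z + d / 2 * (z - z0) ^+ 2) z (c + d * (z - z0)).
Proof.
have h1 := hderivZ c (hderiv_id z).
have h2 := hderiv_subc z z0.
have := hderivD h1 (hderivZ (d / 2) (hderivM h2 h2)).
rewrite (_ : c * 1 + _ = c + d * (z - z0)); last first.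
  have n2 : (2 : C) != 0 by rewrite pnatr_eq0.
  by field.
by apply: hderiv_near; apply: near_everywhere => t; rewrite expr2.
Qed.

(** Near a point [f] differs from its affine approximation, which has the
    primitive [p], by a small multiple of the size of the rectangle.
    Subtracting [p] from the primitives on the sides leaves increments
    bounded by the mean value inequality. *)
Lemma rect_integral_local (X Y e : R) : `|X| < w -> `|Y| < w -> 0 < e ->
  exists2 r, 0 < r & forall s x1 x2 y1 y2, s < r ->
    `|x1| < w -> `|x2| < w -> `|y1| < w -> `|y2| < w ->
    `|x1 - X| <= s -> `|x2 - X| <= s -> `|y1 - Y| <= s -> `|y2 - Y| <= s ->
    nm (rect_integral x1 x2 y1 y2) <= e * s ^+ 2.
Proof.
move=> hX hY e0; set z0 : C := (X +i* Y)%C.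
have /hderivP D := hf (ltW hX) (ltW hY).
have [|r r0 hr] := D (e / 16); first by rewrite divr_gt0.
exists (r / 2); first by rewrite divr_gt0.
move=> s x1 x2 y1 y2 sr wx1 wx2 wy1 wy2 hx1 hx2 hy1 hy2.
have s0 : 0 <= s by apply: le_trans hx1.
pose A z := f z0 + df z0 * (z - z0).
pose p z := f z0 * z + df z0 / 2 * (z - z0) ^+ 2.
have hp z : hderiv p z (A z) by exact: hderiv_quad.
have hA x y : `|x - X| <= s -> `|y - Y| <= s -> nm (f (x +i* y)%C - A (x +i* y)%C) <=
  e / 8 * s.
  move=> hx hy.
  have hn : nm ((x +i* y)%C - z0 : C) <= s * 2.
    rewrite (_ : (x +i* y)%C - z0 = ((x - X) +i* (y - Y))%C :> C) //.
    by apply: (le_trans (nm_le_ReIm _ _)); lra.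
  have := hr ((x +i* y)%C - z0); rewrite (le_lt_trans hn); last by rewrite -ltr_pdivlMr.
  move=> /(_ isT); rewrite [_ + (_ - _)](_ : _ = (x +i* y)%C :> C);
    last by rewrite addrC subrK.
  rewrite /A opprD addrA => /le_trans; apply.
  by have : 0 <= e / 16 by [rewrite divr_ge0 // ltW]; nra.
have side_x y : `|y| < w -> `|y - Y| <= s ->
  nm ((H y x2 - p (x2 +i* y)%C) - (H y x1 - p (x1 +i* y)%C)) <= e / 8 * s * (2 * s).
  move=> wy hy; have dd : `|x2 - x1| <= 2 * s.
    by move: hx1 hx2; rewrite !ler_norml => /andP[? ?] /andP[? ?]; apply/andP; split; lra.
  have k0 : 0 <= e / 8 * s by rewrite mulr_ge0 // divr_ge0 // ltW.
  apply: le_trans (_ : e / 8 * s * `|x2 - x1| <= _); last by rewrite ler_wpM2l.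
  apply: (@mean_value_ineq R (fun t => H y t - p (t +i* y)%C) (fun t =>
    f (t +i* y)%C - A (t +i* y)%C)).
  move=> t ht; split; last by apply: hA => //; exact: between ht hx1 hx2.
  apply: curve_derivB; first by apply: hH; [exact: ltW | exact: between_lt ht wx1 wx2].
  by apply: hderiv_line_x.
have side_y x : `|x| < w -> `|x - X| <= s ->
  nm (('i%C * V x y2 - p (x +i* y2)%C) - ('i%C * V x y1 - p (x +i* y1)%C)) <= e / 8 *
    s * (2 * s).
  move=> wx hx; have dd : `|y2 - y1| <= 2 * s.
    by move: hy1 hy2; rewrite !ler_norml => /andP[? ?] /andP[? ?]; apply/andP; split; lra.
  have k0 : 0 <= e / 8 * s by rewrite mulr_ge0 // divr_ge0 // ltW.
  apply: le_trans (_ : e / 8 * s * `|y2 - y1| <= _); last by rewrite ler_wpM2l.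
  apply: (@mean_value_ineq R (fun t => 'i%C * V x t - p (x +i* t)%C) (fun t =>
    'i%C * (f (x +i* t)%C - A (x +i* t)%C))).
  move=> t ht; split; last first.
    by rewrite nmM nmi mul1r; apply: hA => //; exact: between ht hy1 hy2.
  rewrite mulrBr; apply: curve_derivB; last exact: hderiv_line_y.
  by apply: curve_derivZ; apply: hV; [exact: ltW | exact: between_lt ht wy1 wy2].
have -> : rect_integral x1 x2 y1 y2 =
  ((H y1 x2 - p (x2 +i* y1)%C) - (H y1 x1 - p (x1 +i* y1)%C))
  - ((H y2 x2 - p (x2 +i* y2)%C) - (H y2 x1 - p (x1 +i* y2)%C))
  + (('i%C * V x2 y2 - p (x2 +i* y2)%C) - ('i%C * V x2 y1 - p (x2 +i* y1)%C))
  - (('i%C * V x1 y2 - p (x1 +i* y2)%C) - ('i%C * V x1 y1 - p (x1 +i* y1)%C)).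
  by rewrite /rect_integral; ring.
have t1 := side_x _ wy1 hy1; have t2 := side_x _ wy2 hy2.
have t3 := side_y _ wx2 hx2; have t4 := side_y _ wx1 hx1.
apply: (le_trans (nmD _ _)); rewrite nmN.
apply: le_trans (lerD (nmD _ _) t4) _.
apply: le_trans (lerD (lerD (nmD _ _) t3) (lexx _)) _; rewrite nmN.
apply: le_trans (lerD (lerD (lerD t1 t2) (lexx _)) (lexx _)) _.
by lra.
Qed.

(** The integral is additive under subdivision into four, and small compared
    with the area for small rectangles. *)
Lemma goursat x1 x2 y1 y2 : `|x1| < w -> `|x2| < w -> `|y1| < w -> `|y2| < w ->
  rect_integral x1 x2 y1 y2 = 0.
Proof.
move=> wx1 wx2 wy1 wy2; apply/eqP; rewrite -nm_eq0 eq_le nm_ge0 andbT.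
apply/ler_addgt0Pr => e e0; rewrite add0r.
pose px d := x1 + (x2 - x1) * d; pose py d := y1 + (y2 - y1) * d.
have inx a b d : `|a| < w -> `|b| < w -> 0 <= d <= 1 -> `|a + (b - a) * d| < w.
  move=> ha hb /andP[h1 h2].
  have -> : a + (b - a) * d = (1 - d) * a + d * b by ring.
  have [dd|dd] := ltP 0 d; last by rewrite (_ : d = 0) ?subr0 ?mul0r ?mul1r ?addr0 //;
    lra.
  apply: (le_lt_trans (ler_normD _ _)); rewrite !normrM (ger0_norm h1) ger0_norm
    ?subr_ge0 //.
  have := normr_ge0 a; nra.
have Hw : `|x2 - x1| < 2 * w /\ `|y2 - y1| < 2 * w.
  by move: wx1 wx2 wy1 wy2; rewrite !ltr_norml => /andP[? ?] /andP[? ?] /andP[? ?]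
    /andP[? ?]; split; apply/andP; split; lra.
have E : rect_integral x1 x2 y1 y2 = rect_integral (px 0) (px (0 + 1)) (py 0) (py (0 +
  1)).
  by rewrite /px /py !add0r !mulr0 !addr0 !mulr1 ![_ + (_ - _)]addrC !subrK.
rewrite E (_ : e = e * 1 ^+ 2); last by rewrite expr1n mulr1.
apply: (@square_bisection R (fun d e' s => nm (rect_integral (px d) (px (d +
  s)) (py e') (py (e' + s))) <= e * s ^+ 2)).
- move=> d e' s s0 h1 h2 h3 h4.
  have -> : rect_integral (px d) (px (d + s * 2)) (py e') (py (e' + s * 2)) =
    rect_integral (px d) (px (d + s)) (py e') (py (e' + s)) +
    rect_integral (px (d + s)) (px (d + s + s)) (py e') (py (e' + s)) +
    rect_integral (px d) (px (d + s)) (py (e' + s)) (py (e' + s + s)) +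
    rect_integral (px (d + s)) (px (d + s + s)) (py (e' + s)) (py (e' + s + s)).
    have -> : s * 2 = s + s by ring.
    by rewrite !addrA /rect_integral; ring.
  apply: (le_trans (nmD _ _)); apply: le_trans (lerD (nmD _ _) (lexx _)) _.
  apply: le_trans (lerD (lerD (nmD _ _) (lexx _)) (lexx _)) _.
  by apply: le_trans (lerD (lerD (lerD h1 h2) h3) h4) _; rewrite exprMn; lra.
- move=> X Y hX hY.
  have [|r r0 hr] := @rect_integral_local (px X) (py Y) (e / (2 * w) ^+ 2) (inx _ _ _
    wx1 wx2 hX) (inx _ _ _ wy1 wy2 hY).
    by rewrite divr_gt0 // exprn_gt0 // mulr_gt0.
  exists (r / (2 * w)); first by rewrite divr_gt0 // mulr_gt0.
  move=> d e' s s0 sr d0 d1 e0' e1 /andP[Xd Xs] /andP[Yd Ys].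
  have w2 : 0 < 2 * w by rewrite mulr_gt0.
  have := hr (s * (2 * w)) (px d) (px (d + s)) (py e') (py (e' + s)).
  rewrite -ltr_pdivlMr // sr => /(_ isT).
  rewrite (_ : e / (2 * w) ^+ 2 * (s * (2 * w)) ^+ 2 = e * s ^+ 2); last by field;
    rewrite gt_eqF.
  have bd (a b u v : R) : `|b - a| < 2 * w -> `|u - v| <= s ->
    `|a + (b - a) * u - (a + (b - a) * v)| <= s * (2 * w).
    move=> h1 h2; have -> : a + (b - a) * u - (a + (b - a) * v)
      = (u - v) * (b - a) by ring.
    by rewrite normrM; apply: ler_pM => //; exact: ltW.
  case: Hw => Hx Hy.
  apply.
  - by apply: inx => //; apply/andP; split; lra.
  - by apply: inx => //; apply/andP; split; lra.
  - by apply: inx => //; apply/andP; split; lra.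
  - by apply: inx => //; apply/andP; split; lra.
  - by apply: bd => //; rewrite ler_norml; apply/andP; split; lra.
  - by apply: bd => //; rewrite ler_norml; apply/andP; split; lra.
  - by apply: bd => //; rewrite ler_norml; apply/andP; split; lra.
  - by apply: bd => //; rewrite ler_norml; apply/andP; split; lra.
Qed.

End withHV.
End Goursat.

(** * Primitives of holomorphic functions *)

Section Primitive.
Variable R : realType.
Local Notation C := (Cx R).

Definition holo (f : C -> C) (z : C) := exists d, hderiv f z d.

Lemma holoP (f : C -> C) z : holo f z -> hderiv f z ('D_(1 : C) f z).
Proof. by move=> [d [h1 h2]]; constructor. Qed.

Lemma near_line_between (a b s : R) : Num.min a b <= s <= Num.max a b ->
  `|s - a| <= `|b - a|.
Proof.
case: (leP a b) => ab /andP[h1 h2].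
  by rewrite !ger0_norm ?subr_ge0 // lerB.
by rewrite !ler0_norm ?subr_le0 ?(ltW ab) //; lra.
Qed.

(** The primitive integrates from the centre along a horizontal and then a
    vertical segment; [goursat] exchanges the order when its increments are
    compared. *)
Lemma primitive_square (f df : C -> C) (w : R) : 0 < w ->
  (forall x y, `|x| <= w -> `|y| <= w -> hderiv f (x +i* y)%C (df (x +i* y)%C)) ->
  exists F : C -> C, forall x y, `|x| < w -> `|y| < w ->
    hderiv F (x +i* y)%C (f (x +i* y)%C).
Proof.
move=> w0 hf.
have [H hH] := horizontal_primitive hf; have [V hV] := vertical_primitive hf.
have w00 : `|0 : R| < w by rewrite normr0.
exists (fun z => (H 0 (complex.Re z) - H 0 0) + 'i%C * (V (complex.Re z) (complex.Im
  z) - V (complex.Re z) 0)).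
move=> x y hx hy; apply/hderivP => e e0.
have [|r r0 hr] := hderiv_cont (hf x y (ltW hx) (ltW hy)) (e := e / 2);
  first by rewrite divr_gt0.
exists (Num.min (r / 2) (Num.min (w - `|x|) (w - `|y|))).
  by rewrite !lt_min divr_gt0 // !subr_gt0 hx hy.
move=> [u v]; rewrite !lt_min => /and3P[n1 n2 n3] /=.
have hu := Re_le_nm (u +i* v)%C; have hv := Im_le_nm (u +i* v)%C; rewrite /= in hu hv.
set h : C := (u +i* v)%C in n1 n2 n3 hu hv *.
have hxu : `|x + u| < w by apply: (le_lt_trans (ler_normD _ _)); lra.
have hyv : `|y + v| < w by apply: (le_lt_trans (ler_normD _ _)); lra.
have c0 := goursat w0 hf hH hV hx hxu w00 hy.
set c := f (x +i* y)%C.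
have -> : (H 0 (x + u) - H 0 0 + 'i%C * (V (x + u) (y + v) - V (x + u) 0)) -
   (H 0 x - H 0 0 + 'i%C * (V x y - V x 0)) - c * h =
   ((H y (x + u) - c * ((x + u) +i* y)%C) - (H y x - c * (x +i* y)%C)) +
   (('i%C * V (x + u) (y + v) - c * ((x + u) +i* (y + v))%C) - ('i%C * V (x +
     u) y - c * ((x + u) +i* y)%C)).
  have -> : h = ((x + u) +i* (y + v))%C - (x +i* y)%C :> C.
    by apply/eqP; rewrite eq_complex /=; apply/andP; split; apply/eqP; ring.
  rewrite -[LHS]subr0 -c0 /rect_integral; ring.
have hfc s t : `|s - x| <= `|u| -> `|t - y| <= `|v| -> nm (f (s +i* t)%C - c) <= e / 2.
  move=> hs ht; apply: ltW; apply: hr.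
  rewrite (_ : (s +i* t)%C - (x +i* y)%C = ((s - x) +i* (t - y))%C :> C) //.
  by apply: (le_lt_trans (nm_le_ReIm _ _)); lra.
have m1 : nm ((H y (x + u) - c * ((x + u) +i* y)%C) - (H y x - c * (x +i* y)%C)) <= e
  / 2 * `|u|.
  have := @mean_value_ineq R (fun t => H y t - c * (t +i* y)%C) (fun t =>
    f (t +i* y)%C - c) (e / 2) x (x + u).
  rewrite [x + u - x]addrAC subrr add0r; apply => t ht; split.
    apply: curve_derivB; first by apply: hH; [exact: ltW | exact: between_lt ht hx hxu].
    by apply: (@hderiv_line_x R (fun z => c * z));
      have := hderivZ c (hderiv_id (t +i* y)%C); rewrite mulr1.
  have := near_line_between ht; rewrite [x + u - x]addrAC subrr add0r => ht'.
  by apply: hfc => //; rewrite subrr normr0.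
have m2 : nm (('i%C * V (x + u) (y + v) - c * ((x + u) +i* (y + v))%C) - ('i%C * V (x +
  u) y - c * ((x + u) +i* y)%C)) <= e / 2 * `|v|.
  have := @mean_value_ineq R (fun t => 'i%C * V (x + u) t - c * ((x +
    u) +i* t)%C) (fun t => 'i%C * (f ((x + u) +i* t)%C - c)) (e / 2) y (y + v).
  rewrite [y + v - y]addrAC subrr add0r; apply => t ht; split.
    rewrite mulrBr; apply: curve_derivB; first by apply: curve_derivZ; apply: hV;
      [exact: ltW | exact: between_lt ht hy hyv].
    by apply: (@hderiv_line_y R (fun z => c * z));
      have := hderivZ c (hderiv_id ((x + u) +i* t)%C); rewrite mulr1.
  have := near_line_between ht; rewrite [y + v - y]addrAC subrr add0r => ht'.
  rewrite nmM nmi mul1r.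
  by apply: hfc => //; rewrite [x + u - x]addrAC subrr add0r.
apply: (le_trans (nmD _ _)); apply: (le_trans (lerD m1 m2)).
nra.
Qed.

Lemma hderiv_line_real (f : C -> C) z (s : R) d : hderiv f (z + (s%:C)%C) d ->
  curve_deriv (fun t => f (z + (t%:C)%C)) s d.
Proof.
move=> /hderivP H; apply: curve_derivP => e /H[r r0 hr]; exists r => // h hh.
have e1 : z + ((s + h)%:C)%C = z + (s%:C)%C + (h%:C)%C :> C.
  by rewrite -addrA; congr (_ + _); apply/eqP; rewrite eq_complex /= addr0 !eqxx.
by have := hr (h%:C)%C; rewrite nmR e1 => /(_ hh).
Qed.

Lemma nm_le_sq (z : C) (w : R) : `|complex.Re z| <= w -> `|complex.Im z| <= w ->
  nm z <= 2 * w.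
Proof. by case: z => x y /= h1 h2; apply: (le_trans (nm_le_ReIm _ _)); lra. Qed.

Lemma primitive_disc (f : C -> C) (a : C) (r : R) : 0 < r ->
  (forall z, nm (z - a) < r * 3 -> holo f z) ->
  exists F : C -> C, forall z, nm (z - a) < r -> hderiv F z (f z).
Proof.
move=> r0 hf.
have [|F hF] := @primitive_square (fun z => f (z + a)) (fun z =>
  'D_(1 : C) f (z + a)) r r0.
  move=> x y hx hy; apply: hderiv_shift; apply: holoP; apply: hf.
  by rewrite addrK; apply: (le_lt_trans (@nm_le_sq (x +i* y)%C r hx hy)); lra.
exists (fun z => F (z - a)) => z hz.
have hx := le_lt_trans (Re_le_nm _) hz; have hy := le_lt_trans (Im_le_nm _) hz.
have := hF _ _ hx hy.
have -> : (complex.Re (z - a) +i* complex.Im (z - a))%C = z - a by case: (z - a).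
by rewrite subrK => h; apply: hderiv_shift.
Qed.

(** On the circle the mean value inequality bounds the increments F (z + h)
    - F z by h times a bound for [f] near the circle. If such a bound
    propagates to the disc, dividing by h bounds [f] there. *)
Lemma max_principle_of_primitive (F f : C -> C) (a : C) (r p M : R) : 0 < r -> r < p ->
  (forall z, nm (z - a) < p -> hderiv F z (f z)) ->
  (forall z, nm (z - a) < p -> {for z, continuous f}) ->
  (forall h K : R, 0 < h -> h < (p - r) / 2 -> (forall z, nm (z - a) = r ->
    nm (F (z + (h%:C)%C) - F z) <= K) ->
     forall z, nm (z - a) <= r -> nm (F (z + (h%:C)%C) - F z) <= K) ->
  (forall z, nm (z - a) = r -> nm (f z) <= M) ->
  forall z, nm (z - a) <= r -> nm (f z) <= M.
Proof.
move=> r0 rp hF cf hq hM z0 hz0; apply/ler_addgt0Pr => e e0.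
have e2 : 0 < e / 2 by rewrite divr_gt0.
pose P (d : R) (z : C) := nm (f (z + (d%:C)%C)) < M + e / 2.
have : \forall d \near (0 : R), [set z | nm (z - a) = r] `<=` P d.
  have cK : compact [set z | nm (z - a) = r].
    apply: (subclosed_compact _ (@compact_disc R a r)); last by move=> z /= ->.
    rewrite (_ : [set z : C | nm (z - a) = r] = (fun z : C =>
      nm (z - a)) @^-1` [set x | x = r]) //.
    by apply: closed_comp; [move=> z _; exact: continuous_nm | exact: (@closed_eq R r)].
  have := (compact_near_coveringP _).1 cK R (nbhs (0 : R)) P (nbhs_filter (0 : R));
    apply => z hz /=.
  have hzp : nm (z - a) < p by rewrite hz.
  have cn := continuous_nm_comp (cf _ hzp).
  have : \forall y \near z, nm (f y) < M + e / 2.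
    have := cn [set x | x < M + e / 2]; apply.
    by apply: open_nbhs_nbhs; split; [exact: open_lt | rewrite /=; have := hM _ hz; lra].
  move=> /nbhsC[d d0 hd].
  exists ([set y | nm (y - z) < d / 2], [set s | `|s| < d / 2]).
    split; first by apply/nbhsC; exists (d / 2); rewrite ?divr_gt0.
    by apply/nbhsR; exists (d / 2); [rewrite divr_gt0 | move=> y; rewrite subr0].
  move=> [y s] [/= h1 h2]; apply: hd.
  have -> : y + (s%:C)%C - z = (y - z) + (s%:C)%C by rewrite addrAC.
  by apply: (le_lt_trans (nmD _ _)); rewrite nmR; lra.
move=> /nbhsR[d d0 hd].
have /hderivP/(_ _ e2)[d' d'0 hd'] := hF _ (le_lt_trans hz0 rp).
pose h := Num.min (Num.min d d') ((p - r) / 2) / 2.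
have [h0 h1 h2 h3] : [/\ 0 < h, h < d, h < d' & h < (p - r) / 2].
  have m0 : 0 < Num.min (Num.min d d') ((p - r) / 2) by
    rewrite !lt_min d0 d'0 divr_gt0 // subr_gt0.
  have : h < Num.min (Num.min d d') ((p - r) / 2) by
    rewrite ltr_pdivrMr // ltr_pMr // ltr1n.
  by rewrite !lt_min => /andP[/andP[? ?] ?]; split => //; rewrite divr_gt0.
have H : forall z, nm (z - a) = r -> nm (F (z + (h%:C)%C) - F z) <= (M + e / 2) * h.
  move=> z hz.
  have := @mean_value_ineq_le R (fun t => F (z + (t%:C)%C)) (fun t =>
    f (z + (t%:C)%C)) (M + e / 2) 0 h (ltW h0).
  rewrite addr0 subr0; apply => s /andP[s0 sh]; last first.
    by apply: ltW; apply: hd => //; rewrite subr0 ger0_norm //; apply: le_lt_trans h1.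
  have hs : nm (z + (s%:C)%C - a) < p.
    rewrite addrAC; apply: (le_lt_trans (nmD _ _)); rewrite hz nmR ger0_norm //; lra.
  exact: hderiv_line_real (hF _ hs).
have hb := hq h ((M + e / 2) * h) h0 h3 H z0 hz0.
have := hd' (h%:C)%C; rewrite nmR (gtr0_norm h0) => /(_ h2) hc.
rewrite -(ler_pM2r h0).
have -> : nm (f z0) * h = nm (f z0 * (h%:C)%C) by rewrite nmM nmR gtr0_norm.
have -> : f z0 * (h%:C)%C = (F (z0 + (h%:C)%C) - F z0) - (F (z0 +
  (h%:C)%C) - F z0 - f z0 * (h%:C)%C) by ring.
apply: (le_trans (nmD _ _)); rewrite nmN; apply: (le_trans (lerD hb hc)).
by lra.
Qed.
End Primitive.

(** * The maximum principle for holomorphic functions *)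

Section MP.
Variable R : realType.
Local Notation C := (Cx R).

(** Increments of [F2] have two complex derivatives. *)
Lemma max_principle_primitive1 (F2 F1 f : C -> C) (a : C) (r p M : R) : 0 < r -> r < p ->
  (forall z, nm (z - a) < p -> hderiv F2 z (F1 z) /\ hderiv F1 z (f z)) ->
  (forall z, nm (z - a) = r -> nm (F1 z) <= M) ->
  forall z, nm (z - a) <= r -> nm (F1 z) <= M.
Proof.
move=> r0 rp hF; apply: (max_principle_of_primitive (p := p) (F := F2) r0 rp).
- by move=> z /hF[].
- by move=> z /hF[_ /hderiv_continuous].
move=> h K h0 hp hK; have pr : 0 < p - r by lra.
apply: (@max_principle_deriv2 R _ (fun z => F1 (z + (h%:C)%C) - F1 z) (fun z =>
  f (z + (h%:C)%C) - f z) a r ((p + r) / 2) _ r0) => //; first by lra.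
move=> z hz.
have z1 : nm (z - a) < p by lra.
have z2 : nm (z + (h%:C)%C - a) < p.
  by rewrite addrAC; apply: (le_lt_trans (nmD _ _)); rewrite nmR gtr0_norm //; lra.
have [h1 h2] := hF _ z1; have [h3 h4] := hF _ z2.
by split; apply: hderivB => //; exact: hderiv_shift.
Qed.

(** Increments of [F1] are derivatives of increments of [F2], and have a
    derivative of their own. *)
Lemma max_principle_primitive2 (F2 F1 f : C -> C) (a : C) (r p M : R) : 0 < r -> r < p ->
  (forall z, nm (z - a) < p -> [/\ hderiv F2 z (F1 z), hderiv F1 z (f z)
    & {for z, continuous f}]) ->
  (forall z, nm (z - a) = r -> nm (f z) <= M) ->
  forall z, nm (z - a) <= r -> nm (f z) <= M.
Proof.
move=> r0 rp hF; apply: (max_principle_of_primitive (p := p) (F := F1) r0 rp).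
- by move=> z /hF[].
- by move=> z /hF[].
move=> h K h0 hp hK; have pr : 0 < p - r by lra.
apply: (@max_principle_primitive1 (fun z => F2 (z + (h%:C)%C) - F2 z) (fun z =>
  F1 (z + (h%:C)%C) - F1 z) (fun z => f (z + (h%:C)%C) - f z) a r ((p + r) / 2) _ r0) =>
  //; first by lra.
move=> z hz.
have z1 : nm (z - a) < p by lra.
have z2 : nm (z + (h%:C)%C - a) < p.
  by rewrite addrAC; apply: (le_lt_trans (nmD _ _)); rewrite nmR gtr0_norm //; lra.
have [h1 h2 _] := hF _ z1; have [h3 h4 _] := hF _ z2.
by split; apply: hderivB => //; exact: hderiv_shift.
Qed.

Lemma holo_continuous (f : C -> C) z : holo f z -> {for z, continuous f}.
Proof. by move=> [d]; exact: hderiv_continuous. Qed.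

(** A holomorphic function is the second derivative of a second primitive.
    The radius shrinks by the factor 3 at each of the two primitives, and a
    last factor 2 leaves room for increments: this is the constant 18. *)
Lemma max_principle (f : C -> C) (a : C) (r M : R) : 0 < r ->
  (forall z, nm (z - a) < r * 18 -> holo f z) ->
  (forall z, nm (z - a) = r -> nm (f z) <= M) ->
  forall z, nm (z - a) <= r -> nm (f z) <= M.
Proof.
move=> r0 hf.
have [||F1 hF1] := @primitive_disc R f a (r * 6); first by rewrite mulr_gt0.
  by move=> z hz; apply: hf; lra.
have [||F2 hF2] := @primitive_disc R F1 a (r * 2); first by rewrite mulr_gt0.
  by move=> z hz; exists (f z); apply: hF1; lra.
apply: (@max_principle_primitive2 F2 F1 f a r (r * 2)) => //; first by lra.
move=> z hz; split; [exact: hF2 | by apply: hF1; lra |].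
by apply: holo_continuous; apply: hf; lra.
Qed.

Lemma continuousP_nm (f : C -> C) z : {for z, continuous f} <->
  forall e : R, 0 < e -> exists2 d : R, 0 < d & forall w, nm (w - z) < d ->
    nm (f w - f z) < e.
Proof.
split.
  move=> cf e e0.
  have := cf [set y | nm (y - f z) < e]; rewrite /= => H.
  have /nbhsC[d d0 hd] : \forall w \near z, nm (f w - f z) < e.
    by apply: H; apply/nbhsC; exists e.
  by exists d.
move=> H; move=> A /nbhsC[e e0 he]; apply/nbhsC; have [d d0 hd] := H _ e0.
by exists d => // w /hd; exact: he.
Qed.

Lemma hderiv_mul_cont (g : C -> C) e : {for e, continuous g} ->
  hderiv (fun z => (z - e) * g z) e (g e).
Proof.
move=> /continuousP_nm cg; apply/hderivP => eps eps0.
have [d d0 hd] := cg _ eps0; exists d => // h hh.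
have := hd (e + h); rewrite addrAC subrr add0r => /(_ hh) /ltW h1.
rewrite mul0r subr0 [h * _]mulrC -mulrBl nmM; exact: ler_wpM2r (nm_ge0 _) _ _ h1.
Qed.

(** Geometric growth with a larger ratio wins over any constant. *)
Lemma exists_expr_lt (q B x M : R) : 0 < q -> 0 <= M -> M < x ->
  exists n, B * M ^+ n < q * x ^+ n.
Proof.
move=> q0 M0 Mx; have x0 : 0 < x by apply: le_lt_trans Mx.
have rho1 : `|M / x| < 1 by rewrite ger0_norm ?divr_ge0 ?ltr_pdivrMr ?mul1r // ltW.
have c0 : (GRing.exp (M / x : R)) @ \oo --> (0 : R) by apply: cvg_expr.
have qB : 0 < q / (`|B| + 1) by rewrite divr_gt0 // ltr_wpDl.
have [N _ /(_ N (leqnn N))] := (@cvgrPdist_lt _ _ _ _ _ _ _).1 c0 _ qB.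
rewrite sub0r normrN ger0_norm; last by rewrite exprn_ge0 // divr_ge0 // ltW.
rewrite ltr_pdivlMr ?ltr_wpDl // => h; exists N.
move: h; rewrite expr_div_n mulrAC ltr_pdivrMr ?exprn_gt0 //; apply: le_lt_trans.
rewrite mulrC ler_wpM2l ?exprn_ge0 //.
by apply: (le_trans (ler_norm _)); rewrite lerDl.
Qed.

Lemma punctured_disc_avoids (z : C) (E : seq C) : exists2 d : R, 0 < d
  & forall w, w != z -> nm (w - z) < d -> w \notin E.
Proof.
elim: E => [|x E [d d0 hd]]; first by exists 1.
have [->|xz] := eqVneq x z.
  by exists d => // w wz /(hd w wz); rewrite in_cons negb_or wz.
exists (Num.min d (nm (x - z))).
  by rewrite lt_min d0 nm_gt0 subr_eq0 xz.
move=> w wz; rewrite lt_min => /andP[/(hd w wz) h1 h2].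
rewrite in_cons negb_or h1 andbT; apply: contraTneq h2 => ->.
by rewrite ltxx.
Qed.

(** Multiply a high power of [f] by the polynomial with the exceptional
    points as zeros: the product is holomorphic everywhere, and taking n-th
    roots removes the polynomial from the estimate. The exceptional points
    themselves are reached by continuity. *)
Lemma max_principle_off_points (E : seq C) (f : C -> C) (a : C) (r M : R) : 0 < r ->
  (forall z, nm (z - a) < r * 18 -> {for z, continuous f}) ->
  (forall z, nm (z - a) < r * 18 -> z \notin E -> holo f z) ->
  (forall z, nm (z - a) = r -> nm (f z) <= M) ->
  forall z, nm (z - a) <= r -> nm (f z) <= M.
Proof.
move=> r0 cf hf hM.
have M0 : 0 <= M.
  apply: (le_trans (nm_ge0 _) (hM (a + (r%:C)%C) _)).
  by rewrite addrAC subrr add0r nmR gtr0_norm.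
pose Q z := \prod_(e <- E) (z - e).
have hQ z : holo Q z.
  rewrite /Q; elim: E {hf Q} => [|e E [d hd]].
    by exists 0; under eq_fun do rewrite big_nil; exact: hderiv_cst.
  under eq_fun do rewrite big_cons.
  by eexists; apply: hderivM; [exact: hderiv_subc | exact: hd].
have off z : nm (z - a) <= r -> z \notin E -> nm (f z) <= M.
  move=> hz zE; rewrite leNgt; apply/negP => Mf.
  have Q0 : 0 < nm (Q z).
    rewrite nm_gt0 /Q prodf_seq_neq0; apply/allP => e eE /=.
    by rewrite subr_eq0; apply: contraNneq zE => ->.
  have [|B' hB] := @bounded_on_disc R (fun w => nm (Q w)) a r (ltW r0).
    by move=> w _; apply: continuous_nm_comp; exact: holo_continuous.
  have [n] := exists_expr_lt B' Q0 M0 Mf.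
  rewrite ltNge => /negP; apply.
  rewrite -nmX -nmM.
  apply: (@max_principle (fun w => Q w * f w ^+ n) a r _ r0 _ _ z hz); last first.
    move=> w hw; rewrite nmM nmX; apply: ler_pM; rewrite ?nm_ge0 ?exprn_ge0 ?nm_ge0 //.
      by apply: hB; rewrite hw.
    by apply: lerXn2r; rewrite ?nnegrE ?nm_ge0 //; exact: hM.
  move=> w hw; have [wE|wE] := boolP (w \in E); last first.
    have [b hb] := hQ w; have [c hc] := hf _ hw wE.
    have [d hd] := hderivX n hc.
    by eexists; apply: hderivM; [exact: hb | exact: hd].
  pose G z := \prod_(e <- rem w E) (z - e) * f z ^+ n.
  exists (G w).
  (* At an exceptional point the factor z - w of the polynomial makes the product
     differentiable. *)
  have e1 : (fun z => Q z * f z ^+ n) = (fun z => (z - w) * G z).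
    by apply/funext => t; rewrite /Q /G (big_rem w wE) /= mulrA.
  rewrite e1; apply: hderiv_mul_cont.
  apply: contM; last exact: contX (cf _ hw).
  have : holo (fun z => \prod_(e <- rem w E) (z - e)) w.
    elim: (rem w E) => [|e E' [d hd]].
      by exists 0; under eq_fun do rewrite big_nil; exact: hderiv_cst.
    under eq_fun do rewrite big_cons.
    by eexists; apply: hderivM; [exact: hderiv_subc | exact: hd].
  exact: holo_continuous.
move=> z; rewrite le_eqVlt => /predU1P[/hM //|hz].
rewrite leNgt; apply/negP => Mf.
have e0 : 0 < nm (f z) - M by rewrite subr_gt0.
have hz18 : nm (z - a) < r * 18 by lra.
have [d d0 hd] := (continuousP_nm _ _).1 (cf _ hz18) _ e0.
have [d' d'0 hd'] := punctured_disc_avoids z E.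
pose t := Num.min (Num.min d d') (r - nm (z - a)) / 2.
have [t0 t1 t2 t3] : [/\ 0 < t, t < d, t < d' & t < r - nm (z - a)].
  have m0 : 0 < Num.min (Num.min d d') (r - nm (z - a)) by
    rewrite !lt_min d0 d'0 subr_gt0.
  have : t < Num.min (Num.min d d') (r - nm (z - a)) by
    rewrite ltr_pdivrMr // ltr_pMr // ltr1n.
  by rewrite !lt_min => /andP[/andP[? ?] ?]; split => //; rewrite divr_gt0.
pose w := z + (t%:C)%C.
have wz : w - z = (t%:C)%C by rewrite /w addrAC subrr add0r.
have nwz : nm (w - z) = t by rewrite wz nmR gtr0_norm.
have wnz : w != z by rewrite -subr_eq0 -nm_eq0 nwz gt_eqF.
have := off w; have -> : nm (w - a) <= r.
  rewrite [w - a](_ : _ = (w - z) + (z - a)); last by rewrite addrA subrK.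
  by apply: (le_trans (nmD _ _)); rewrite nwz; lra.
rewrite hd' ?nwz // => /(_ isT isT) hw.
have := hd w; rewrite nwz => /(_ t1).
have : nm (f z) <= nm (f w) + nm (f w - f z).
  rewrite [X in _ <= _ + X]nmB.
  by rewrite [f z in X in X <= _](_ : f z = f w + (f z - f w)) ?nmD // addrC subrK.
by lra.
Qed.

End MP.

(** * Removable singularities and isolated zeros *)

Section Fact.
Variable R : realType.
Local Notation C := (Cx R).

(** The value at [w] makes the quotient continuous there when [g] is
    differentiable at [w]. *)
Definition diff_quot (g : C -> C) (w z : C) : C :=
  if z == w then 'D_(1 : C) g w else (g z - g w) / (z - w).

Lemma diff_quotE (g : C -> C) (w z : C) : (z - w) * diff_quot g w z = g z - g w.
Proof.
rewrite /diff_quot; have [->|zw] := eqVneq z w; first by rewrite !subrr mul0r.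
by rewrite mulrC divfK // subr_eq0.
Qed.

Lemma near_neq (z w : C) : z != w -> \forall t \near z, t != w.
Proof.
move=> zw; apply/nbhsC; exists (nm (z - w)).
  by rewrite nm_gt0 subr_eq0.
move=> t h; apply: contraTneq h => ->.
by rewrite nmB ltxx.
Qed.

Lemma near_diff_quot (g : C -> C) (w z : C) : z != w ->
  \forall t \near z, (g t - g w) / (t - w) = diff_quot g w t.
Proof. by move=> /near_neq; apply: filterS => t /negbTE tw; rewrite /diff_quot tw. Qed.

Lemma diff_quot_holo (g : C -> C) (w z : C) : z != w -> holo g z ->
  holo (diff_quot g w) z.
Proof.
move=> zw [d hd]; eexists; apply: (hderiv_near (near_diff_quot g zw)).
apply: hderivM; first by apply: hderivB; [exact: hd | exact: hderiv_cst].
by apply: hderivV; [rewrite subr_eq0 | exact: hderiv_subc].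
Qed.

Lemma diff_quot_cont (g : C -> C) (w z : C) : z != w -> {for z, continuous g} ->
  {for z, continuous (diff_quot g w)}.
Proof.
move=> zw cg; apply: (near_eq_continuous (near_diff_quot g zw)).
apply: (@continuousM C C (fun t => g t - g w) (fun t => (t - w)^-1)).
  exact: cont_subc.
apply: holo_continuous; eexists; apply: hderivV; first by rewrite subr_eq0.
exact: hderiv_subc.
Qed.

Lemma diff_quot_cont_center (g : C -> C) (w : C) : holo g w ->
  {for w, continuous (diff_quot g w)}.
Proof.
move=> /holoP /hderivP hd; apply/continuousP_nm => e e0.
have e2 : 0 < e / 2 by rewrite divr_gt0.
have [r r0 hr] := hd _ e2; exists r => // t ht.
have := hr _ ht; rewrite [w + _]addrC subrK /diff_quot eqxx.
have [->|tw] := eqVneq t w; first by move=> _; rewrite ?eqxx subrr nm0.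
have n0 : 0 < nm (t - w) by rewrite nm_gt0 subr_eq0.
have -> : g t - g w - 'D_1 g w * (t - w) = ((g t - g w) / (t - w) - 'D_1 g w) * (t - w).
  by rewrite mulrBl divfK // subr_eq0.
rewrite nmM ler_pM2r // => h; apply: (le_lt_trans h).
by rewrite ltr_pdivrMr // ltr_pMr // ltr1n.
Qed.

Lemma real_cauchy_limit (q : C -> R) (a : C) :
  (forall e : R, 0 < e -> exists2 d : R, 0 < d & forall w w', 0 < nm (w - a) < d ->
    0 < nm (w' - a) < d -> `|q w - q w'| <= e) ->
  exists l, forall e : R, 0 < e -> exists2 d : R, 0 < d & forall w, 0 < nm (w - a) < d ->
    `|q w - l| <= e.
Proof.
move=> hq.
have ex (d : R) : 0 < d -> exists w, 0 < nm (w - a) < d.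
  move=> d0; exists (a + ((d / 2)%:C)%C); rewrite addrAC subrr add0r nmR gtr0_norm
    ?divr_gt0 //=.
  by rewrite ltr_pdivrMr // ltr_pMr // ltr1n.
have : cvg (q @ a^').
  apply: cauchy_cvg; apply: cauchy_exP => e /= e0.
  have [d d0 hd] := hq (e / 2) ltac:(by rewrite divr_gt0).
  have [w' hw'] := ex _ d0.
  exists (q w'); suff : \forall w \near a^', ball (q w') e (q w) by [].
  rewrite near_withinE; apply/nbhsC; exists d => // w h1 h2.
  rewrite /= -ball_normE /= distrC; apply: (le_lt_trans (hd w w' _ hw')).
    by rewrite h1 lt_def nm_ge0 nm_eq0 subr_eq0 h2.
  by rewrite ltr_pdivrMr // ltr_pMr // ltr1n.
move=> /cvg_ex[l hl]; exists l => e e0.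
have : \forall w \near a^', `|l - q w| <= e := (@cvgrPdist_le _ _ _ _ _ _ _).1 hl _ e0.
rewrite near_withinE => hn; have [d d0 hd] := (nbhsC a _).1 (hn _);
  exists d => // w /andP[h1 h2].
rewrite distrC; apply: hd => //.
by apply: contraTneq h1 => ->; rewrite subrr nm0 ltxx.
Qed.

Lemma cplx_cauchy_limit (q : C -> C) (a : C) :
  (forall e : R, 0 < e -> exists2 d : R, 0 < d & forall w w', 0 < nm (w - a) < d ->
    0 < nm (w' - a) < d -> nm (q w - q w') <= e) ->
  exists l, forall e : R, 0 < e -> exists2 d : R, 0 < d & forall w, 0 < nm (w - a) < d ->
    nm (q w - l) <= e.
Proof.
move=> hq.
have [|l hl] := @real_cauchy_limit (fun w => complex.Re (q w)) a.
  move=> e /hq[d d0 hd]; exists d => // w w' h h'; apply: le_trans (hd _ _ h h').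
  by have := Re_le_nm (q w - q w'); case: (q w) => ? ?; case: (q w').
have [|k hk] := @real_cauchy_limit (fun w => complex.Im (q w)) a.
  move=> e /hq[d d0 hd]; exists d => // w w' h h'; apply: le_trans (hd _ _ h h').
  by have := Im_le_nm (q w - q w'); case: (q w) => ? ?; case: (q w').
exists (l +i* k)%C => e e0; have e2 : 0 < e / 2 by rewrite divr_gt0.
have [d d0 hd] := hl _ e2; have [d' d'0 hd'] := hk _ e2.
exists (Num.min d d'); first by rewrite lt_min d0.
move=> w; rewrite lt_min => /and3P[w0 w1 w2].
have := hd w; rewrite w0 w1 => /(_ isT) h1.
have := hd' w; rewrite w0 w2 => /(_ isT) h2.
move: h1 h2; case: (q w) => x y /= h1 h2.
apply: (le_trans (nm_le_ReIm (x - l) (y - k))); lra.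
Qed.

Lemma disc_bound (f : C -> C) a (r : R) : 0 < r -> (forall z, nm (z - a) <= r ->
  {for z, continuous f}) ->
  exists2 B, 0 <= B & forall z, nm (z - a) <= r -> nm (f z) <= B.
Proof.
move=> r0 cf; have [|B hB] := @bounded_on_disc R (fun w => nm (f w)) a r (ltW r0).
  by move=> z /cf; exact: continuous_nm_comp.
by exists B => //; apply: le_trans (nm_ge0 (f a)) (hB _ _); rewrite subrr nm0 ltW.
Qed.

(** Write g for the quotient; it is continuous, and holomorphic off [a]. Its
    own difference quotients at [a] form a Cauchy family: on a circle around
    [a] the quotients based at points w near [a] are uniformly close to the
    one based at [a], and the maximum principle carries the estimate between
    two of them from the circle to the point [a], the exceptional points
    being [a] and the two base points. *)
Lemma diff_quot_removable (f : C -> C) a (p : R) : 0 < p -> (forall z, nm (z - a) < p ->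
  holo f z) ->
  forall z, nm (z - a) < p -> holo (diff_quot f a) z.
Proof.
move=> p0 hf z hz; have [->|za] := eqVneq z a; last by apply: diff_quot_holo => //;
  exact: hf.
set g := diff_quot f a.
pose r := p / 20.
have r0 : 0 < r by rewrite divr_gt0.
have hg t : nm (t - a) < p -> t != a -> holo g t.
  by move=> h1 h2; apply: diff_quot_holo => //; exact: hf.
have aa : nm (a - a) < p by rewrite subrr nm0.
have cga : {for a, continuous g} by apply: diff_quot_cont_center; exact: hf.
have cg t : nm (t - a) < p -> {for t, continuous g}.
  by move=> ht; have [->//|ta] := eqVneq t a; apply: holo_continuous; exact: hg.
have [|B B0 hB] := @disc_bound g a r r0.
  by move=> t ht; apply: cg; apply: (le_lt_trans ht); rewrite /r; lra.
have circle (e : R) : 0 < e -> exists2 d : R, 0 < d & forall w t, 0 < nm (w - a) < d ->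
  nm (t - a) = r ->
    nm (diff_quot g w t - diff_quot g a t) <= e.
  move=> e0.
  have e4 : 0 < e * r / 4 by rewrite !mulr_gt0 ?invr_gt0.
  have [d d0 hd] := (continuousP_nm _ _).1 cga _ e4.
  have b1 : 0 < B + 1 by lra.
  (* Chosen so that 2 B d1 is at most e r^2 / 4; the other half of the estimate
     comes from continuity of g at a. *)
  pose d1 := e * r ^+ 2 / (8 * (B + 1)).
  have d10 : 0 < d1 by rewrite /d1 !mulr_gt0 ?exprn_gt0 // invr_gt0 mulr_gt0.
  exists (Num.min (Num.min d d1) (r / 2)); first by rewrite !lt_min d0 d10 divr_gt0.
  move=> w t; rewrite !lt_min => /andP[w0 /andP[/andP[w1 w2] w3]] tr.
  have tw : r / 2 <= nm (t - w).
    have : nm (t - a) <= nm (t - w) + nm (w - a) by rewrite [t - a](_ : _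
      = (t - w) + (w - a)) ?nmD // addrA subrK.
    by rewrite tr; lra.
  have twn : t - w != 0 by rewrite -nm_eq0 gt_eqF //; apply: lt_le_trans tw;
    rewrite divr_gt0.
  have tan : t - a != 0 by rewrite -nm_eq0 tr gt_eqF.
  have E : (diff_quot g w t - diff_quot g a t) * ((t - w) * (t - a))
    = (g t - g w) * (w - a) + (g a - g w) * (t - w).
    transitivity (((t - w) * diff_quot g w t) * (t - a) - ((t - a) * diff_quot g a t)
      * (t - w)); first by ring.
    by rewrite !diff_quotE; ring.
  have bw : nm (g t - g w) <= 2 * B.
    apply: (le_trans (nmD _ _)); rewrite nmN; have := hB t; rewrite tr => /(_ (lexx _)).
    have := hB w; have -> : nm (w - a) <= r by lra. move=> /(_ isT); lra.
  have gw := hd _ w1.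
  have Nb : nm ((g t - g w) * (w - a) + (g a - g w) * (t - w)) <= 2 * B * d1 +
    e * r / 4 * nm (t - w).
    apply: (le_trans (nmD _ _)); rewrite !nmM; apply: lerD.
      by apply: ler_pM; rewrite ?nm_ge0 // ltW.
    by apply: ler_wpM2r; [exact: nm_ge0 | rewrite nmB ltW].
  rewrite -E !nmM tr in Nb.
  have twr : nm (t - w) * r > 0 by rewrite mulr_gt0 // nm_gt0 twn.
  rewrite -(ler_pM2r twr); apply: (le_trans Nb).
  have Bd : 2 * B * d1 <= e * r ^+ 2 / 4.
    rewrite /d1 mulrA ler_pdivrMr ?mulr_gt0 //.
    have : 0 <= e * r ^+ 2 by rewrite mulr_ge0 ?sqr_ge0 // ltW.
    by nra.
  have er : 0 < e * r by rewrite mulr_gt0.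
  have h5 : e * r * (r / 2) <= e * r * nm (t - w) by rewrite ler_wpM2l // ltW.
  nra.
have [l hl] : exists l, forall e : R, 0 < e -> exists2 d : R, 0 < d
  & forall w, 0 < nm (w - a) < d -> nm ((g w - g a) / (w - a) - l) <= e.
  apply: cplx_cauchy_limit => e e0.
  have e2 : 0 < e / 2 by rewrite divr_gt0.
  have [d d0 hd] := circle _ e2.
  exists (Num.min d r); first by rewrite lt_min d0.
  move=> w w'; rewrite !lt_min => /and3P[w0 w1 w2] /and3P[w0' w1' w2'].
  have wa : w != a by apply: contraTneq w0 => ->; rewrite subrr nm0 ltxx.
  have wa' : w' != a by apply: contraTneq w0' => ->; rewrite subrr nm0 ltxx.
  have E v : v != a -> (g v - g a) / (v - a) = diff_quot g v a.
    move=> va; rewrite /diff_quot eq_sym (negbTE va) -[g v - g a]opprB -[v - a]opprB.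
    by rewrite invrN mulrNN.
  rewrite !E //.
  apply: (@max_principle_off_points R [:: a; w; w'] (fun t =>
    diff_quot g w t - diff_quot g w' t) a r e r0).
  - move=> t ht.
    have tp : nm (t - a) < p by apply: (lt_trans ht); rewrite /r; lra.
    have cq v : v != a -> nm (v - a) < r -> {for t, continuous (diff_quot g v)}.
      move=> va vr; have [->|tv] := eqVneq t v.
        by apply: diff_quot_cont_center; apply: hg => //; apply: (lt_trans vr);
          rewrite /r; lra.
      exact: (diff_quot_cont tv (cg _ tp)).
    by apply: contB; exact: cq.
  - move=> t ht; rewrite !inE !negb_or => /and3P[ta tw tw'].
    have tp : nm (t - a) < p by apply: (lt_trans ht); rewrite /r; lra.
    have [x hx] := diff_quot_holo tw (hg _ tp ta);
      have [y hy] := diff_quot_holo tw' (hg _ tp ta).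
    by exists (x - y); exact: hderivB.
  - move=> t tr.
    have h1 := hd w t; rewrite w0 w1 in h1; have {}h1 := h1 isT tr.
    have h2 := hd w' t; rewrite w0' w1' in h2; have {}h2 := h2 isT tr.
    rewrite [diff_quot g w t - _](_ : _ = (diff_quot g w t - diff_quot g a t) -
      (diff_quot g w' t - diff_quot g a t)); last by ring.
    by apply: (le_trans (nmD _ _)); rewrite nmN; lra.
  - by rewrite subrr nm0 ltW.
exists l; apply/hderivP => e e0.
have [d d0 hd] := hl _ e0; exists d => // h hh.
have [->|h0] := eqVneq h 0; first by rewrite addr0 subrr mulr0 subrr nm0 mulr0.
have := hd (a + h); rewrite addrAC subrr add0r hh nm_gt0 h0  => /(_ isT) hb.
have -> : g (a + h) - g a - l * h = ((g (a + h) - g a) / h - l) * h by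
  rewrite mulrBl divfK.
by rewrite nmM; apply: ler_wpM2r; rewrite ?nm_ge0.
Qed.

(** Divide by z - a as long as the value at [a] is 0. If this never stops,
    the maximum principle for the successive quotients bounds |f z| by B (|z
    - a| / r)^n for all n, so [f] vanishes near [a]. *)
Theorem zero_dichotomy (f : C -> C) a (p : R) : 0 < p -> (forall z, nm (z - a) < p ->
  holo f z) ->
  (exists2 r : R, 0 < r & forall z, nm (z - a) < r -> f z = 0) \/
  exists n (u : C -> C), [/\ forall z, nm (z - a) < p -> holo u z, u a != 0 &
     forall z, f z = (z - a) ^+ n * u z].
Proof.
move=> p0 hf.
pose g n := iter n (fun h => diff_quot h a) f.
have hg n z : nm (z - a) < p -> holo (g n) z.
  by elim: n z => [|n IH] z hz; [exact: hf | apply: diff_quot_removable hz].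
have fac n : (forall m, (m < n)%N -> g m a = 0) -> forall z, f z = (z - a) ^+ n * g n z.
  elim: n => [|n IH] h z; first by rewrite expr0 mul1r.
  rewrite IH; last by move=> m mn; apply: h; exact: ltnW.
  have := diff_quotE (g n) a z; rewrite (h n) // subr0 => <-.
  by rewrite exprSr mulrA.
have [[n gn]|all0] := pselect (exists n, g n a != 0).
  right; have ex : exists n, g n a != 0 by exists n.
  exists (ex_minn ex), (g (ex_minn ex)); case: ex_minnP => m gm hm; split => //.
    by move=> z; exact: hg.
  apply: fac => k km; apply/eqP; apply: contraTT km => gk; rewrite -leqNgt.
  exact: hm.
left; have {}all0 n : g n a = 0.
  by apply/eqP; apply: contrapT => /negP h; apply: all0; exists n.
pose r := p / 20.
have r0 : 0 < r by rewrite divr_gt0.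
exists r => // z hz.
have [|B B0 hB] := @disc_bound f a r r0.
  by move=> t ht; apply: holo_continuous; apply: hf; apply: (le_lt_trans ht);
    rewrite /r; lra.
apply/eqP; rewrite -nm_eq0; apply/negPn/negP => fz.
have fz0 : 0 < nm (f z) by rewrite lt_def fz nm_ge0.
have [n] := exists_expr_lt B fz0 (nm_ge0 _) hz.
rewrite ltNge => /negP; apply.
have hG : nm (g n z) <= B / r ^+ n.
  apply: (@max_principle R (g n) a r) => //; last exact: ltW.
    by move=> t ht; apply: hg; apply: (lt_trans ht); rewrite /r; lra.
  move=> t tr; rewrite ler_pdivlMr ?exprn_gt0 // -tr -nmX -nmM mulrC -fac //.
  by apply: hB; rewrite tr.
rewrite ler_pdivlMr ?exprn_gt0 // in hG.
rewrite (fac n) // nmM nmX -mulrA mulrC; apply: ler_wpM2r hG.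
by rewrite exprn_ge0 ?nm_ge0.
Qed.

End Fact.

(** * Bounded subharmonic functions on the plane are constant *)

Section Liouville.
Variable R : realType.
Local Notation C := (Cx R).

Lemma is_derive_quad (a b s : R) : is_derive s (1 : R) (fun s =>
  (s - a) ^+ 2 + b) (2 * (s - a)).
Proof.
have h1 : is_derive s (1 : R) (fun s => s - a) 1.
  have h : is_derive s (1 : R) (fun s => s - a) (1 - 0) :=
    is_deriveB (is_derive_id s 1) (is_derive_cst a s 1).
  by rewrite subr0 in h.
have h2 : is_derive s (1 : R) (fun s => (s - a) * (s - a) + b) _ :=
  is_deriveD (is_deriveM h1 h1) (is_derive_cst b s 1).
have -> : (fun s => (s - a) ^+ 2 + b) = (fun s => (s - a) * (s - a) + b) by
  apply/funext => t; rewrite expr2.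
by apply: (is_derive_eq h2); rewrite /GRing.scale /=; ring.
Qed.

Lemma is_derive_lin (a s : R) : is_derive s (1 : R) (fun s => 2 * (s - a)) 2.
Proof.
have h1 : is_derive s (1 : R) (fun s => s - a) (1 - 0) :=
  is_deriveB (is_derive_id s 1) (is_derive_cst a s 1).
have h2 : is_derive s (1 : R) (fun s => 2 * (s - a)) _ := is_deriveZ 2 h1.
by apply: (is_derive_eq h2); rewrite /GRing.scale /=; ring.
Qed.

Lemma near_quad_pos (a b x : R) : 0 < (x - a) ^+ 2 + b ->
  \forall s \near x, 0 < (s - a) ^+ 2 + b.
Proof.
move=> h; have := is_derive_continuous (is_derive_quad a b x).
move=> /(_ [set y | 0 < y]); apply.
by apply: open_nbhs_nbhs; split; [exact: open_gt | exact: h].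
Qed.

Lemma is_deriv2_ln_quad (a b x : R) : 0 < (x - a) ^+ 2 + b ->
  is_deriv2 (fun s => ln ((s - a) ^+ 2 + b)) x (2 / ((x - a) ^+ 2 +
    b) - 4 * (x - a) ^+ 2 / ((x - a) ^+ 2 + b) ^+ 2).
Proof.
move=> h; exists (fun s => 2 * (s - a) / ((s - a) ^+ 2 + b)).
  apply: filterS (near_quad_pos h) => s hs.
  have h1 := is_derive_quad a b s.
  have h2 : is_derive s (1 : R) (fun s => ln ((s - a) ^+ 2 + b)) _ :=
    @is_derive1_comp R (@ln R) (fun s => (s - a) ^+ 2 + b) s _ _ (is_derive1_ln hs) h1.
  by apply: (is_derive_eq h2); rewrite mulrC.
have h0 : (x - a) ^+ 2 + b != 0 by rewrite gt_eqF.
have h1 := is_derive_quad a b x.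
have hV : is_derive x (1 : R) (fun s => ((s - a) ^+ 2 + b)^-1) _ :=
    @is_deriveV R (fun s => (s - a) ^+ 2 + b) _ _ _ h0 h1.
have hM : is_derive x (1 : R) (fun s => 2 * (s - a) / ((s - a) ^+ 2 + b)) _ :=
  is_deriveM (is_derive_lin a x) hV.
by apply: (is_derive_eq hM); rewrite /GRing.scale /=; field.
Qed.

Lemma is_deriv2_inv_quad (a b x : R) : 0 < (x - a) ^+ 2 + b ->
  is_deriv2 (fun s => ((s - a) ^+ 2 + b)^-1) x (8 * (x - a) ^+ 2 / ((x - a) ^+ 2 +
    b) ^+ 3 - 2 / ((x - a) ^+ 2 + b) ^+ 2).
Proof.
move=> h; exists (fun s => - (((s - a) ^+ 2 + b)^-1 * ((s - a) ^+ 2 +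
  b)^-1 * (2 * (s - a)))).
  apply: filterS (near_quad_pos h) => s hs.
  have h0 : (s - a) ^+ 2 + b != 0 by rewrite gt_eqF.
  have h1 := is_derive_quad a b s.
  have hV : is_derive s (1 : R) (fun s => ((s - a) ^+ 2 + b)^-1) _ :=
    @is_deriveV R (fun s => (s - a) ^+ 2 + b) _ _ _ h0 h1.
  by apply: (is_derive_eq hV); rewrite /GRing.scale /=; field.
have h0 : (x - a) ^+ 2 + b != 0 by rewrite gt_eqF.
have h1 := is_derive_quad a b x.
have hV : is_derive x (1 : R) (fun s => ((s - a) ^+ 2 + b)^-1) _ :=
    @is_deriveV R (fun s => (s - a) ^+ 2 + b) _ _ _ h0 h1.
have hM : is_derive x (1 : R) (fun s => - (((s - a) ^+ 2 + b)^-1 * ((s - a) ^+ 2 +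
  b)^-1 * (2 * (s - a)))) _ :=
  is_deriveN (is_deriveM (is_deriveM hV hV) (is_derive_lin a x)).
by apply: (is_derive_eq hM); rewrite /GRing.scale /= fctE; field.
Qed.

Lemma nm_sq_sub (x y : R) (c : C) : nm ((x +i* y)%C - c : C) ^+ 2
  = (x - complex.Re c) ^+ 2 + (y - complex.Im c) ^+ 2.
Proof. by rewrite nm_sq; case: c. Qed.

Lemma nm_sq_pos (z c : C) : z != c -> 0 < nm (z - c) ^+ 2.
Proof. by move=> zc; rewrite exprn_gt0 // nm_gt0 subr_eq0 zc. Qed.

Lemma is_lap_ln (c : C) (x y : R) : (x +i* y)%C != c ->
  is_lap (fun z => ln (nm (z - c) ^+ 2)) x y 0.
Proof.
move=> /nm_sq_pos; rewrite nm_sq_sub; set a := complex.Re c; set b := complex.Im c => q0.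
have q0' : 0 < (y - b) ^+ 2 + (x - a) ^+ 2 by rewrite addrC.
eexists; eexists; split.
- under eq_fun do rewrite nm_sq_sub; exact: is_deriv2_ln_quad q0.
- under eq_fun do rewrite nm_sq_sub addrC; exact: is_deriv2_ln_quad q0'.
- rewrite -/a -/b; have := gt_eqF q0; have := gt_eqF q0'.
  by move=> /negbT h1 /negbT h2; field; rewrite ?h1 ?h2.
Qed.

Lemma is_lap_inv (c : C) (x y : R) : (x +i* y)%C != c ->
  is_lap (fun z => (nm (z - c) ^+ 2)^-1) x y (4 / (nm ((x +i* y)%C - c : C) ^+ 2) ^+ 2).
Proof.
move=> /nm_sq_pos; rewrite nm_sq_sub; set a := complex.Re c; set b := complex.Im c => q0.
have q0' : 0 < (y - b) ^+ 2 + (x - a) ^+ 2 by rewrite addrC.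
eexists; eexists; split.
- under eq_fun do rewrite nm_sq_sub; exact: is_deriv2_inv_quad q0.
- under eq_fun do rewrite nm_sq_sub addrC; exact: is_deriv2_inv_quad q0'.
- rewrite -/a -/b; have := gt_eqF q0; have := gt_eqF q0'.
  by move=> /negbT h1 /negbT h2; field; rewrite ?h1 ?h2.
Qed.

Lemma compact_annulus (c : C) (r r' : R) : compact [set z : C | r <= nm (z - c) <= r'].
Proof.
apply: (subclosed_compact _ (@compact_disc R c r')); last by move=> z /= /andP[].
rewrite (_ : [set z : C | r <= nm (z - c) <= r'] =
  (fun z : C => nm (z - c)) @^-1` [set x | r <= x] `&` (fun z : C =>
    nm (z - c)) @^-1` [set x | x <= r']).
  by apply: closedI; apply: closed_comp; [move=> z _;
    exact: continuous_nm | exact: (@closed_ge R r)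
    | move=> z _; exact: continuous_nm | exact: (@closed_le R r')].
by apply/seteqP; split => z /=; [move=> /andP[] | move=> [-> ->]].
Qed.

Lemma open_annulus (c : C) (r r' : R) : open [set z : C | r < nm (z - c) < r'].
Proof.
rewrite (_ : [set z : C | r < nm (z - c) < r'] =
  (fun z : C => nm (z - c)) @^-1` [set x | r < x] `&` (fun z : C =>
    nm (z - c)) @^-1` [set x | x < r']).
  by apply: openI; apply: open_comp; [move=> z _; exact: continuous_nm |
    exact: (@open_gt R r)
    | move=> z _; exact: continuous_nm | exact: (@open_lt R r')].
by apply/seteqP; split => z /=; [move=> /andP[] | move=> [-> ->]].
Qed.

(** Compare [u] on an annulus around [c] with the barrier ln |z - c|^2 - |z
    - c|^-2, whose Laplacian is negative. Subtracting a small multiple of it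
    makes the Laplacian positive, so the maximum is on the boundary: the
    inner circle gives nearly [u c], and on a large outer circle the barrier
    exceeds the upper bound of [u]. *)
Theorem liouville (u : C -> R) (B : R) : continuous u ->
  (forall x y, exists2 l, is_lap u x y l & 0 <= l) -> (forall z, u z <= B) ->
  forall t c, u t <= u c.
Proof.
move=> cu hl hB t c; have [->//|tc] := eqVneq t c.
have T0 : 0 < nm (t - c) by rewrite nm_gt0 subr_eq0.
apply/ler_addgt0Pr => e e0.
have [r r0 [rT hr]] : exists2 r, 0 < r & r < nm (t - c) /\ forall z, nm (z - c) <= r ->
  u z <= u c + e / 2.
  have e2 : 0 < e / 2 by rewrite divr_gt0.
  have := (@cvgrPdist_lt _ _ _ _ (nbhs_filter c) u (u c)).1 (cu c) _ e2.
  move=> /(nbhsC c _).1[d d0 hd].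
  exists (Num.min d (nm (t - c)) / 2); first by rewrite divr_gt0 // lt_min d0.
  have : Num.min d (nm (t - c)) / 2 < Num.min d (nm (t - c)).
    by rewrite ltr_pdivrMr ?lt_min ?d0 // ltr_pMr ?lt_min ?d0 // ltr1n.
  rewrite lt_min => /andP[h1 h2]; split => // z hz.
  have := hd z (le_lt_trans hz h1); rewrite ltr_norml => /andP[]; lra.
pose w (z : C) := ln (nm (z - c) ^+ 2) - (nm (z - c) ^+ 2)^-1.
pose wr := ln (r ^+ 2) - (r ^+ 2)^-1.
have wle (q q' : R) : 0 < q -> q <= q' -> ln q - q^-1 <= ln q' - q'^-1.
  move=> q0 qq; have q'0 := lt_le_trans q0 qq.
  by apply: lerB; [rewrite ler_ln ?posrE | rewrite lef_pV2 ?posrE].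
have key eps : 0 < eps -> u t <= u c + e / 2 + eps * (w t - wr).
  move=> eps0.
  have [Rb RbT Rbig] : exists2 Rb, nm (t - c) < Rb
    & B - u c - e / 2 <= eps * (ln (Rb ^+ 2) - (Rb ^+ 2)^-1 - wr).
    (* The logarithm of the outer radius squared must exceed K, with 1 to spare
       for the inverse square. *)
    pose K := (B - u c - e / 2) / eps + wr + 1.
    pose Rb := Num.max (nm (t - c) + 1) (Num.max 1 (expR K)).
    exists Rb; first by rewrite lt_max ltrDl ltr01.
    have R1 : 1 <= Rb by rewrite !le_max lexx !orbT.
    have RK : expR K <= Rb by rewrite !le_max lexx !orbT.
    have h1 : K <= ln (Rb ^+ 2).
      rewrite -[K]expRK ler_ln ?posrE ?expR_gt0 ?exprn_gt0 //; last by lra.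
      by apply: (le_trans RK); rewrite expr2 ler_peMr // ltW //; lra.
    have h2 : (Rb ^+ 2)^-1 <= 1 by rewrite invf_le1 ?exprn_gt0 //;
      [rewrite exprn_ege1 | lra].
    rewrite [eps * _]mulrC -ler_pdivrMr //; rewrite /K in h1; lra.
  have Rb0 : 0 < Rb by lra.
  pose Phi z := u z + (- eps) * w z.
  have := @max_on_boundary R [set z | r <= nm (z - c) <= Rb] [set z |
    r < nm (z - c) < Rb] Phi.
  case.
  - by exists t; rewrite /= !ltW.
  - exact: compact_annulus.
  - exact: open_annulus.
  - by move=> z /= /andP[/ltW -> /ltW ->].
  - apply: continuous_in_subspaceT => z; rewrite inE /= => /andP[h1 _].
    have zc : z != c by apply: contraTneq h1 => ->; rewrite subrr nm0 -ltNge.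
    have cn : {for z, continuous (fun z => nm (z - c) ^+ 2)}.
      by apply: (@continuousM R C (fun z => nm (z - c)) (fun z => nm (z - c)));
        exact: continuous_nm.
    apply: (@continuousD R R C u (fun z => - eps * w z)); first exact: cu.
    apply: (@continuousM R C (fun=> - eps) w); first exact: cst_continuous.
    apply: (@continuousB R R C (fun z => ln (nm (z - c) ^+ 2)) (fun z =>
      (nm (z - c) ^+ 2)^-1)).
      apply: (@continuous_comp _ _ _ (fun z => nm (z - c) ^+ 2) (@ln R) z cn).
      by apply: continuous_ln; exact: nm_sq_pos.
    by apply: continuousV cn; rewrite gt_eqF // nm_sq_pos.
  - move=> x y /= /andP[h1 h2].
    have zc : (x +i* y)%C != c by apply: contraTneq h1 => ->;
      rewrite subrr nm0 -leNgt ltW.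
    have [l hl1 l0] := hl x y.
    exists (l + - eps * (0 + -1 * (4 / (nm ((x +i* y)%C - c : C) ^+ 2) ^+ 2))).
      apply: is_lapD => //; apply: is_lapZ.
      have := is_lapD (is_lap_ln zc) (is_lapZ (-1) (is_lap_inv zc)).
      by congr is_lap; apply/funext => z; rewrite mulN1r.
    have : 0 < 4 / (nm ((x +i* y)%C - c : C) ^+ 2) ^+ 2 by
      rewrite divr_gt0 // exprn_gt0 // nm_sq_pos.
    by nra.
  move=> z [/= /andP[z1 z2] z3 z4].
  have ht : r <= nm (t - c) <= Rb by rewrite !ltW.
  have := z4 _ ht; rewrite /Phi => ht'.
  suff : u z + - eps * w z <= u c + e / 2 - eps * wr by lra.
  have [zr|zr] := eqVneq (nm (z - c)) r.
    have := hr z; rewrite zr lexx => /(_ isT).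
    by rewrite /w zr -/wr; lra.
  have zR : nm (z - c) = Rb.
    apply/eqP; rewrite eq_le z2 leNgt; apply/negP => h; apply: z3.
    by rewrite h lt_def zr z1.
  by rewrite /w zR; have := hB z; lra.
have [d0|d0] := lerP (w t - wr) 0.
  have := key 1 ltr01; rewrite mul1r; lra.
have eps0 : 0 < e / 2 / (w t - wr) by rewrite !divr_gt0.
have := key _ eps0; rewrite divfK ?gt_eqF //; lra.
Qed.
End Liouville.

(** * Charts and the anti-canonical cocycle *)

Section Manifold.
Variable R : realType.
Local Notation C := (Cx R).
Variables (n : nat) (X : complex_manifold R n).

Lemma coordP (c : chart X) (x : X) : patch c x -> dom c (coord c x) /\
  par c (coord c x) = x.
Proof. by move=> [z dz <-]; rewrite /coord; case: xgetP => [w -> [] //|/(_ z)[]]. Qed.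

Lemma coordK (c : chart X) z : dom c z -> coord c (par c z) = z.
Proof.
move=> dz; have [|d e] := @coordP c (par c z); first by exists z.
by apply: (par_inj (mem_set d) (mem_set dz) e).
Qed.

Lemma patch_open (c : chart X) : open (patch c).
Proof. by apply/(par_homeo (@subset_refl _ _)); exact: dom_open. Qed.

(** Charts are open maps, so neighbourhoods may be tested in coordinates. *)
Lemma par_near (c : chart X) z (P : set X) : dom c z -> nbhs (par c z) P ->
  \forall w \near z, dom c w /\ P (par c w).
Proof.
move=> dz; rewrite nbhsE => -[V [oV Vz] VP].
have oW : open (dom c `&` par c @^-1` V).
  apply/(par_homeo (@subIsetl _ _ _)).
  rewrite (_ : par c @` _ = patch c `&` V); first by apply: openI => //;
    exact: patch_open.
  apply/seteqP; split => x; first by move=> [w [dw Vw] <-]; split => //; exists w.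
  by move=> [[w dw <-] Vw]; exists w.
have : nbhs z (dom c `&` par c @^-1` V) by apply: open_nbhs_nbhs; split.
by apply: filterS => w [dw Vw]; split => //; exact: VP.
Qed.

Lemma transition_diff (c c' : chart X) z : dom c z -> patch c' (par c z) ->
  differentiable (transition c c') z.
Proof. exact: par_holo. Qed.

Lemma transitionP (c c' : chart X) z : patch c' (par c z) ->
  dom c' (transition c c' z) /\ par c' (transition c c' z) = par c z.
Proof. exact: coordP. Qed.

Lemma mul_jac m k (f : 'rV[C]_m -> 'rV[C]_k) z v : v *m 'J f z = 'd f z v.
Proof. by rewrite /jacobian mul_rV_lin1. Qed.

Lemma mx_ext m k (A B : 'M[C]_(m, k)) : (forall v : 'rV_m, v *m A = v *m B) -> A = B.
Proof. by move=> h; apply/row_matrixP => i; rewrite !rowE. Qed.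

Lemma jac_comp m k l (f : 'rV[C]_m -> 'rV[C]_k) (g : 'rV[C]_k -> 'rV[C]_l) z :
  differentiable f z -> differentiable g (f z) -> 'J (g \o f) z = 'J f z *m 'J g (f z).
Proof. by move=> df dg; apply: mx_ext => v; rewrite mulmxA !mul_jac diff_comp. Qed.

Lemma jac_near m k (f g : 'rV[C]_m -> 'rV[C]_k) z : differentiable f z ->
  differentiable g z ->
  (\forall w \near z, f w = g w) -> 'J f z = 'J g z.
Proof.
move=> df dg fg; apply: mx_ext => v.
have ef := @deriveEjacobian _ _ _ f z v df; have eg := @deriveEjacobian _ _ _ g z v dg.
exact: (etrans (etrans (esym ef) (near_eq_derive v fg)) eg).
Qed.

Lemma det_jac_comp m (f g : 'rV[C]_m -> 'rV[C]_m) z :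
  differentiable f z -> differentiable g (f z) -> \det ('J (g \o f) z)
    = \det ('J f z) * \det ('J g (f z)).
Proof. by move=> df dg; have -> := jac_comp df dg; exact: det_mulmx. Qed.

Lemma det_jac_near m (f g : 'rV[C]_m -> 'rV[C]_m) z : differentiable f z ->
  differentiable g z ->
  (\forall w \near z, f w = g w) -> \det ('J f z) = \det ('J g z).
Proof. by move=> df dg fg; have -> := jac_near df dg fg. Qed.

(** The chain rule and the multiplicativity of determinants. *)
Lemma anticanonical_cocycle (c c' c'' : chart X) z : dom c z -> patch c' (par c z) ->
  patch c'' (par c z) ->
  anticanonical X c c'' z = anticanonical X c c' z * anticanonical X c' c''
    (transition c c' z).
Proof.
move=> dz p1 p2; rewrite /anticanonical.
have [d1 e1] := transitionP p1.
have p2' : patch c'' (par c' (transition c c' z)) by rewrite e1.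
have dt := transition_diff dz p1; have dt' := transition_diff d1 p2'.
apply: (@etrans _ _ (\det ('J (transition c' c'' \o transition c c') z)));
  last exact: (det_jac_comp dt dt').
have dt2 := transition_diff dz p2.
have dt3 : differentiable (transition c' c'' \o transition c c') z :=
  differentiable_comp dt dt'.
refine (det_jac_near dt2 dt3 _).
have : nbhs (par c z) (patch c') by apply: open_nbhs_nbhs; split => //; exact: patch_open.
move=> /(par_near dz); apply: filterS => w [dw pw].
by rewrite /= /transition; have [_ ->] := coordP pw.
Qed.

Lemma anticanonical_id (c : chart X) z : dom c z -> anticanonical X c c z = 1.
Proof.
move=> dz; have pz : patch c (par c z) by exists z.
have di : differentiable (@id 'rV[C]_n) z by [].
have e1 : 'J (@id 'rV[C]_n) z = 1%:M.
  apply: mx_ext => v; have e := @deriveEjacobian _ _ _ id z v di.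
  by rewrite mulmx1; exact: (etrans (esym e) (derive_id z v)).
apply: (@etrans _ _ (\det ('J (@id 'rV[C]_n) z))); last by rewrite e1 det1.
refine (det_jac_near (transition_diff dz pz) di _).
have : nbhs z (dom c) by apply: open_nbhs_nbhs; split => //; exact: dom_open.
by apply: filterS => w dw; rewrite /transition coordK.
Qed.

Lemma anticanonical_neq0 (c c' : chart X) z : dom c z -> patch c' (par c z) ->
  anticanonical X c c' z != 0.
Proof.
move=> dz p1; have p0 : patch c (par c z) by exists z.
have := anticanonical_cocycle dz p1 p0; rewrite anticanonical_id // => /esym h.
by apply: contra_eq_neq h => ->; rewrite mul0r eq_sym oner_eq0.
Qed.

(** The partial derivatives are the entries of the Jacobian matrix; those of
    a coordinate function are often easier to compute than those of the map. *)
Lemma jac_entry m k (f : 'rV[C]_m -> 'rV[C]_k) z i j d : differentiable f z ->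
  is_derive z (delta_mx 0 i : 'rV[C]_m) (fun w => f w 0 j : C) d -> 'J f z i j = d.
Proof.
move=> df [_ <-].
set v := delta_mx 0 i : 'rV[C]_m.
have dv : derivable f z v by exact: diff_derivable.
have e := @deriveEjacobian _ _ _ f z v df.
have e2 : 'J f z i j = (v *m 'J f z) 0 j by rewrite /v -rowE [RHS]mxE.
apply: (etrans e2); apply: (etrans (congr1 (fun M : 'rV[C]_k => M 0 j) (esym e))).
have hl : (fun h : C => h^-1 *: (f (h *: v + z) - f z)) @ 0^' --> 'D_v f z := dv.
have hl2 : (fun h : C => (h^-1 *: (f (h *: v + z) - f z)) 0 j) @ 0^' --> ('D_v f z) 0 j.
  apply: (@cvg_comp _ _ _ (fun h : C => h^-1 *: (f (h *: v +
    z) - f z)) (fun N : 'rV[C]_k => N 0 j) _ _ _ hl).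
  exact: (@coord_continuous C 1 k 0 j ('D_v f z)).
apply: esym; apply: norm_cvg_lim.
have -> : (fun h : C => h^-1 *: (((fun w => f w 0 j) \o shift z) (h *: v) - f z 0 j)) =
  (fun h : C => (h^-1 *: (f (h *: v + z) - f z)) 0 j); last exact: hl2.
by apply/funext => h; rewrite !mxE.
Qed.

Lemma det2 (A : 'M[C]_2) : \det A = A 0 0 * A 1 1 - A 0 1 * A 1 0.
Proof.
rewrite (expand_det_row _ 0) !big_ord_recl big_ord0 addr0 /cofactor !det_mx11 !mxE /=.
rewrite expr0 expr1 mul1r mulN1r mulrN.
congr (A _ _ * A _ _ - A _ _ * A _ _); by apply/val_inj.
Qed.
End Manifold.

(** * Partial derivatives of quotients *)

Section Partial.
Variable R : realType.
Local Notation C := (Cx R).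

Lemma is_derive_coord (z : 'rV[C]_2) (i j : 'I_2) :
  is_derive z (delta_mx 0 i : 'rV[C]_2) (fun w : 'rV[C]_2 => w 0 j : C) (i == j)%:R.
Proof.
have hl : (fun h : C => h^-1 *: (((fun w : 'rV[C]_2 =>
  w 0 j : C) \o shift z) (h *: (delta_mx 0 i : 'rV[C]_2)) - z 0 j))
    @ (0 : C)^' --> ((i == j)%:R : C).
  apply: cvg_near_cst; rewrite near_withinE; apply: nearW => h h0.
  rewrite /= !mxE eqxx /= addrK [j == i]eq_sym /GRing.scale /= mulrA mulVf //.
  by rewrite mul1r.
split; first by apply/cvg_ex; exists ((i == j)%:R).
exact: (norm_cvg_lim hl).
Qed.

Lemma is_derive_ratio (a b : 'rV[C]_2 -> C) (z v : 'rV[C]_2) da db : b z != 0 ->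
  is_derive z v a da -> is_derive z v b db ->
  is_derive z v (fun w => a w / b w) ((da * b z - a z * db) / b z ^+ 2).
Proof.
move=> b0 ha [hb1 hb2].
have hV : is_derive z v (fun w => (b w)^-1) (- (b z) ^- 2 *: db).
  constructor; first exact: derivableV.
  by rewrite (deriveV b0 hb1) hb2.
have hM : is_derive z v (fun w => a w / b w) _ := is_deriveM ha hV.
by apply: (is_derive_eq hM); rewrite /GRing.scale /=; field.
Qed.

(** Coordinate changes of the projective plane and of its blow-up are
    quotients of affine or bilinear functions of the two coordinates, so
    this covers all of them. *)
Lemma det_jac_ratio (f : 'rV[C]_2 -> 'rV[C]_2) (z : 'rV[C]_2) (a b c d : 'rV[C]_2 -> C)
    (a0 a1 b0 b1 c0 c1 d0 d1 : C) :
  let e0 := delta_mx 0 0 : 'rV[C]_2 in let e1 := delta_mx 0 1 : 'rV[C]_2 in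
  differentiable f z -> b z != 0 -> d z != 0 ->
  (\forall w \near z, f w 0 0 = a w / b w /\ f w 0 1 = c w / d w) ->
  is_derive z e0 a a0 -> is_derive z e1 a a1 -> is_derive z e0 b b0 ->
    is_derive z e1 b b1 ->
  is_derive z e0 c c0 -> is_derive z e1 c c1 -> is_derive z e0 d d0 ->
    is_derive z e1 d d1 ->
  \det ('J f z) = ((a0 * b z - a z * b0) * (c1 * d z - c z * d1) - (c0 * d z - c z *
    d0) * (a1 * b z - a z * b1))
    / (b z ^+ 2 * d z ^+ 2).
Proof.
move=> e0 e1 df bz dz nf ha0 ha1 hb0 hb1 hc0 hc1 hd0 hd1.
have nf0 : \forall w \near z, a w / b w = f w 0 0 by apply: filterS nf => w [].
have nf1 : \forall w \near z, c w / d w = f w 0 1 by apply: filterS nf => w [].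
have j00 := jac_entry df (near_eq_is_derive nf0 (is_derive_ratio bz ha0 hb0)).
have j10 := jac_entry df (near_eq_is_derive nf0 (is_derive_ratio bz ha1 hb1)).
have j01 := jac_entry df (near_eq_is_derive nf1 (is_derive_ratio dz hc0 hd0)).
have j11 := jac_entry df (near_eq_is_derive nf1 (is_derive_ratio dz hc1 hd1)).
rewrite (det2 ('J f z)) j00 j01 j10 j11.
by field; rewrite bz dz.
Qed.

Lemma is_derive_aff (n0 n1 n2 : C) (z : 'rV[C]_2) (i : 'I_2) :
  is_derive z (delta_mx 0 i : 'rV[C]_2) (fun w => n0 + w 0 0 * n1 +
    w 0 1 * n2) ((i == 0)%:R * n1 + (i == 1)%:R * n2).
Proof.
have h : is_derive z (delta_mx 0 i : 'rV[C]_2) (fun w =>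
  n0 + w 0 0 * n1 + w 0 1 * n2) _ :=
  is_deriveD (is_deriveD (is_derive_cst n0 z _) (is_deriveM (is_derive_coord z i 0)
    (is_derive_cst n1 z _)))
   (is_deriveM (is_derive_coord z i 1) (is_derive_cst n2 z _)).
by apply: (is_derive_eq h); rewrite /GRing.scale /=; ring.
Qed.

Lemma is_derive_bil (n0 n1 n2 : C) (z : 'rV[C]_2) (i : 'I_2) :
  is_derive z (delta_mx 0 i : 'rV[C]_2) (fun w => n0 + w 0 0 * (n1 + w 0 1 * n2))
    ((i == 0)%:R * (n1 + z 0 1 * n2) + z 0 0 * ((i == 1)%:R * n2)).
Proof.
have h1 : is_derive z (delta_mx 0 i : 'rV[C]_2) (fun w => n1 + w 0 1 * n2) _ :=
  is_deriveD (is_derive_cst n1 z _) (is_deriveM (is_derive_coord z i 1) (is_derive_cst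
    n2 z _)).
have h : is_derive z (delta_mx 0 i : 'rV[C]_2) (fun w =>
  n0 + w 0 0 * (n1 + w 0 1 * n2)) _ :=
  is_deriveD (is_derive_cst n0 z _) (is_deriveM (is_derive_coord z i 0) h1).
by apply: (is_derive_eq h); rewrite /GRing.scale /=; ring.
Qed.

Lemma det3 (A : 'M[C]_3) : \det A =
  A 0 0 * (A 1 1 * A 2%:R 2%:R - A 1 2%:R * A 2%:R 1)
  - A 0 1 * (A 1 0 * A 2%:R 2%:R - A 1 2%:R * A 2%:R 0)
  + A 0 2%:R * (A 1 0 * A 2%:R 1 - A 1 1 * A 2%:R 0).
Proof.
rewrite (expand_det_row _ 0) !big_ord_recl big_ord0 addr0 /cofactor !det2 !mxE /=.
rewrite !expr0 !expr1 mul1r.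
have e1 : lift 0 0 = 1 :> 'I_3 by exact/val_inj.
have e2 : lift 0 1 = 2%:R :> 'I_3 by exact/val_inj.
have e3 : lift 1 0 = 0 :> 'I_3 by exact/val_inj.
have e4 : lift 1 1 = 2%:R :> 'I_3 by exact/val_inj.
have e5 : lift 2%:R 0 = 0 :> 'I_3 by exact/val_inj.
have e6 : lift 2%:R 1 = 1 :> 'I_3 by exact/val_inj.
have e7 : lift ord0 (lift ord0 ord0) = 2%:R :> 'I_3 by exact/val_inj.
have e8 : ord0 = 0 :> 'I_3 by exact/val_inj.
rewrite ?e7 ?e1 ?e2 ?e3 ?e4 ?e5 ?e6 ?e8.
have -> : (-1) ^+ (0 + bump 0 (bump 0 0)) = 1 :> C by rewrite /= -signr_odd.
ring.
Qed.
End Partial.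

(** * Changes of coordinates on the blow-up *)

Section Trans.
Variable R : realType.
Local Notation C := (Cx R).
Variables (p : 'I_9 -> P2 R) (p_inj : injective p).
Local Notation X := (blowup p_inj).

(** The homogeneous coordinates, in the basis of [c'], of the point with
    coordinates [z] in [c]. *)
Definition hom_coord (c c' : frame p) (z : 'rV[C]_2) (k : 'I_3) : C :=
  (bpoint c z *m invmx (sval c').1) 0 k.
Definition frame_change (c c' : frame p) : 'M[C]_3 := (sval c).1 *m invmx (sval c').1.

Lemma hom_coord_none (c c' : frame p) z k : (sval c).2 = None ->
  hom_coord c c' z k = frame_change c c' 0 k + z 0 0 * frame_change c c' 1 k +
    z 0 1 * frame_change c c' 2%:R k.
Proof. by move=> e; rewrite /hom_coord /bpoint e -mulmxA mulmx3E !vec3E mul1r. Qed.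

Lemma hom_coord_some (c c' : frame p) z k j : (sval c).2 = Some j ->
  hom_coord c c' z k = frame_change c c' 0 k + z 0 0 * (frame_change c c' 1 k +
    z 0 1 * frame_change c c' 2%:R k).
Proof. by move=> e; rewrite /hom_coord /bpoint e -mulmxA mulmx3E !vec3E mul1r mulrDr
  addrA mulrA. Qed.

Lemma dir_mul (K : 'M[C]_3) (s : C) : vec3 0 1 s *m K =
  (K 1 0 + s * K 2%:R 0) *: delta_mx 0 ord0 + vec3 0 (K 1 1 + s * K 2%:R 1) (K 1 2%:R +
    s * K 2%:R 2%:R).
Proof.
rewrite [RHS]vec3_eta [LHS]vec3_eta !mulmx3E !vec3E.
by congr vec3; rewrite !mxE /=; ring.
Qed.

Lemma trans_scale (c c' : frame p) z w : bdom c z -> bdom c' w -> bpar c' w = bpar c z ->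
  hom_coord c c' z 0 != 0 /\ bpoint c z = hom_coord c c' z 0 *: bpoint c' w.
Proof.
move=> dz dw e.
have ee : <[bpoint c z]>%VS = <[bpoint c' w]>%VS by
  rewrite -(bpar_line dz) -e (bpar_line dw).
have [a a0 ea] := vline_eqP (bpoint_neq0 _ _) (bpoint_neq0 _ _) ee.
have -> : hom_coord c c' z 0 = a.
  rewrite /hom_coord ea -scalemxAl mxE bpoint_coords.
  by case: ((sval c').2) => [j|]; rewrite vec3E mulr1.
by split.
Qed.

Lemma trans_coord0 (c c' : frame p) z w : bdom c z -> bdom c' w -> bpar c' w = bpar c z ->
  w 0 0 = hom_coord c c' z 1 / hom_coord c c' z 0.
Proof.
move=> dz dw e; have [n0 ez] := trans_scale dz dw e.
rewrite {1}/hom_coord ez -scalemxAl mxE bpoint_coords -/(hom_coord c c' z 0).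
by case: ((sval c').2) => [j|]; rewrite vec3E mulrAC divff // mul1r.
Qed.

Lemma trans_coord2 (c c' : frame p) z w : bdom c z -> bdom c' w -> bpar c' w = bpar c z ->
  hom_coord c c' z 2%:R = hom_coord c c' z 0 * (if (sval c').2 is Some _ then w 0 0 *
    w 0 1 else w 0 1).
Proof.
move=> dz dw e; have [n0 ez] := trans_scale dz dw e.
rewrite {1}/hom_coord ez -scalemxAl mxE bpoint_coords -/(hom_coord c c' z 0).
by case: ((sval c').2) => [j|]; rewrite vec3E.
Qed.

Lemma trans_coord1_none (c c' : frame p) z w : bdom c z -> bdom c' w ->
  bpar c' w = bpar c z ->
  (sval c').2 = None -> w 0 1 = hom_coord c c' z 2%:R / hom_coord c c' z 0.
Proof.
move=> dz dw e e'; have [n0 _] := trans_scale dz dw e.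
by have := trans_coord2 dz dw e; rewrite e' => ->; rewrite mulrAC divff // mul1r.
Qed.

(** In a chart around a centre the second coordinate is a slope, that is a
    quotient of homogeneous coordinates away from the centre. *)
Lemma trans_coord1_some (c c' : frame p) z w j : bdom c z -> bdom c' w ->
  bpar c' w = bpar c z ->
  (sval c').2 = Some j -> w 0 0 != 0 -> w 0 1 = hom_coord c c' z 2%:R / hom_coord c c'
    z 1.
Proof.
move=> dz dw e e' w0; have [n0 _] := trans_scale dz dw e.
have e2 := trans_coord2 dz dw e; rewrite e' in e2.
have e0 := trans_coord0 dz dw e.
have n1 : hom_coord c c' z 1 = hom_coord c c' z 0 * w 0 0 by rewrite e0 mulrC divfK.
by rewrite e2 n1; field; rewrite w0 n0.
Qed.

Lemma center_eq0 (c : frame p) z j : bdom c z -> (sval c).2 = Some j ->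
  (z 0 0 == 0) = (<[bpoint c z]>%VS == sval (p j)).
Proof.
move=> dz e; have [d0 dn] := bdir_center z e.
apply/eqP/eqP => [z0|].
  by rewrite (bpoint_some z e) z0 scale0r addr0 (frame_center e).
rewrite (frame_center e) => /(vline_eqP (bpoint_neq0 c z) (row0_neq0 (frame_unit
  c)))[a a0].
have -> : row ord0 (sval c).1 = vec3 1 0 0 *m (sval c).1.
  rewrite rowE; congr (_ *m _); rewrite [LHS]vec3_eta; congr vec3; by rewrite !mxE.
rewrite scalemxAl /bpoint e => /(can_inj (mulmxK (frame_unit c)))/rowP/(_ 1).
by rewrite !mxE /= mulr0.
Qed.

Lemma none_off_center (A : frame p) z i : bdom A z -> (sval A).2 = None ->
  <[bpoint A z]>%VS != sval (p i).
Proof. by move=> dz e; apply: dz; rewrite e. Qed.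

Lemma some_off_center (A c : frame p) z w j : bdom A z -> bdom c w ->
  bpar c w = bpar A z ->
  (sval c).2 = Some j -> (sval A).2 != Some j -> w 0 0 != 0.
Proof.
move=> dz dw e ec eA; rewrite (center_eq0 dw ec) -(bpar_line dw) e (bpar_line dz).
exact: dz.
Qed.

Lemma near_trans (c c' : chart X) z : dom c z -> patch c' (par c z) ->
  \forall w \near z, [/\ bdom c w, bdom c' (transition c c' w)
    & bpar c' (transition c c' w) = bpar c w].
Proof.
move=> dz pz; have : nbhs (par c z) (patch c') by apply: open_nbhs_nbhs; split => //;
  exact: patch_open.
by move=> /(par_near dz); apply: filterS => w [dw /coordP[h1 h2]]; split.
Qed.

(** The classical factor: K^-1 of the plane is O(3). *)
Lemma anticanonical_none_none (A c : frame p) z : bdom A z ->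
  patch (c : chart X) (bpar A z) ->
  (sval A).2 = None -> (sval c).2 = None ->
  anticanonical X A c z = \det (frame_change A c) / hom_coord A c z 0 ^+ 3.
Proof.
move=> dz pz eA ec.
have dt := @transition_diff _ _ X A c z dz pz.
have nt := @near_trans A c z dz pz.
have [h1 h2 h3] := nbhs_singleton nt.
have [n0 _] := trans_scale h1 h2 h3.
pose N := frame_change A c.
pose a k (w : 'rV[C]_2) := N 0 k + w 0 0 * N 1 k + w 0 1 * N 2%:R k.
have ha k w : hom_coord A c w k = a k w by exact: hom_coord_none.
have nr : \forall w \near z, transition (A : chart X) (c : chart X) w 0 0
  = a 1 w / a 0 w /\
   transition (A : chart X) (c : chart X) w 0 1 = a 2%:R w / a 0 w.
  apply: filterS nt => w [k1 k2 k3]; rewrite -!ha.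
  by split; [exact: trans_coord0 | exact: trans_coord1_none].
have a0 : a 0 z != 0 by rewrite -ha.
have d k i := is_derive_aff (N 0 k) (N 1 k) (N 2%:R k) z i.
have e := det_jac_ratio dt a0 a0 nr (d 1 0) (d 1 1) (d 0 0) (d 0 1) (d 2%:R 0) (d 2%:R
  1) (d 0 0) (d 0 1).
apply: (etrans e); rewrite ha -/N (det3 N) /=.
rewrite /a in a0 *.
by field.
Qed.

(** One of the three factors of the denominator is replaced, since the
    Jacobian of the blow-up map (s, t) -> (s, s t) is s. *)
Lemma anticanonical_none_some (A c : frame p) z j : bdom A z ->
  patch (c : chart X) (bpar A z) ->
  (sval A).2 = None -> (sval c).2 = Some j ->
  hom_coord A c z 1 != 0 /\ anticanonical X A c z = \det (frame_change A c) /
    (hom_coord A c z 0 ^+ 2 * hom_coord A c z 1).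
Proof.
move=> dz pz eA ec.
have dt := @transition_diff _ _ X A c z dz pz.
have nt := @near_trans A c z dz pz.
have [h1 h2 h3] := nbhs_singleton nt.
have [n0 _] := trans_scale h1 h2 h3.
have ne : (sval A).2 != Some j by rewrite eA.
pose N := frame_change A c.
pose a k (w : 'rV[C]_2) := N 0 k + w 0 0 * N 1 k + w 0 1 * N 2%:R k.
have ha k w : hom_coord A c w k = a k w by exact: hom_coord_none.
have nr : \forall w \near z, transition (A : chart X) (c : chart X) w 0 0
  = a 1 w / a 0 w /\
   transition (A : chart X) (c : chart X) w 0 1 = a 2%:R w / a 1 w.
  apply: filterS nt => w [k1 k2 k3]; rewrite -!ha.
  by split; [exact: trans_coord0 | apply: (trans_coord1_some k1 k2 k3 ec
    (some_off_center k1 k2 k3 ec ne))].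
have a0 : a 0 z != 0 by rewrite -ha.
have a1 : a 1 z != 0.
  have := some_off_center h1 h2 h3 ec ne; rewrite (trans_coord0 h1 h2 h3) ha.
  by apply: contraNneq => ->; rewrite mul0r.
split; first by rewrite ha.
have d k i := is_derive_aff (N 0 k) (N 1 k) (N 2%:R k) z i.
have e := det_jac_ratio dt a0 a1 nr (d 1 0) (d 1 1) (d 0 0) (d 0 1) (d 2%:R 0) (d 2%:R
  1) (d 1 0) (d 1 1).
apply: (etrans e); rewrite !ha -/N (det3 N) /=.
rewrite /a in a0 a1 *.
by field; rewrite a0 a1.
Qed.

(** Over the centre the point no longer determines the slope; it is read off
    from the line which the point of the blow-up contains. *)
Lemma bdir_trans (c c' : frame p) z w j : bdom c z -> bdom c' w -> bpar c' w = bpar c z ->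
  (sval c).2 = Some j -> (sval c').2 = Some j ->
  let m k := frame_change c c' 1 k + z 0 1 * frame_change c c' 2%:R k in
  [/\ m 1 != 0, w 0 1 = m 2%:R / m 1 &
    bdir c z j = m 0 *: row ord0 (sval c').1 + m 1 *: bdir c' w j].
Proof.
move=> dz dw e ec ec' m.
have bd : bdir c z j = m 0 *: row ord0 (sval c').1 + vec3 0 (m 1) (m 2%:R) *m (sval c').1.
  rewrite /bdir ec eqxx -[LHS](mulmxKV (frame_unit c')) -[X in X *m _]mulmxA
    -/(frame_change c c').
  by rewrite rowE scalemxAl -mulmxDl dir_mul.
have m21 : m 2%:R = w 0 1 * m 1.
  have : (vec3 0 (m 1) (m 2%:R) *m (sval c').1) \in
    (<[row ord0 (sval c').1]> + <[(vec3 0 1 (w 0 1) *m (sval c').1)%R]>)%VS.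
    have : bdir c z j \in (sval (bpar c z)).2 j by rewrite (bpar_dir _ dz) memvE addvSr.
    rewrite -e (bpar_dir _ dw) (frame_center ec') {2}/bdir ec' eqxx bd => hb.
    rewrite -[X in X \in _](addKr (m 0 *: row ord0 (sval c').1)).
    by apply: memvD hb; rewrite memvN memvZ // memvE addvSl.
  move=> /(mem_line2_coords (frame_unit c')).
  by rewrite mulmxK ?frame_unit // vec3E2 vec3E1.
have ev : vec3 0 (m 1) (m 2%:R) = m 1 *: vec3 0 1 (w 0 1).
  by rewrite [RHS]vec3_eta; congr vec3; rewrite !mxE /= ?mulr0 ?mulr1 // m21 mulrC.
have bd' : bdir c z j = m 0 *: row ord0 (sval c').1 + m 1 *: bdir c' w j.
  by rewrite bd ev -scalemxAl [bdir c' w j]/bdir ec' eqxx.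
have m1n : m 1 != 0.
  have [d0 dn] := bdir_center z ec.
  apply: contraNN dn => /eqP m10; rewrite -(frame_center ec) (frame_center ec').
  move: d0; rewrite bd' m10 scale0r addr0 => d0; rewrite vlineZ //.
  by apply: contraNN d0 => /eqP ->; rewrite scale0r.
by split => //; rewrite m21 mulfK.
Qed.

(** Along the exceptional curve the quotients of homogeneous coordinates
    degenerate, but the common factor [z 0 0] cancels and the slopes change
    by a homography. *)
Lemma anticanonical_some_some (c c' : frame p) z j : bdom c z ->
  patch (c' : chart X) (bpar c z) ->
  (sval c).2 = Some j -> (sval c').2 = Some j -> z 0 0 = 0 ->
  let m1 := frame_change c c' 1 1 + z 0 1 * frame_change c c' 2%:R 1 in
  m1 != 0 /\ anticanonical X c c' z = \det (frame_change c c') / (hom_coord c c' z 0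
    ^+ 2 * m1).
Proof.
move=> dz pz ec ec' z0.
have dt := @transition_diff _ _ X c c' z dz pz.
have nt := @near_trans c c' z dz pz.
have [h1 h2 h3] := nbhs_singleton nt.
have [n0 _] := trans_scale h1 h2 h3.
pose N := frame_change c c'; rewrite /= -/N.
have N0 : N 0 1 = 0 /\ N 0 2%:R = 0.
  have : <[row ord0 (sval c).1]>%VS = <[row ord0 (sval c').1]>%VS.
    by rewrite -(frame_center ec) (frame_center ec').
  move=> /(vline_eqP (row0_neq0 (frame_unit c)) (row0_neq0 (frame_unit c')))[a _ ea].
  have eN : row ord0 N = a *: delta_mx 0 0.
    by rewrite /N /frame_change row_mul ea -scalemxAl rowE mulmxK ?frame_unit.
  by move/rowP: eN => eN; have := eN 1; have := eN 2%:R; rewrite !mxE /= mulr0.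
pose a k (w : 'rV[C]_2) := N 0 k + w 0 0 * (N 1 k + w 0 1 * N 2%:R k).
pose m k (w : 'rV[C]_2) := N 1 k + w 0 0 * 0 + w 0 1 * N 2%:R k.
have ha k w : hom_coord c c' w k = a k w by exact: hom_coord_some ec.
have hm w : m 1 w = N 1 1 + w 0 1 * N 2%:R 1 by rewrite /m mulr0 addr0.
have hm2 w : m 2%:R w = N 1 2%:R + w 0 1 * N 2%:R 2%:R by rewrite /m mulr0 addr0.
have nr : \forall w \near z, transition (c : chart X) (c' : chart X) w 0 0
  = a 1 w / a 0 w /\
   transition (c : chart X) (c' : chart X) w 0 1 = m 2%:R w / m 1 w.
  apply: filterS nt => w [k1 k2 k3]; rewrite -!ha.
  split; first exact: trans_coord0.
  by rewrite hm hm2; have [_ ->] := bdir_trans k1 k2 k3 ec ec'.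
have a0 : a 0 z != 0 by rewrite -ha.
have m1 : m 1 z != 0 by rewrite hm; have [] := bdir_trans h1 h2 h3 ec ec'.
split; first by rewrite -hm.
have d k i := is_derive_bil (N 0 k) (N 1 k) (N 2%:R k) z i.
have dm k i := is_derive_aff (N 1 k) 0 (N 2%:R k) z i.
have e := det_jac_ratio dt a0 m1 nr (d 1 0) (d 1 1) (d 0 0) (d 0 1) (dm 2%:R 0) (dm
  2%:R 1) (dm 1 0) (dm 1 1).
apply: (etrans e); rewrite ha -hm (det3 N) /=.
have [N01 N02] := N0.
rewrite /m /a z0 N01 N02 in a0 m1 *.
rewrite mul0r addr0 in a0; rewrite mulr0 addr0 in m1.
by field; rewrite a0 m1.
Qed.
End Trans.

(** * Sections given by products of three linear forms *)

Section Sections.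
Variable R : realType.
Local Notation C := (Cx R).
Variables (p : 'I_9 -> P2 R) (p_inj : injective p).
Local Notation X := (blowup p_inj).
Implicit Types (Q : 'M[C]_3) (c : frame p) (z w : 'rV[C]_2).

(** The columns of [Q] are three linear forms; this singles out those that
    vanish at the centre of the chart. *)
Definition killed Q c (k : 'I_3) : bool := (row ord0 (sval c).1 *m Q) 0 k == 0.
(** The cubic vanishes at the centre to first order exactly when a single
    form does. *)
Definition simple_at Q c : bool := [exists k0, [forall k, killed Q c k == (k == k0)]].

(** The equation of the strict transform of the line: a form that vanishes
    at the centre is divided by the equation [z 0 0] of the exceptional
    curve. *)
Definition strict_form Q c z (k : 'I_3) : C :=
  if (sval c).2 is Some j then
    if killed Q c k then (bdir c z j *m Q) 0 k else (bpoint c z *m Q) 0 k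
  else (bpoint c z *m Q) 0 k.

Definition cubic Q (v : 'rV[C]_3) : C := \prod_k (v *m Q) 0 k.

(** The determinant of the frame makes the components in different charts
    compatible. Where [simple_at] fails, the quotient by [z 0 0] means
    nothing on the exceptional curve; [regular_at] excludes this case. *)
Definition cubic_section Q c z : C :=
  (if (sval c).2 is Some j then
     if simple_at Q c then \prod_k strict_form Q c z k else cubic Q (bpoint c z) / z 0 0
   else cubic Q (bpoint c z)) / \det (sval c).1.

Lemma cubicZ Q a v : cubic Q (a *: v) = a ^+ 3 * cubic Q v.
Proof.
rewrite /cubic; under eq_bigr do rewrite -scalemxAl mxE.
by rewrite big_split /= prodr_const card_ord.
Qed.

Lemma form_near_center Q c z j k : (sval c).2 = Some j -> killed Q c k ->
  (bpoint c z *m Q) 0 k = z 0 0 * (bdir c z j *m Q) 0 k.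
Proof.
by move=> e /eqP hk; rewrite (bpoint_some z e) mulmxDl -scalemxAl !mxE; move: hk;
  rewrite !mxE => ->; rewrite add0r.
Qed.

(** Recombines the change of one form along the exceptional curve with that
    of the other two. *)
Lemma prod_if (k0 : 'I_3) (a b : C) : \prod_k (if k == k0 then a else b) = a * b ^+ 2.
Proof.
rewrite (bigD1 k0) //= eqxx; congr (_ * _).
rewrite (eq_bigr (fun=> b)) => [|k /negbTE ->//].
by rewrite prodr_const cardC1 card_ord.
Qed.

Lemma cubic_strict_form Q c z j : (sval c).2 = Some j -> simple_at Q c ->
  cubic Q (bpoint c z) = z 0 0 * \prod_k strict_form Q c z k.
Proof.
move=> e /existsP[k0 /forallP hk0].
have hk k : killed Q c k = (k == k0) by exact: (eqP (hk0 k)).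
rewrite /cubic (bigD1 k0) //= [in RHS](bigD1 k0) //= mulrA; congr (_ * _).
  by rewrite /strict_form e hk eqxx; apply: form_near_center => //; rewrite hk.
by apply: eq_bigr => k kk; rewrite /strict_form e hk (negbTE kk).
Qed.

Lemma cubic_section_off Q c z j : (sval c).2 = Some j -> z 0 0 != 0 ->
  cubic_section Q c z = cubic Q (bpoint c z) / (z 0 0 * \det (sval c).1).
Proof.
move=> e z0; rewrite /cubic_section e; case: ifP => h; last by rewrite invfM mulrA.
by rewrite (cubic_strict_form z e h) -mulf_div divff // mul1r.
Qed.

Lemma det_frame_neq0 c : \det (sval c).1 != 0.
Proof. by have := frame_unit c; rewrite unitmxE unitfE. Qed.

Lemma det_frame_change c c' : \det (frame_change c c')
  = \det (sval c).1 / \det (sval c').1.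
Proof. by rewrite /frame_change det_mulmx det_inv. Qed.

(** The cubic is homogeneous of degree 3, as is the anti-canonical factor. *)
Lemma cubic_section_trans_none Q (A c : frame p) z : bdom A z ->
  patch (c : chart X) (bpar A z) -> (sval A).2 = None ->
  cubic_section Q c (transition (A : chart X) (c : chart X) z)
    = anticanonical X A c z * cubic_section Q A z.
Proof.
move=> dz pz eA; set w := transition _ _ _.
have [h1 h2 h3] := nbhs_singleton (@near_trans _ _ p_inj A c z dz pz).
have [n0 ez] := trans_scale h1 h2 h3; rewrite -/w in ez.
have dA := det_frame_neq0 A; have dc := det_frame_neq0 c.
have eb : cubic Q (bpoint A z) = hom_coord A c z 0 ^+ 3 * cubic Q (bpoint c w) by
  rewrite {1}ez cubicZ.
case ec : ((sval c).2) => [j|].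
  have [n1 ->] := anticanonical_none_some dz pz eA ec.
  have w0 : w 0 0 != 0 by apply: (some_off_center h1 h2 h3 ec); rewrite eA.
  rewrite (cubic_section_off Q ec w0) /cubic_section eA eb det_frame_change.
  rewrite {1}(trans_coord0 h1 h2 h3).
  by field; rewrite n0 n1 dA dc.
rewrite (anticanonical_none_none dz pz eA ec) /cubic_section eA ec eb det_frame_change.
by field; rewrite n0 dA dc.
Qed.

(** Along an exceptional curve the form that vanishes at the centre scales
    like the slopes and the other two like homogeneous coordinates, which
    matches the anti-canonical factor. *)
Lemma cubic_section_trans_center Q (c c' : frame p) z j : bdom c z ->
  patch (c' : chart X) (bpar c z) ->
  (sval c).2 = Some j -> (sval c').2 = Some j -> z 0 0 = 0 ->
  cubic_section Q c' (transition (c : chart X) (c' : chart X) z)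
    = anticanonical X c c' z * cubic_section Q c z.
Proof.
move=> dz pz ec ec' z0; set w := transition _ _ _.
have [h1 h2 h3] := nbhs_singleton (@near_trans _ _ p_inj c c' z dz pz).
have [n0 ez] := trans_scale h1 h2 h3; rewrite -/w in ez.
have w0 : w 0 0 = 0.
  apply/eqP; rewrite (center_eq0 h2 ec') -(bpar_line h2) h3 (bpar_line h1).
  by rewrite -(center_eq0 h1 ec) z0 eqxx.
have rr : row ord0 (sval c).1 = hom_coord c c' z 0 *: row ord0 (sval c').1.
  by move: ez; rewrite (bpoint_some z ec) (bpoint_some w ec') z0 w0 !scale0r !addr0.
have hk k : killed Q c k = killed Q c' k.
  by rewrite /killed rr -scalemxAl mxE mulf_eq0 (negbTE n0).
have hs : simple_at Q c = simple_at Q c'.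
  by rewrite /simple_at; apply: eq_existsb => k0; apply: eq_forallb => k; rewrite hk.
rewrite /cubic_section ec ec' hs; case: ifP => s1;
  last by rewrite z0 w0 invr0 !mulr0 !mul0r mulr0.
have [m1 ->] := anticanonical_some_some dz pz ec ec' z0; set m := _ + _ in m1 *.
have [_ _ bd] := bdir_trans h1 h2 h3 ec ec'; rewrite -/m -/w in bd.
have [k0 /forallP hk0] := existsP s1.
have hk' k : killed Q c' k = (k == k0) by exact: (eqP (hk0 k)).
have r0 : strict_form Q c z k0 = m * strict_form Q c' w k0.
  have kz : (row ord0 (sval c').1 *m Q) 0 k0 = 0.
    by apply/eqP; rewrite -/(killed Q c' k0) hk' eqxx.
  rewrite /strict_form ec ec' hk hk' eqxx bd mulmxDl -!scalemxAl.
  by rewrite [LHS]mxE [X in X + _]mxE [X in _ + X]mxE kz mulr0 add0r.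
have r1 k : k != k0 -> strict_form Q c z k = hom_coord c c' z 0 * strict_form Q c' w k.
  by move=> kk; rewrite /strict_form ec ec' hk hk' (negbTE kk) {1}ez -scalemxAl [LHS]mxE.
have eP : \prod_k strict_form Q c z k = m * hom_coord c c' z 0 ^+ 2 * \prod_k
  strict_form Q c' w k.
  rewrite -(prod_if k0) -big_split /=; apply: eq_bigr => k _.
  by case: eqVneq => [->|/r1].
rewrite eP det_frame_change.
have dA := det_frame_neq0 c; have dc := det_frame_neq0 c'.
by field; rewrite n0 m1 dA dc.
Qed.

(** Two charts meeting off the exceptional curves are compared through the
    affine chart with the same frame; on an exceptional curve both charts
    have the same centre. *)
Lemma cubic_section_trans Q (c c' : frame p) z : bdom c z ->
  patch (c' : chart X) (bpar c z) ->
  cubic_section Q c' (transition (c : chart X) (c' : chart X) z)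
    = anticanonical X c c' z * cubic_section Q c z.
Proof.
move=> dz pz; case ec : ((sval c).2) => [j|]; last exact: cubic_section_trans_none.
have [h1 h2 h3] := nbhs_singleton (@near_trans _ _ p_inj c c' z dz pz).
have [z0|z0] := eqVneq (z 0 0) 0.
  apply: (cubic_section_trans_center Q dz pz ec _ z0).
  apply/eqP; apply: contraT => ne.
  have := h2 _ ne; rewrite -(bpar_line h2) h3 (bpar_line h1).
  by rewrite -(center_eq0 h1 ec) z0 eqxx.
(* The affine chart with the same frame. *)
have fA : is_frame p ((sval c).1, None) by rewrite /is_frame /= frame_unit.
pose A : frame p := exist _ ((sval c).1, None) fA.
pose zA : 'rV[C]_2 := \row_k [:: z 0 0; z 0 0 * z 0 1]`_k.
have eb : bpoint A zA = bpoint c z by rewrite /bpoint ec /= !mxE.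
have dA : bdom A zA.
  move=> i _; rewrite eb; have [<-|ij] := eqVneq j i; last by apply: dz; rewrite ec.
  by rewrite -(center_eq0 dz ec).
have eP : bpar A zA = bpar c z.
  apply: blowup_pt_eq; first by rewrite (bpar_line dA) (bpar_line dz) eb.
  move=> i; rewrite (bpar_line dA) => e; have := @none_off_center _ _ A zA i dA erefl.
  by rewrite e eqxx.
have pc : patch (c : chart X) (bpar A zA) by rewrite eP; exists z.
have pc' : patch (c' : chart X) (bpar A zA) by rewrite eP.
have tz : transition (A : chart X) (c : chart X) zA = z.
  by rewrite /transition [par _ _]eP; exact: (@coordK _ _ X c z dz).
have co := @anticanonical_cocycle _ _ X A c c' zA dA pc pc'.
have s1 := cubic_section_trans_none Q dA pc erefl.
have s2 := cubic_section_trans_none Q dA pc' erefl.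
rewrite tz in s1 co.
have tt : transition (A : chart X) (c' : chart X) zA
  = transition (c : chart X) (c' : chart X) z.
  by rewrite /transition [par _ zA]eP.
apply: (etrans (congr1 (cubic_section Q c') (esym tt))); apply: (etrans s2).
apply: (etrans (congr1 (fun t => t * cubic_section Q A zA) co)).
apply: (etrans _ (congr1 (fun t => anticanonical X c c' z * t) (esym s1))).
have gen (a b s : C) : a * b * s = b * (a * s) by ring.
exact: gen.
Qed.
End Sections.

(** * Regularity and zeros of these sections *)

Section Forms.
Variable R : realType.
Local Notation C := (Cx R).
Variables (p : 'I_9 -> P2 R) (p_inj : injective p).
Local Notation X := (blowup p_inj).
Implicit Types (Q : 'M[C]_3) (c : frame p) (z w : 'rV[C]_2).

Lemma near_everywhere_row n (x : 'rV[C]_n) (P : 'rV[C]_n -> Prop) : (forall v, P v) ->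
  \forall v \near x, P v.
Proof. by move=> h; apply: filterS (@filterT _ (nbhs x) (nbhs_filter x)) => v _. Qed.

Lemma prod3 (F : 'I_3 -> C) : \prod_k F k = F 0 * F 1 * F 2%:R.
Proof.
rewrite !big_ord_recl big_ord0 mulr1 mulrA.
by congr (F _ * F _ * F _); exact/val_inj.
Qed.

Lemma cubic_diff Q c z : differentiable (fun w => cubic Q (bpoint c w)) z.
Proof.
rewrite (_ : (fun w => _) = (fun w => (bpoint c w *m Q) 0 0 * (bpoint c w *m Q) 0 1 *
  (bpoint c w *m Q) 0 2%:R)).
  by apply: differentiableM; [apply: differentiableM|]; exact: differentiable_bpoint.
by apply/funext => w; rewrite /cubic prod3.
Qed.

Lemma strict_form_diff Q c k z : differentiable (fun w => strict_form Q c w k) z.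
Proof.
rewrite /strict_form; case: ((sval c).2) => [j|]; last exact: differentiable_bpoint.
by case: (killed Q c k); [exact: differentiable_bdir | exact: differentiable_bpoint].
Qed.

(** Either the chart has no centre, or the division by [z 0 0] is carried
    out on the forms, or it is a division by a nonzero number. *)
Definition regular_at Q c z : Prop := [\/ (sval c).2 = None, simple_at Q c | z 0 0 != 0].

Lemma cubic_section_diff Q c z : regular_at Q c z -> differentiable (cubic_section Q c) z.
Proof.
have dC (g : 'rV[C]_2 -> C) : differentiable g z ->
  differentiable (fun w => g w / \det (sval c).1) z.
  by move=> dg; apply: differentiableM => //; exact: differentiable_cst.
rewrite /regular_at /cubic_section; case: ((sval c).2) => [j|] h; last by apply: dC;
  exact: cubic_diff.
apply: dC; case hs : (simple_at Q c) h => h.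
  rewrite (_ : (fun w => _) = (fun w => strict_form Q c w 0 * strict_form Q c w 1 *
    strict_form Q c w 2%:R)).
    by apply: differentiableM; [apply: differentiableM|]; exact: strict_form_diff.
  by apply/funext => w; rewrite prod3.
apply: differentiableM; first exact: cubic_diff.
apply: differentiableV; first exact: differentiable_coord.
by case: h.
Qed.

Lemma regular_at_near Q c z : regular_at Q c z -> \forall w \near z, regular_at Q c w.
Proof.
case=> h; [by apply: near_everywhere_row => w; apply: Or31 |
  by apply: near_everywhere_row => w; apply: Or32 |].
have dz : differentiable (fun w : 'rV[C]_2 => w 0 0 : C) z by exact: differentiable_coord.
by have := differentiable_near_neq0 dz h; apply: filterS => w; exact: Or33.
Qed.

Definition const_form_coord c (k : 'I_3) : 'I_3 :=
  if (sval c).2 is Some _ then if k == 0 then 1 else 0 else 0.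
(** A product of three lines whose section is constant in the chart [c]: it
    lets any chart be compared with [c] through a section. The factors are
    the line at infinity of the chart and, once if there is a centre, a line
    through it whose strict transform misses the chart. *)
Definition const_form c : 'M[C]_3 := \matrix_(i < 3,
  k < 3) invmx (sval c).1 i (const_form_coord c k).

Lemma const_formE c (v : 'rV[C]_3) k : (v *m const_form c) 0 k
  = (v *m invmx (sval c).1) 0 (const_form_coord c k).
Proof. by rewrite !mxE; apply: eq_bigr => i _; rewrite !mxE. Qed.

Lemma row0E c : row ord0 (sval c).1 *m invmx (sval c).1 = delta_mx 0 (ord0 : 'I_3).
Proof. by rewrite rowE mulmxK ?frame_unit. Qed.

Lemma killed_const_form c j k : (sval c).2 = Some j ->
  killed (const_form c) c k = (k == 0).
Proof.
by move=> e; rewrite /killed const_formE row0E /const_form_coord e !mxE;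
  case: (k == 0); rewrite /= ?oner_eq0 ?eqxx.
Qed.

Lemma simple_const_form c j : (sval c).2 = Some j -> simple_at (const_form c) c.
Proof.
by move=> e; apply/existsP; exists 0; apply/forallP => k; rewrite (killed_const_form _ e).
Qed.

Lemma cubic_section_const_form c z : cubic_section (const_form c) c z
  = (\det (sval c).1)^-1.
Proof.
rewrite /cubic_section -[RHS]mul1r; congr (_ / _); case e : ((sval c).2) => [j|].
  rewrite (simple_const_form e) big1 // => k _; rewrite /strict_form e
    (killed_const_form _ e).
  case: ifP => k0; rewrite const_formE /const_form_coord e k0.
    by rewrite /bdir e eqxx mulmxK ?frame_unit // vec3E1.
  by rewrite bpoint_coords e vec3E0.
by rewrite /cubic big1 // => k _; rewrite const_formE /const_form_coord e
  bpoint_coords e vec3E0.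
Qed.

Lemma center_same c c' z w j : bdom c z -> bdom c' w -> bpar c' w = bpar c z ->
  (sval c).2 = Some j -> z 0 0 = 0 -> (sval c').2 = Some j /\ w 0 0 = 0.
Proof.
move=> dz dw e ec z0.
have ec' : (sval c').2 = Some j.
  apply/eqP; apply: contraT => ne.
  have := dw _ ne; rewrite -(bpar_line dw) e (bpar_line dz).
  by rewrite -(center_eq0 dz ec) z0 eqxx.
split => //; apply/eqP; rewrite (center_eq0 dw ec') -(bpar_line dw) e (bpar_line dz).
by rewrite -(center_eq0 dz ec) z0 eqxx.
Qed.

Lemma killed_same Q c c' j : (sval c).2 = Some j -> (sval c').2 = Some j ->
  killed Q c =1 killed Q c'.
Proof.
move=> e e' k; have := frame_center e; rewrite (frame_center e').
move=> /(vline_eqP (row0_neq0 (frame_unit c')) (row0_neq0 (frame_unit c)))[a a0 ea].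
by rewrite /killed ea -scalemxAl [in RHS]mxE mulf_eq0 (negbTE a0).
Qed.

Lemma simple_same Q c c' j : (sval c).2 = Some j -> (sval c').2 = Some j ->
  simple_at Q c = simple_at Q c'.
Proof.
move=> e e'; rewrite /simple_at; apply: eq_existsb => k0; apply: eq_forallb => k.
by rewrite (killed_same Q e e').
Qed.

Lemma regular_const_form c c' z w : bdom c z -> bdom c' w -> bpar c' w = bpar c z ->
  regular_at (const_form c) c' w.
Proof.
move=> dz dw e; rewrite /regular_at; case ec' : ((sval c').2) => [j|]; last exact: Or31.
have [w0|w0] := eqVneq (w 0 0) 0; last exact: Or33.
have [ec _] := center_same dw dz (esym e) ec' w0.
by apply: Or32; rewrite -(simple_same _ ec ec') (simple_const_form ec).
Qed.

(** The strict transform of the line where the [k]-th form vanishes. *)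
Definition on_line Q k (P : blowup_pt p) : Prop :=
  (forall v, v \in (sval P).1 -> (v *m Q) 0 k = 0) /\
  forall i, (forall v, v \in sval (p i) -> (v *m Q) 0 k = 0) ->
    forall v, v \in (sval P).2 i -> (v *m Q) 0 k = 0.

Lemma form_vline Q k (u : 'rV[C]_3) : (u *m Q) 0 k = 0 -> forall v, v \in <[u]>%VS ->
  (v *m Q) 0 k = 0.
Proof. by move=> h v /vlineP[a ->]; rewrite -scalemxAl mxE h mulr0. Qed.

Lemma strict_form_on_line Q c z k : bdom c z -> strict_form Q c z k
  = 0 <-> on_line Q k (bpar c z).
Proof.
move=> dz; rewrite /on_line (bpar_line dz); split.
- move=> r0.
  have b0 : (bpoint c z *m Q) 0 k = 0.
    move: r0; rewrite /strict_form; case e : ((sval c).2) => [j|] //; case: ifP => // hk.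
    by rewrite (form_near_center z e hk) => ->; rewrite mulr0.
  split; first exact: form_vline.
  move=> i hi v; rewrite (bpar_dir _ dz) => /memv_addP[u hu [t ht ->]].
  rewrite mulmxDl mxE hi // add0r; apply: form_vline ht.
  rewrite /bdir; case: ifP => [/eqP e|_]; last exact: b0.
  have hk : killed Q c k.
    by apply/eqP; apply: hi; rewrite (frame_center e) memv_line.
  by move: r0; rewrite /strict_form e hk /bdir e eqxx.
- move=> [h1 h2]; have b0 : (bpoint c z *m Q) 0 k = 0 by apply: h1; exact: memv_line.
  rewrite /strict_form; case e : ((sval c).2) => [j|] //; case: ifP => // hk.
  apply: (h2 j); last by rewrite (bpar_dir _ dz) memvE addvSr.
  by rewrite (frame_center e); apply: form_vline; apply/eqP.
Qed.

End Forms.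

(** * Orders of vanishing on a Riemann surface *)

Section OneVar.
Variable R : realType.
Local Notation C := (Cx R).

Lemma const_mx1 (z : 'rV[C]_1) : const_mx (z 0 0) = z.
Proof. by apply/rowP => i; rewrite mxE !ord1. Qed.

Lemma differentiable_const_mx (t : C) : differentiable (fun t : C =>
  const_mx t : 'rV[C]_1) t.
Proof.
rewrite (_ : (fun t : C => const_mx t : 'rV[C]_1) = (fun t : C =>
  t *: (const_mx 1 : 'rV[C]_1))).
  by apply: differentiableZl.
by apply/funext => s; apply/rowP => i; rewrite !mxE mulr1.
Qed.

Lemma holo_of_diff (g : 'rV[C]_1 -> C) (z : 'rV[C]_1) : differentiable g z ->
  holo (fun t => g (const_mx t)) (z 0 0).
Proof.
move=> dg; have dg' : differentiable g (const_mx (z 0 0)) by rewrite const_mx1.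
have dc := @differentiable_comp _ _ _ _ (fun t : C =>
  const_mx t : 'rV[C]_1) g (z 0 0) (differentiable_const_mx _) dg'.
exists ('D_(1 : C) (fun t => g (const_mx t)) (z 0 0)); constructor; last by [].
exact: diff_derivable.
Qed.

Lemma diff_of_holo (u : C -> C) (z : 'rV[C]_1) : holo u (z 0 0) ->
  differentiable (fun w : 'rV[C]_1 => u (w 0 0)) z.
Proof.
move=> [d [h1 _]].
have du : differentiable u (z 0 0) by apply/derivable1_diffP.
exact: (@differentiable_comp _ _ _ _ (fun w : 'rV[C]_1 =>
  w 0 0 : C) u z (differentiable_coord _ _ _) du).
Qed.

Lemma near_const_mx (z : 'rV[C]_1) (P : 'rV[C]_1 -> Prop) : (\forall w \near z, P w) ->
  \forall t \near (z 0 0 : C), P (const_mx t).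
Proof.
move=> h; have := differentiable_continuous (differentiable_const_mx (z 0 0)).
by apply; rewrite const_mx1.
Qed.

Lemma near_of_coord (z : 'rV[C]_1) (P : C -> Prop) : (\forall t \near (z 0 0 : C), P t) ->
  nbhs z (fun w : 'rV[C]_1 => P (w 0 0)).
Proof.
move=> h; have := differentiable_continuous (differentiable_coord z 0 0).
by apply.
Qed.

(** The local normal form of a holomorphic function that does not vanish
    identically. *)
Definition has_order (g : 'rV[C]_1 -> C) (a : 'rV[C]_1) (n : nat) : Prop :=
  exists v : 'rV[C]_1 -> C, [/\ \forall z \near a, differentiable v z, v a != 0 &
    \forall z \near a, g z = (z 0 0 - a 0 0) ^+ n * v z].

Lemma order_dichotomy (g : 'rV[C]_1 -> C) (a : 'rV[C]_1) : (\forall z \near a,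
  differentiable g z) ->
  (\forall z \near a, g z = 0) \/ exists n, has_order g a n.
Proof.
move=> /near_const_mx/nbhsC[p p0 hp].
have hh t : nm (t - a 0 0) < p -> holo (fun t => g (const_mx t)) t.
  by move=> /hp /holo_of_diff; rewrite mxE.
have [[r r0 hr]|[n [u [hu ua hf]]]] := zero_dichotomy p0 hh.
  left; have : \forall t \near (a 0 0 : C), g (const_mx t) = 0 by apply/nbhsC; exists r.
  by move=> /near_of_coord; apply: filterS => w; rewrite const_mx1.
right; exists n, (fun z => u (z 0 0)); split => //.
  have : \forall t \near (a 0 0 : C), holo u t by apply/nbhsC; exists p.
  by move=> /near_of_coord; apply: filterS => w; exact: diff_of_holo.
by apply: near_everywhere_row => w; rewrite -hf const_mx1.
Qed.

Lemma order_neq0 g a n : has_order g a n -> \forall z \near a, z != a -> g z != 0.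
Proof.
move=> [v [dv va hg]]; have va' := differentiable_continuous (nbhs_singleton dv).
have nv : \forall z \near a, v z != 0 by exact: (cvgr_neq0 _ va' va).
apply: filterS2 hg nv => z -> vz za; rewrite mulf_neq0 // expf_neq0 // subr_eq0.
by apply: contraNneq za => e; rewrite -(const_mx1 z) -(const_mx1 a) e.
Qed.

Lemma order0 (g : 'rV[C]_1 -> C) (a : 'rV[C]_1) : (\forall z \near a,
  differentiable g z) -> g a != 0 -> has_order g a 0.
Proof. by move=> dg ga; exists g; split => //; apply: near_everywhere_row => z;
  rewrite expr0 mul1r. Qed.

(** If n' were larger, dividing by (z - a)^n would exhibit the unit [Lam]
    times the unit part of [g] as a function vanishing at [a]. Applied in
    both directions this gives invariance of orders under changes of charts
    and frames. *)
Lemma order_le (g g' : 'rV[C]_1 -> C) (a a' : 'rV[C]_1) (n n' : nat) (T : 'rV[C]_1 ->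
  'rV[C]_1) (Lam : 'rV[C]_1 -> C) :
  has_order g a n -> has_order g' a' n' -> differentiable T a -> T a = a' ->
  differentiable Lam a -> Lam a != 0 ->
  (\forall z \near a, g' (T z) = Lam z * g z) -> (n' <= n)%N.
Proof.
move=> [v [dv va hg]] [v' [dv' va' hg']] dT Ta dL La hh; rewrite leqNgt; apply/negP => nn.
have dva := nbhs_singleton dv; have dva' := nbhs_singleton dv'.
pose al := a 0 0 : C.
pose tau (t : C) := T (const_mx t) 0 0.
have htau : holo tau al.
  apply: (@holo_of_diff (fun z => T z 0 0)).
  exact: (@differentiable_comp _ _ _ _ T (fun w : 'rV[C]_1 =>
    w 0 0 : C) a dT (differentiable_coord _ _ _)).
have cq := diff_quot_cont_center htau.
have cV : {for al, continuous (fun t => v' (T (const_mx t)))}.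
  apply: holo_continuous; apply: (@holo_of_diff (fun z => v' (T z))).
  by apply: (@differentiable_comp _ _ _ _ T v' a dT); rewrite Ta.
have cL : {for al, continuous (fun t => Lam (const_mx t))} :=
  holo_continuous (holo_of_diff dL).
have cv : {for al, continuous (fun t => v (const_mx t))} :=
  holo_continuous (holo_of_diff dva).
have cs : {for al, continuous (fun t => t - al)}.
  by apply: holo_continuous; exists 1; exact: hderiv_subc.
have taual : tau al = a' 0 0 by rewrite /tau /al const_mx1 Ta.
(* Both sides of the identity divided by (t - al)^n; they agree off al, hence at al. *)
pose F t := (t - al) ^+ (n' - n) * (diff_quot tau al t ^+ n' * v' (T (const_mx t))).
pose G t := Lam (const_mx t) * v (const_mx t).
have cF : {for al, continuous F} := contM (contX cs) (contM (contX cq) cV).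
have cG : {for al, continuous G} := contM cL cv.
suff FG : \forall t \near al, t != al -> F t = G t.
  have := @continuous_eq R C C F G al cF cG FG; rewrite /F /G subrr expr0n subn_eq0
    leqNgt nn mul0r /al const_mx1.
  by move=> /esym/eqP; rewrite mulf_eq0 (negbTE La) (negbTE va).
have hgT : \forall z \near a, g' (T z) = (T z 0 0 - a' 0 0) ^+ n' * v' (T z).
  have cT : T @ a --> a' by rewrite -Ta; exact: differentiable_continuous dT.
  exact: (cT _ hg').
have hn : \forall z \near a, [/\ g' (T z) = (T z 0 0 - a' 0 0) ^+ n' * v' (T z),
  g' (T z) = Lam z * g z & g z = (z 0 0 - a 0 0) ^+ n * v z].
  by apply: filterS3 hgT hh hg => z; split.
have [d d0 hd] := (nbhsC _ _).1 (near_const_mx hn).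
apply/nbhsC; exists d => // t /hd[e1 e2 e3] ta; rewrite /F /G.
rewrite e1 e3 in e2; rewrite mxE -/al in e2.
have tal : t - al != 0 by rewrite subr_eq0.
have := diff_quotE tau al t; rewrite taual -/(tau t) => eq.
rewrite -/(tau t) -eq exprMn in e2.
have [k ek] : exists k, n' = (n + k)%N by exists (n' - n)%N; rewrite subnKC // ltnW.
apply: (mulfI (expf_neq0 n tal)).
rewrite ek addKn mulrA -exprD -ek mulrA e2.
by ring.
Qed.
End OneVar.

(** * Degrees of pull-backs *)

Section Pull.
Variable R : realType.
Local Notation C := (Cx R).
Variables (p : 'I_9 -> P2 R) (p_inj : injective p).
Local Notation X := (blowup p_inj).
Variables (S : complex_manifold R 1) (f : S -> X).
Hypothesis hf : holomorphic_map f.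
Implicit Types (Q : 'M[C]_3) (b : chart S) (c : frame p) (a : 'rV[C]_1).

(** The map [f] in the chart [b] of the curve and the chart [c] of the
    blow-up. *)
Definition local_map b c (z : 'rV[C]_1) : 'rV[C]_2 := @coord _ _ X c (f (par b z)).
Definition at_chart b c a : Prop := dom b a /\ patch (c : chart X) (f (par b a)).

Lemma at_chart_near b c a : at_chart b c a -> \forall z \near a, at_chart b c z.
Proof.
move=> [da pa]; have [cf _] := hf.
have np : nbhs (f (par b a)) (patch (c : chart X)).
  by apply: open_nbhs_nbhs; split => //; exact: patch_open.
exact: (par_near da (cf (par b a) _ np)).
Qed.

Lemma local_mapP b c a : at_chart b c a -> bdom c (local_map b c a) /\
  bpar c (local_map b c a) = f (par b a).
Proof. by move=> [_ /coordP]. Qed.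

Lemma local_map_diff b c a : at_chart b c a -> differentiable (local_map b c) a.
Proof. by move=> [da pa]; have [_ h] := hf; exact: (h b c a da pa). Qed.

Definition pulled_section Q b c (z : 'rV[C]_1) : C := cubic_section Q c (local_map b c z).

Lemma pulled_section_diff Q b c a : at_chart b c a -> regular_at Q c (local_map b c a) ->
  \forall z \near a, differentiable (pulled_section Q b c) z.
Proof.
move=> ha hg; have nl := differentiable_continuous (local_map_diff ha).
have ng : \forall z \near a, regular_at Q c (local_map b c z) by
  exact: (nl _ (regular_at_near hg)).
apply: filterS2 (at_chart_near ha) ng => z hz gz.
exact: (@differentiable_comp _ _ _ _ (local_map b c) (cubic_section Q c) z
  (local_map_diff hz) (cubic_section_diff gz)).
Qed.

Lemma pulled_strict_form_diff Q k b c a : at_chart b c a ->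
  \forall z \near a, differentiable (fun z => strict_form Q c (local_map b c z) k) z.
Proof.
move=> ha; apply: filterS (at_chart_near ha) => z hz.
exact: (@differentiable_comp _ _ _ _ (local_map b c) (fun w =>
  strict_form Q c w k) z (local_map_diff hz) (strict_form_diff Q c k _)).
Qed.

Lemma local_map_transition b b' c c' a a' : at_chart b c a -> at_chart b' c' a' ->
  par b a = par b' a' ->
  patch (c' : chart X) (bpar c (local_map b c a)) /\
    transition (c : chart X) (c' : chart X) (local_map b c a) = local_map b' c' a'.
Proof.
move=> ha ha' e; have [d1 e1] := local_mapP ha; have [_ p2] := ha'.
have e3 : par (c : chart X) (local_map b c a) = f (par b' a') by rewrite -e.
by split; [rewrite e1 e | rewrite /transition e3].
Qed.

Lemma pulled_section_trans Q b b' c c' a a' : at_chart b c a -> at_chart b' c' a' ->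
  par b a = par b' a' ->
  pulled_section Q b' c' a' = anticanonical X c c' (local_map b c a) * pulled_section
    Q b c a.
Proof.
move=> ha ha' e; have [pc tz] := local_map_transition ha ha' e;
  have [d1 _] := local_mapP ha.
have h := cubic_section_trans Q d1 pc.
exact: (etrans (congr1 (cubic_section Q c') (esym tz)) h).
Qed.

(** The transition function between two frames, expressed by a section which
    is constant in the first one. In this form it is visibly holomorphic
    along the curve, as a derivative of a coordinate change is not. *)
Definition transition_factor b b' c c' a' : C := \det (sval c).1 * pulled_section
  (const_form c) b' c' a'.

Lemma transition_factorE b b' c c' a a' : at_chart b c a -> at_chart b' c' a' ->
  par b a = par b' a' ->
  anticanonical X c c' (local_map b c a) = transition_factor b b' c c' a'.
Proof.
move=> ha ha' e; have h := pulled_section_trans (const_form c) ha ha' e.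
have h2 : pulled_section (const_form c) b c a = (\det (sval c).1)^-1 by
  exact: cubic_section_const_form.
rewrite /transition_factor h h2 mulrCA divff ?mulr1 //; exact: det_frame_neq0.
Qed.

Lemma pulled_order_le Q b b' c c' a a' n n' : at_chart b c a -> at_chart b' c' a' ->
  par b a = par b' a' ->
  has_order (pulled_section Q b c) a n -> has_order (pulled_section Q b' c') a' n' ->
    (n' <= n)%N.
Proof.
move=> ha ha' e o1 o2.
have [da _] := ha; have [da' _] := ha'.
have pb : patch b' (par b a) by rewrite e; exists a'.
have dT := @transition_diff _ _ S b b' a da pb.
have Ta : transition b b' a = a' by rewrite /transition e coordK.
have hac' : at_chart b c' a by split => //; rewrite e; case: ha'.
have hgood : regular_at (const_form c) c' (local_map b c' a).
  have [d1 e1] := local_mapP ha; have [d2 e2] := local_mapP hac'.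
  by apply: (regular_const_form d1 d2); rewrite e1 e2.
have dL : differentiable (transition_factor b b c c') a.
  apply: differentiableM; first exact: differentiable_cst.
  exact: (nbhs_singleton (pulled_section_diff hac' hgood)).
have La : transition_factor b b c c' a != 0.
  rewrite -(transition_factorE ha hac' erefl); have [d1 e1] := local_mapP ha.
  apply: (@anticanonical_neq0 _ _ X c c' _ d1).
  by have [] := local_map_transition ha hac' erefl.
apply: (order_le o1 o2 dT Ta dL La).
have npb : \forall z \near a, dom b z /\ patch b' (par b z).
  by apply: (par_near da); apply: open_nbhs_nbhs; split => //; exact: patch_open.
apply: filterS3 npb (at_chart_near ha) (at_chart_near hac') => z [dz pz] hz hz'.
have [dT' eT] := @transitionP _ _ S b b' z pz.
have hT : at_chart b' c' (transition b b' z) by split => //; rewrite eT; case: hz'.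
rewrite (pulled_section_trans Q hz hT (esym eT)).
by rewrite (transition_factorE hz hz' erefl).
Qed.

Lemma pulled_order_uniq Q b b' c c' a a' n n' : at_chart b c a -> at_chart b' c' a' ->
  par b a = par b' a' ->
  has_order (pulled_section Q b c) a n -> has_order (pulled_section Q b' c') a' n' ->
    n = n'.
Proof.
move=> ha ha' e o1 o2; apply/eqP; rewrite eqn_leq.
by rewrite (pulled_order_le ha' ha (esym e) o2 o1) (pulled_order_le ha ha' e o1 o2).
Qed.

Lemma exists_at_chart s : exists b c a, par b a = s /\ at_chart b c a.
Proof.
have [b [a da ea]] := par_cover s; have [c pc] := @par_cover _ _ X (f s).
by exists b, c, a; split => //; split => //; rewrite ea.
Qed.

(** The orders of the pulled back section are nonnegative, and its zeros are
    finite in number because they are isolated and the curve is compact. *)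
Lemma degree_of_section Q : compact [set: S] ->
  (forall b c a, at_chart b c a -> regular_at Q c (local_map b c a)) ->
  (forall b c a, at_chart b c a -> exists n, has_order (pulled_section Q b c) a n) ->
  exists2 d, pullback_degree (anticanonical X) f d & 0 <= d.
Proof.
move=> cS hg ho.
pose D (s : S) : int := Posz (xget 0%N [set n | exists b c a, [/\ par b a
  = s, at_chart b c a & has_order (pulled_section Q b c) a n]]).
have DE b c a n : at_chart b c a -> has_order (pulled_section Q b c) a n ->
  D (par b a) = Posz n.
  move=> ha o; congr Posz; apply: xget_unique; first by exists b, c, a.
  by move=> n' [b' [c' [a' [e ha' o']]]]; exact: (pulled_order_uniq ha' ha e o' o).
have fin : finite_set [set s | D s != 0].
  have loc0 s : exists U : set S, [/\ open U, U s & forall t, U t -> t != s -> D t = 0].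
    have [b [c [a [<- ha]]]] := exists_at_chart s.
    have [n o] := ho _ _ _ ha.
    have nz := order_neq0 o.
    have : nbhs a [set z | at_chart b c z /\ (z != a ->
      pulled_section Q b c z != 0)] by exact: filterI (at_chart_near ha) nz.
    rewrite nbhsE => -[V [oV Va] hV].
    have oW : open (V `&` dom b) by apply: openI => //; exact: dom_open.
    exists (par b @` (V `&` dom b)); split.
    - by apply/(par_homeo (@subIsetr _ _ _)).
    - by exists a => //; split => //; case: ha.
    - move=> _ [z [Vz dz] <-] za; have [hz gz] := hV _ Vz.
      have zna : z != a by apply: contraNneq za => ->.
      apply: (DE b c z 0%N hz); apply: order0 (gz zna).
      exact: (pulled_section_diff hz (hg _ _ _ hz)).
  apply: contrapT => inf; set Z := [set s | D s != 0] in inf.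
  (* A filter of cofinite subsets of the support; compactness gives it a cluster
     point. *)
  pose F : set_system S := [set A | finite_set (Z `\` A)].
  have PF : ProperFilter F.
    split; first by rewrite /F /= setD0.
    split; first by rewrite /F /= setDT.
      by move=> A B; rewrite /F /= setDIr => hA hB; rewrite finite_setU.
    by move=> A B AB; rewrite /F /=; apply: sub_finite_set => s [Zs nB]; split => // /AB.
  have [s [_ cs]] := cS F PF (@filterT _ F _).
  have [U [oU Us hU]] := loc0 s.
  have FA : F (Z `\ s).
    rewrite /F /= setDD; apply: (@sub_finite_set _ _ [set s]); last exact: finite_set1.
    by move=> t [].
  have [t [[Zt ts] Ut]] := cs _ _ FA (open_nbhs_nbhs (conj oU Us)).
  by move: Zt; rewrite /Z /= (hU t Ut) ?eqxx //; apply/eqP.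
exists (\sum_(s \in [set: S]) D s); last by apply: fsumr_ge0.
exists (fun c s => cubic_section Q c (@coord _ _ X c (f s))), D; split => //; split.
- move=> c c' s p1 p2.
  have [b [a da ea]] := par_cover s.
  have ha : at_chart b c a by split => //; rewrite ea.
  have ha' : at_chart b c' a by split => //; rewrite ea.
  by have := pulled_section_trans Q ha ha' erefl; rewrite /pulled_section /local_map ea.
- move=> b a c da pa; have ha : at_chart b c a by split.
  have [n o] := ho _ _ _ ha; rewrite (DE _ _ _ _ ha o).
  have [v [dv va hv]] := o; exists v; split => //.
  rewrite near_withinE; apply: filterS hv => z hz _; exact: hz.
Qed.
End Pull.

(** * A criterion for nefness *)

Section Lines.
Variable R : realType.
Local Notation C := (Cx R).

Lemma order_mul (g h : 'rV[C]_1 -> C) a m n : has_order g a m -> has_order h a n ->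
  has_order (fun z => g z * h z) a (m + n).
Proof.
move=> [u [du ua hu]] [v [dv va hv]]; exists (fun z => u z * v z); split.
- by apply: filterS2 du dv => z d1 d2; exact: differentiableM.
- by rewrite mulf_neq0.
- by apply: filterS2 hu hv => z -> ->; rewrite exprD mulrACA.
Qed.

Lemma order_near (g h : 'rV[C]_1 -> C) a n : (\forall z \near a, g z = h z) ->
  has_order g a n -> has_order h a n.
Proof.
move=> gh [u [du ua hu]]; exists u; split => //.
by apply: filterS2 gh hu => z <-.
Qed.

Lemma order_cst (k : C) a : k != 0 -> has_order (fun=> k) a 0.
Proof. by move=> k0; apply: order0 => //; apply: near_everywhere_row => z;
  exact: differentiable_cst. Qed.

Variables (p : 'I_9 -> P2 R) (p_inj : injective p).
Local Notation X := (blowup p_inj).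

Lemma cubic_section_strict (Q : 'M[C]_3) (c : frame p) z : (forall j, (sval c).2
  = Some j -> simple_at Q c) ->
  cubic_section Q c z = strict_form Q c z 0 * strict_form Q c z 1 * strict_form Q c z
    2%:R * (\det (sval c).1)^-1.
Proof.
move=> hQ; rewrite /cubic_section; case e : ((sval c).2) => [j|];
  first by rewrite (hQ j e) prod3.
by rewrite /cubic prod3 /strict_form e.
Qed.

Section Curve.
Variables (S : complex_manifold R 1) (f : S -> X).
Hypothesis hf : holomorphic_map f.

Lemma par_nbhs (b : chart S) a (P : set S) : dom b a ->
  (\forall z \near a, P (par b z)) -> nbhs (par b a) P.
Proof.
move=> da h; have {h} : nbhs a [set z | P (par b z)] by [].
rewrite !nbhsE => -[V [oV Va] hV].
have oW : open (V `&` dom b) by apply: openI => //; exact: dom_open.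
exists (par b @` (V `&` dom b)).
  by split; [apply/(par_homeo (@subIsetr _ _ _)) | exists a].
by move=> _ [z [Vz _] <-]; exact: hV.
Qed.

(** The set where the [k]-th strict equation vanishes on a neighbourhood is
    open, and closed by isolation of zeros; the curve is connected. *)
Lemma line_dichotomy (Q : 'M[C]_3) k : connected [set: S] ->
  (forall s, on_line Q k (f s)) \/
  (forall b c a, at_chart f b c a -> exists n, has_order (fun z =>
    strict_form Q c (local_map f b c z) k) a n).
Proof.
move=> cS; pose N : set S := interior [set s | on_line Q k (f s)].
have vanish b c a : at_chart f b c a -> (\forall z \near a,
  strict_form Q c (local_map f b c z) k = 0) -> N (par b a).
  move=> ha h0; have [da _] := ha; apply: (par_nbhs da).
  apply: filterS2 (at_chart_near hf ha) h0 => z hz; have [d1 e1] := local_mapP hz.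
  by move=> /(strict_form_on_line Q k d1); rewrite e1.
have [[s0 Ns0]|nN] := pselect (N !=set0); last first.
  right => b c a ha; have [h0|//] := order_dichotomy (pulled_strict_form_diff hf Q k ha).
  by exfalso; apply: nN; exists (par b a); exact: vanish ha h0.
left; suff NT : N = [set: S].
  by move=> s; have : N s by [rewrite NT]; exact: interior_subset.
apply: cS; first by exists s0.
  by exists N; [exact: open_interior | rewrite setTI].
exists N; last by rewrite setTI.
rewrite -[N]setCK closedC openE => s nNs.
have [b [c [a [es ha]]]] := exists_at_chart f s; rewrite -es in nNs *.
have [h0|[n o]] := order_dichotomy (pulled_strict_form_diff hf Q k ha).
  by exfalso; apply: nNs; exact: vanish ha h0.
have [da _] := ha; apply: (par_nbhs da).
apply: filterS2 (at_chart_near hf ha) (order_neq0 o) => z hz hn.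
have [->//|za] := eqVneq z a; move=> /interior_subset /=.
have [d1 e1] := local_mapP hz; rewrite -e1 => /(strict_form_on_line Q k d1) /eqP.
by rewrite (negbTE (hn za)).
Qed.

(** All orders are 0. *)
Lemma degree_of_nowhere_zero (Q : 'M[C]_3) :
  (forall b c a, at_chart f b c a -> regular_at Q c (local_map f b c a) /\
    cubic_section Q c (local_map f b c a) != 0) ->
  pullback_degree (anticanonical X) f 0.
Proof.
move=> h; exists (fun c s => cubic_section Q c (@coord _ _ X c (f s))), (fun=> 0); split.
- split.
    move=> c c' s p1 p2; have [b [a da ea]] := par_cover s.
    have ha : at_chart f b c a by split => //; rewrite ea.
    have ha' : at_chart f b c' a by split => //; rewrite ea.
    by have := pulled_section_trans Q ha ha' erefl; rewrite /pulled_section /local_map ea.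
  move=> b a c da pa; have ha : at_chart f b c a by split.
  have [hg h0] := h _ _ _ ha; exists (pulled_section f Q b c); split.
  + exact: (pulled_section_diff hf ha hg).
  + exact: h0.
  + rewrite near_withinE; apply: near_everywhere_row => z _; rewrite expr0z mul1r //.
- rewrite (_ : [set s : S | 0 != 0] = set0); first exact: finite_set0.
  by apply/seteqP; split => s //=; rewrite eqxx.
- by rewrite fsbig1.
Qed.
End Curve.

(** The zero divisor of the section [Q] is a union of strict transforms of
    lines. A curve outside it has nonnegative degree, counted by zeros of
    [Q]; a curve inside it lies on one of the lines, along which another
    section has no zeros. *)
Lemma nef_of_lines (Q : 'M[C]_3) :
  (forall (c : frame p) j, (sval c).2 = Some j -> simple_at Q c) ->
  (forall k, exists G : 'M[C]_3, forall (c : frame p) z, bdom c z ->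
    on_line Q k (bpar c z) ->
     regular_at G c z /\ cubic_section G c z != 0) ->
  nef (anticanonical X).
Proof.
move=> hQ hG S f cS nS hf _.
have onl k : (forall s, on_line Q k (f s)) -> exists2 d,
  pullback_degree (anticanonical X) f d & 0 <= d.
  move=> h; have [G hGk] := hG k; exists 0 => //; apply: (degree_of_nowhere_zero hf (Q :=
    G)) => b c a ha.
  by have [d1 e1] := local_mapP ha; apply: hGk => //; rewrite e1.
have [h|o0] := line_dichotomy hf Q 0 nS; first exact: onl h.
have [h|o1] := line_dichotomy hf Q 1 nS; first exact: onl h.
have [h|o2] := line_dichotomy hf Q 2%:R nS; first exact: onl h.
apply: (degree_of_section hf (Q := Q) cS) => b c a ha.
  rewrite /regular_at; case e : ((sval c).2) => [j|]; last exact: Or31.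
  by apply: Or32; exact: hQ e.
have [n0 h0] := o0 _ _ _ ha; have [n1 h1] := o1 _ _ _ ha; have [n2 h2] := o2 _ _ _ ha.
have d0 : (\det (sval c).1)^-1 != 0 by rewrite invr_eq0 det_frame_neq0.
exists (n0 + n1 + n2 + 0)%N.
apply: order_near (order_mul (order_mul (order_mul h0 h1) h2) (order_cst a d0)).
by apply: near_everywhere_row => z; rewrite /pulled_section (cubic_section_strict _
  (hQ c)).
Qed.
End Lines.

(** * The configuration and the nefness of its anti-canonical bundle *)

Section Config.
Variable R : realType.
Local Notation C := (Cx R).

(** Directions of three lines through [1:0:0]; their sum is 0. *)
Definition dirx (k : nat) : C := [:: 1; 0; -1]`_k.
Definition diry (k : nat) : C := [:: 0; 1; -1]`_k.
(** A linear form on the directions which takes the value 1 on the [k]-th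
    one. It recovers the affine coordinate on a line. *)
Definition formx (k : nat) : C := [:: 1; 0; -1]`_k.
Definition formy (k : nat) : C := [:: 0; 1; 0]`_k.

Definition line_pt (k : nat) (t : C) : 'rV[C]_3 := vec3 t (dirx k) (diry k).
Definition center_vec (k a : nat) : 'rV[C]_3 := line_pt k a%:R.

Lemma form_dir k : (k < 3)%N -> dirx k * formx k + diry k * formy k = 1.
Proof. by case: k => [|[|[|//]]] _; rewrite /dirx /diry /formx /formy /=; ring. Qed.

Lemma cross_neq0 k k' : (k < 3)%N -> (k' < 3)%N -> k != k' ->
  dirx k' * diry k - diry k' * dirx k != 0.
Proof.
case: k => [|[|[|//]]] _; case: k' => [|[|[|//]]] _ //= _;
  rewrite /dirx /diry /= ?(mul0r, mulr0, mul1r, mulr1, subr0, sub0r, mulN1r, opprK,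
    add0r, addr0, oppr_eq0, oner_eq0) //.
Qed.

Lemma line_pt_neq0 k t : (k < 3)%N -> line_pt k t != 0.
Proof.
move=> /form_dir h; apply/eqP => /rowP e; have := e 1; have := e 2%:R.
rewrite !mxE /= => e2 e1; move: h; rewrite e1 e2 !mul0r addr0 => /eqP.
by rewrite eq_sym oner_eq0.
Qed.

Lemma center_vec_neq0 k a : (k < 3)%N -> center_vec k a != 0.
Proof. exact: line_pt_neq0. Qed.

Lemma config_line_lt (i : 'I_9) : (i %/ 3 < 3)%N. Proof.
  by rewrite ltn_divLR // ltn_ord. Qed.

Lemma center_dim (i : 'I_9) : \dim <[center_vec (i %/ 3) (i %% 3)]>%VS == 1%N.
Proof. by rewrite dim_vline center_vec_neq0 ?config_line_lt. Qed.

Definition config (i : 'I_9) : P2 R := exist _ <[center_vec (i %/ 3) (i %% 3)]>%VS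
  (center_dim i).

Lemma line_pt_inj k k' t t' : (k < 3)%N -> (k' < 3)%N ->
  <[line_pt k t]>%VS = <[line_pt k' t']>%VS -> k = k' /\ t = t'.
Proof.
move=> hk hk' /(vline_eqP (line_pt_neq0 t hk) (line_pt_neq0 t' hk'))[r r0 /rowP e].
have := e 0; have := e 1; have := e 2%:R; rewrite !mxE /= => e2 e1 e0.
have kk : k = k'.
  apply/eqP; apply: contraT => ne; have := cross_neq0 hk hk' ne.
  rewrite -(mulrI_eq0 _ (lregP r0)) mulrBr !mulrA -e1 -e2.
  by rewrite mulrC subrr eqxx.
subst k'; split => //; have := form_dir hk; rewrite {1}e1 {1}e2 -!mulrA -mulrDr
  form_dir // mulr1 => r1.
by move: e0; rewrite r1 mul1r.
Qed.

Lemma center_vec_inj k k' a a' : (k < 3)%N -> (k' < 3)%N ->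
  <[center_vec k a]>%VS = <[center_vec k' a']>%VS -> k = k' /\ a = a'.
Proof. by move=> hk hk' /(line_pt_inj hk hk')[-> /eqP]; rewrite eqr_nat => /eqP. Qed.

Lemma config_inj : injective config.
Proof.
move=> i j /(congr1 sval) /= /center_vec_inj [||h1 h2]; rewrite ?config_line_lt //.
by apply/val_inj; rewrite /= (divn_eq i 3) (divn_eq j 3) h1 h2.
Qed.

Definition idx (k a : nat) : 'I_9 := inord (3 * k + a).
Lemma idxE k a : (k < 3)%N -> (a < 3)%N -> (idx k a %/ 3 = k /\ idx k a %% 3 = a)%N.
Proof.
move=> hk ha; have h : (3 * k + a < 9)%N.
  by case: k hk => [|[|[|//]]] _; case: a ha => [|[|[|//]]].
by rewrite /idx inordK // mulnC divnMDl // modnMDl divn_small // modn_small // addn0.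
Qed.

Lemma config_idx k a : (k < 3)%N -> (a < 3)%N -> sval (config (idx k a))
  = <[center_vec k a]>%VS.
Proof. by move=> hk ha; have [h1 h2] := idxE hk ha; rewrite /= h1 h2. Qed.

(** The columns are the equations of the three lines. *)
Definition lines : 'M[C]_3 := \matrix_(i < 3, k < 3) [:: 0; diry k; - dirx k]`_i.
(** The columns are equations of lines through the three centres of the
    [k]-th line, different from that line. *)
Definition transversals (k : nat) : 'M[C]_3 := \matrix_(i < 3, a < 3) [:: 1;
  - a%:R * formx k; - a%:R * formy k]`_i.

Lemma linesE (v : 'rV[C]_3) k : (v *m lines) 0 k = v 0 1 * diry k - v 0 2%:R * dirx k.
Proof. by rewrite mulmx3E !mxE /= mulr0 add0r mulrN. Qed.

Lemma transversalsE (v : 'rV[C]_3) (k : nat) a : (v *m transversals k) 0 a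
  = v 0 0 - a%:R * (v 0 1 * formx k + v 0 2%:R * formy k).
Proof. by rewrite mulmx3E !mxE /=; ring. Qed.

Lemma on_lineE (v : 'rV[C]_3) (k : 'I_3) : (v *m lines) 0 k = 0 ->
  let y := v 0 1 * formx k + v 0 2%:R * formy k in v
    = vec3 (v 0 0) (y * dirx k) (y * diry k).
Proof.
move=> h y; have hk := form_dir (ltn_ord k); rewrite linesE in h.
rewrite [LHS]vec3_eta; congr vec3.
  rewrite -[LHS]mulr1 -hk /y; apply/eqP; rewrite -subr_eq0.
  have -> : v 0 1 * (dirx k * formx k + diry k * formy k) - (v 0 1 * formx k +
    v 0 2%:R * formy k) * dirx k =
     (v 0 1 * diry k - v 0 2%:R * dirx k) * formy k by ring.
  by rewrite h mul0r.
rewrite -[LHS]mulr1 -hk /y; apply/eqP; rewrite -subr_eq0.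
have -> : v 0 2%:R * (dirx k * formx k + diry k * formy k) - (v 0 1 * formx k +
  v 0 2%:R * formy k) * diry k =
   - (v 0 1 * diry k - v 0 2%:R * dirx k) * formx k by ring.
by rewrite h oppr0 mul0r.
Qed.

Lemma transversal_zero (v : 'rV[C]_3) (k a : 'I_3) : v != 0 -> (v *m lines) 0 k = 0 ->
  (v *m transversals k) 0 a = 0 ->
  <[v]>%VS = <[center_vec k a]>%VS.
Proof.
move=> v0 /on_lineE e; rewrite transversalsE => /eqP; rewrite subr_eq0 => /eqP e0.
set y := v 0 1 * formx k + v 0 2%:R * formy k in e e0.
have ev : v = y *: center_vec k a.
  rewrite e e0 [RHS]vec3_eta; congr vec3; rewrite !mxE //=.
  by rewrite mulrC.
have y0 : y != 0 by apply: contraNneq v0 => y0; rewrite ev y0 scale0r.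
by rewrite ev vlineZ.
Qed.

Lemma center_row (c : frame config) j : (sval c).2 = Some j ->
  exists2 t, t != 0 & row ord0 (sval c).1 = t *: center_vec (j %/ 3) (j %% 3).
Proof.
move=> e; have := frame_center e => /= h.
exact: (vline_eqP (row0_neq0 (frame_unit c)) (center_vec_neq0 _ (config_line_lt j))
  (esym h)).
Qed.

Lemma killed_lines (c : frame config) j k : (sval c).2 = Some j ->
  killed lines c k = (k == (j %/ 3)%N :> nat).
Proof.
move=> e; have [t t0 et] := center_row e.
rewrite /killed et -scalemxAl mxE mulf_eq0 (negbTE t0) /= linesE !mxE /=.
have [->|ne] := eqVneq (k : nat) (j %/ 3)%N; first by rewrite mulrC subrr eqxx.
by apply/negbTE; apply: cross_neq0; rewrite ?config_line_lt.
Qed.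

Lemma simple_lines (c : frame config) j : (sval c).2 = Some j -> simple_at lines c.
Proof.
move=> e; apply/existsP; exists (Ordinal (config_line_lt j)); apply/forallP => k.
by rewrite (killed_lines _ e) -val_eqE /=.
Qed.

Lemma killed_transversals (c : frame config) j (k a : 'I_3) : (sval c).2 = Some j ->
  (j %/ 3)%N = k ->
  killed (transversals k) c a = (a == (j %% 3)%N :> nat).
Proof.
move=> e jk; have [t t0 et] := center_row e.
rewrite /killed et -scalemxAl mxE mulf_eq0 (negbTE t0) /= transversalsE !mxE /= jk
  form_dir // mulr1.
by rewrite subr_eq0 eqr_nat eq_sym.
Qed.

Lemma simple_transversals (c : frame config) j (k : 'I_3) : (sval c).2 = Some j ->
  (j %/ 3)%N = k ->
  simple_at (transversals k) c.
Proof.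
move=> e jk; have h : (j %% 3 < 3)%N by rewrite ltn_mod.
apply/existsP; exists (Ordinal h); apply/forallP => a.
by rewrite (killed_transversals _ e jk) -val_eqE /=.
Qed.

(** The transversals meet the [k]-th line in the three centres and nowhere
    else, and at each centre only one of them passes, with another tangent
    direction. *)
Lemma transversals_nowhere_zero (k : 'I_3) (c : frame config) z : bdom c z ->
  on_line lines k (bpar c z) ->
  regular_at (transversals k) c z /\ cubic_section (transversals k) c z != 0.
Proof.
move=> dz [h1 h2]; rewrite (bpar_line dz) in h1.
have bl := h1 _ (memv_line _).
have nz (a : 'I_3) : (sval c).2 != Some (idx k a) ->
  (bpoint c z *m transversals k) 0 a != 0.
  move=> ne; apply/eqP => /(transversal_zero (bpoint_neq0 c z) bl) e.
  by have := dz _ ne; rewrite e config_idx // eqxx.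
have dM := det_frame_neq0 c.
case e : ((sval c).2) => [j|]; last first.
  split; first exact: Or31.
  rewrite /cubic_section e mulf_neq0 ?invr_eq0 // /cubic; apply/prodf_neq0 => a _.
  by apply: nz; rewrite e.
have [jk|jk] := eqVneq (j %/ 3)%N (k : nat).
  split; first by apply: Or32; exact: (simple_transversals e).
  rewrite /cubic_section e (simple_transversals e jk) mulf_neq0 ?invr_eq0 //;
    apply/prodf_neq0 => a _.
  rewrite /strict_form e (killed_transversals _ e jk).
  have [ja|ja] := eqVneq (a : nat) (j %% 3)%N; last first.
    apply: nz; rewrite e; apply: contraNneq ja => -[->].
    by have [_ ->] := idxE (ltn_ord k) (ltn_ord a).
  have [d0 dn] := bdir_center z e.
  have hd : (bdir c z j *m lines) 0 k = 0.
    apply: (h2 j); last by rewrite (bpar_dir _ dz) memvE addvSr.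
    move=> v /= /vlineP[s ->]; rewrite -scalemxAl mxE linesE !mxE /= jk.
    by rewrite [diry k * _]mulrC subrr mulr0.
  apply/eqP => /(transversal_zero d0 hd) eb; move: dn.
  by rewrite eb -(frame_center e) /= jk ja eqxx.
have z0 : z 0 0 != 0.
  apply/eqP => /eqP; rewrite (center_eq0 dz e) => /eqP eb.
  have : (center_vec (j %/ 3) (j %% 3) *m lines) 0 k = 0 by apply: h1;
    rewrite eb memv_line.
  rewrite linesE !mxE /= => /eqP; apply/negP; apply: cross_neq0;
    rewrite ?config_line_lt //.
  by rewrite eq_sym.
split; first exact: Or33.
rewrite (cubic_section_off _ e z0) mulf_neq0 ?invr_eq0 ?mulf_neq0 // /cubic;
  apply/prodf_neq0 => a _.
apply: nz; rewrite e; apply: contraNneq jk => -[->].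
by have [-> _] := idxE (ltn_ord k) (ltn_ord a).
Qed.

Theorem nef_blowup : nef (anticanonical (blowup config_inj)).
Proof.
apply: (@nef_of_lines R config config_inj lines).
  by move=> c j; exact: simple_lines.
by move=> k; exists (transversals k) => c z; exact: transversals_nowhere_zero.
Qed.
End Config.

(** * Weights of smooth metrics along complex lines *)

Section Metric.
Variable R : realType.
Local Notation C := (Cx R).

(** Directional derivatives are derivatives of restrictions to lines. *)
Lemma is_derive_lineP m (H : 'rV[R]_m -> R) (P v : 'rV[R]_m) (x l : R) :
  is_derive P v H l <-> is_derive x (1 : R) (fun s => H (P + (s - x) *: v)) l.
Proof.
have E : (fun h : R => h^-1 *: (((fun s => H (P + (s - x) *: v)) \o shift x) (h *: 1)
  - H (P + (x - x) *: v))) =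
         (fun h : R => h^-1 *: ((H \o shift P) (h *: v) - H P)).
  apply/funext => h; rewrite /= subrr scale0r addr0 addrK [h *: 1]mulr1 [P + _]addrC //.
split => -[d e].
  have hl : (fun h : R => h^-1 *: ((H \o shift P) (h *: v) - H P)) @ 0^' --> l by
    rewrite -e.
  by split; [apply/cvg_ex; exists l; rewrite E | rewrite /derive E; exact: norm_cvg_lim].
have hl : (fun h : R => h^-1 *: (((fun s => H (P +
  (s - x) *: v)) \o shift x) (h *: 1) - H (P + (x - x) *: v))) @ 0^' --> l by
  rewrite -e.
rewrite E in hl.
by split; [apply/cvg_ex; exists l | exact: norm_cvg_lim].
Qed.

Lemma real_to_cplxK n (z : 'rV[C]_n) : real_to_cplx (cplx_to_real z) = z.
Proof.
apply/rowP => k; rewrite mxE /cplx_to_real row_mxEl row_mxEr !mxE.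
by case: (z 0 k).
Qed.

Lemma cplx_to_realK n (x : 'rV[R]_(n + n)) : cplx_to_real (real_to_cplx x) = x.
Proof.
apply/rowP => k; rewrite /cplx_to_real; case: (splitP k) => j ej.
  have -> : k = lshift n j by exact/val_inj.
  by rewrite row_mxEl !mxE.
have -> : k = rshift n j by exact/val_inj.
by rewrite row_mxEr !mxE.
Qed.

Lemma cplx_to_real_line n (z0 v : 'rV[C]_n) (t : C) :
  cplx_to_real (z0 + t *: v) = cplx_to_real z0 + complex.Re t *: cplx_to_real v +
    complex.Im t *: cplx_to_real ('i%C *: v).
Proof.
apply/rowP => k; rewrite !mxE; case: (fintype.split k) => i; rewrite !mxE;
  case: (z0 0 i) => a b; case: (v 0 i) => c d; case: t => p q /=; ring.
Qed.

Lemma continuous_Re : continuous (fun z : C => complex.Re z).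
Proof.
move=> z; apply/(@cvgrPdist_lt _ _ _ _ (nbhs_filter z)) => e e0; apply/nbhsC;
  exists e => // w wz.
apply: le_lt_trans wz; rewrite distrC; have := Re_le_nm (w - z).
by case: w => ? ?; case: z.
Qed.

Lemma continuous_Im : continuous (fun z : C => complex.Im z).
Proof.
move=> z; apply/(@cvgrPdist_lt _ _ _ _ (nbhs_filter z)) => e e0; apply/nbhsC;
  exists e => // w wz.
apply: le_lt_trans wz; rewrite distrC; have := Im_le_nm (w - z).
by case: w => ? ?; case: z.
Qed.

Section Aff.
Variables (n : nat) (D : set 'rV[C]_n) (h : 'rV[C]_n -> R).
Hypothesis h0 : forall z, D z -> 0 < h z.
Hypothesis hs : smooth_on D h.

Lemma weight_continuous_line (z0 v : 'rV[C]_n) (t : C) : D (z0 + t *: v) ->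
  {for t, continuous (fun s : C => h (z0 + s *: v))}.
Proof.
move=> dt; have /differentiable_continuous := hs [::] dt.
rewrite /partials /= cplx_to_real_line => cF.
have cA : {for t, continuous (fun s : C => cplx_to_real z0 +
  complex.Re s *: cplx_to_real v + complex.Im s *: cplx_to_real ('i%C *: v))}.
  have cR : (fun s : C => complex.Re s *: cplx_to_real v) @ t --> complex.Re t *:
    cplx_to_real v := cvgZr_tmp (@continuous_Re t).
  have cI : (fun s : C => complex.Im s *: cplx_to_real ('i%C *: v)) @ t --> complex.Im
    t *: cplx_to_real ('i%C *: v) := cvgZr_tmp (@continuous_Im t).
  have c0 : (fun s : C => cplx_to_real z0) @ t --> cplx_to_real z0 :=
    @cst_continuous C 'rV[R]_(n + n) (cplx_to_real z0) t.
  exact: (cvgD (cvgD c0 (cR (nbhs_filter t))) (cI (nbhs_filter t))).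
have := @continuous_comp _ _ _ _ (h \o @real_to_cplx R n) t cA cF.
by rewrite /comp; congr continuous_at; apply/funext => s;
  rewrite -cplx_to_real_line real_to_cplxK.
Qed.

(** Smoothness provides the derivatives of [h] to all orders; those of - ln
    [h] along a line follow by the chain rule. *)
Lemma is_deriv2_log_weight (P : 'rV[R]_(n + n)) (x : R) (k : 'I_(n + n)) :
  (\forall s \near x, D (real_to_cplx (P + (s - x) *: delta_mx 0 k))) ->
  is_deriv2 (fun s => - ln (h (real_to_cplx (P + (s - x) *: delta_mx 0 k)))) x
     (partials [:: k; k] (fun w => - ln (h w)) P).
Proof.
set e := delta_mx 0 k => nD.
pose F : 'rV[R]_(n + n) -> R := h \o @real_to_cplx R n.
pose G : 'rV[R]_(n + n) -> R := (fun w => - ln (h w)) \o @real_to_cplx R n.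
pose Ps s : 'rV[R]_(n + n) := P + (s - x) *: e.
have shift s s' : Ps s + (s' - s) *: e = Ps s'.
  by rewrite /Ps -addrA -scalerDl; congr (_ + _ *: _); ring.
pose dF s := 'D_e F (Ps s).
have lF s : D (real_to_cplx (Ps s)) -> is_derive s (1 : R) (fun s => F (Ps s)) (dF s).
  move=> ds; have := hs [::] ds; rewrite cplx_to_realK => /= dfF.
  have := (is_derive_lineP F (Ps s) e s (dF s)).1 (DeriveDef (diff_derivable dfF) erefl).
  by under eq_fun do rewrite shift.
pose g' s := - (F (Ps s))^-1 * dF s.
have lG s : D (real_to_cplx (Ps s)) -> is_derive s (1 : R) (fun s => G (Ps s)) (g' s).
  move=> ds; have F0 : 0 < F (Ps s) by exact: h0.
  have hh : is_derive s (1 : R) (fun s => - ln (F (Ps s))) _ :=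
    is_deriveN (@is_derive1_comp R (@ln R) (fun s =>
      F (Ps s)) s _ _ (is_derive1_ln F0) (lF s ds)).
  by apply: (is_derive_eq hh); rewrite /g' mulNr.
have eG s : D (real_to_cplx (Ps s)) -> 'D_e G (Ps s) = g' s.
  move=> ds; have [_ //] : is_derive (Ps s) e G (g' s).
  apply/(is_derive_lineP G (Ps s) e s (g' s)).
  by under eq_fun do rewrite shift; exact: lG.
exists g'; first by apply: filterS nD => s; exact: lG.
have dx : D (real_to_cplx (Ps x)) by exact: (nbhs_singleton nD).
have Px : Ps x = P by rewrite /Ps subrr scale0r addr0.
have ddF : exists l, is_derive x (1 : R) dF l.
  have := hs [:: k] dx; rewrite cplx_to_realK Px => dfF.
  exists ('D_e ('D_e F) P).
  exact: (is_derive_lineP ('D_e F) P e x _).1 (DeriveDef (diff_derivable dfF) erefl).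
have [l hl] := ddF.
have F0 : 0 < F (Ps x) by exact: h0.
have hV : is_derive x (1 : R) (fun s => (F (Ps s))^-1) _ :=
  @is_deriveV R (fun s => F (Ps s)) _ _ _ (lt0r_neq0 F0) (lF x dx).
have hg : is_derive x (1 : R) g' _ := is_deriveM (is_deriveN hV) hl.
have nE : \forall s \near x, g' s = 'D_e G (P + (s - x) *: e).
  by apply: filterS nD => s ds; rewrite eG.
have hD := (is_derive_lineP ('D_e G) P e x _).2 (near_eq_is_derive nE hg).
have [_ eD] := hD.
by rewrite /partials /= -/e -/G eD; exact: hg.
Qed.

Hypothesis oD : open D.

Lemma cplx_to_real_delta (a : 'I_n) : cplx_to_real (delta_mx 0 a : 'rV[C]_n)
  = delta_mx 0 (lshift n a) :> 'rV[R]_(n + n).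
Proof.
apply/rowP => k; rewrite /cplx_to_real; case: (splitP k) => j ej.
  have -> : k = lshift n j by exact/val_inj.
  by rewrite row_mxEl !mxE eq_lshift /= [j == a]eq_sym; case: (a == j).
have -> : k = rshift n j by exact/val_inj.
by rewrite row_mxEr !mxE eq_rlshift; case: (j == a).
Qed.

Lemma cplx_to_real_idelta (a : 'I_n) : cplx_to_real ('i%C *: (delta_mx 0 a :
  'rV[C]_n)) = delta_mx 0 (rshift n a) :> 'rV[R]_(n + n).
Proof.
apply/rowP => k; rewrite /cplx_to_real; case: (splitP k) => j ej.
  have -> : k = lshift n j by exact/val_inj.
  rewrite row_mxEl !mxE eq_lrshift /=; case: (j == a) => /=; ring.
have -> : k = rshift n j by exact/val_inj.
rewrite row_mxEr !mxE eq_rshift /=; case: (j == a) => /=; ring.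
Qed.

(** The diagonal entries of the Levi form are a quarter of the Laplacians
    along the coordinate lines. *)
Lemma is_lap_log_weight (z0 : 'rV[C]_n) (a : 'I_n) (x y : R) :
  let A t := z0 + t *: (delta_mx 0 a : 'rV[C]_n) in
  D (A (x +i* y)%C) ->
  (forall xi : 'rV[C]_n, 0 <= \sum_b \sum_c levi (fun w =>
    - ln (h w)) (A (x +i* y)%C) b c * xi 0 b * (xi 0 c)^*) ->
  exists2 l, is_lap (fun t => - ln (h (A t))) x y l & 0 <= l.
Proof.
move=> A dA pos; set z := A (x +i* y)%C in dA pos.
pose P := cplx_to_real z.
have nA : \forall t \near ((x +i* y)%C : C), D (A t).
  have dfA : differentiable (fun t : C => z0 + t *: (delta_mx 0 a : 'rV[C]_n)) ((x +i*
    y)%C : C).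
    by apply: differentiableD; [exact: differentiable_cst | exact: differentiableZl].
  have := differentiable_continuous dfA; apply.
  by apply: open_nbhs_nbhs.
have eP : P = cplx_to_real z0 + x *: delta_mx 0 (lshift n a) +
  y *: delta_mx 0 (rshift n a).
  by apply: (etrans (cplx_to_real_line _ _ _)); rewrite cplx_to_real_delta
    cplx_to_real_idelta.
have eX s : A (s +i* y)%C = real_to_cplx (P + (s - x) *: delta_mx 0 (lshift n a)).
  refine (etrans (esym (real_to_cplxK _)) (congr1 (@real_to_cplx R n) _)).
  apply: (etrans (cplx_to_real_line _ _ _)); rewrite cplx_to_real_delta
    cplx_to_real_idelta eP /=.
  by rewrite scalerBl; apply/rowP => i; rewrite !mxE; ring.
have eY s : A (x +i* s)%C = real_to_cplx (P + (s - y) *: delta_mx 0 (rshift n a)).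
  refine (etrans (esym (real_to_cplxK _)) (congr1 (@real_to_cplx R n) _)).
  apply: (etrans (cplx_to_real_line _ _ _)); rewrite cplx_to_real_delta
    cplx_to_real_idelta eP /=.
  by rewrite scalerBl; apply/rowP => i; rewrite !mxE; ring.
set G := fun w => - ln (h w).
exists (partials [:: lshift n a; lshift n a] G P + partials [:: rshift n a;
  rshift n a] G P).
  exists (partials [:: lshift n a; lshift n a] G P), (partials [:: rshift n a;
    rshift n a] G P).
  split => //.
    under eq_fun do rewrite eX; apply: is_deriv2_log_weight.
    by have := near_line_x nA; apply: filterS => s; rewrite eX.
  under eq_fun do rewrite eY; apply: is_deriv2_log_weight.
  by have := near_line_y nA; apply: filterS => s; rewrite eY.
have := pos (delta_mx 0 a).
rewrite (bigD1 a) //= [X in _ + X]big1 ?addr0; last first.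
  by move=> b ba; apply: big1 => c _; rewrite [delta_mx 0 a 0 b]mxE (negbTE ba) /=
    mulr0 mul0r.
rewrite (bigD1 a) //= [X in _ + X]big1 ?addr0; last first.
  by move=> b ba; rewrite [delta_mx 0 a 0 b]mxE (negbTE ba) /= rmorph0 mulr0.
rewrite [delta_mx 0 a 0 a]mxE !eqxx /= rmorph1 !mulr1 mxE.
have gen (u v : R) : 0 <= u / 4 * 1 - v / 4 * - 0 -> 0 <= u.
  by rewrite mulr1 oppr0 mulr0 subr0 pmulr_lge0 ?invr_gt0.
by rewrite lecE /= => /andP[_]; exact: gen.
Qed.
End Aff.
End Metric.

(** * Charts along the three lines *)

Section Ruled.
Variable R : realType.
Local Notation C := (Cx R).
Local Notation config := (@config R).
Local Notation X := (blowup (@config_inj R)).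

Lemma frame_origin : is_frame config (1%:M, None).
Proof. by rewrite /is_frame /= unitmx1. Qed.
Definition origin_chart : frame config := exist (fun c =>
  is_true (is_frame config c)) (1%:M, None) frame_origin.

(** The [k]-th line in the affine chart around [1:0:0]. *)
Definition line_dir (k : nat) : 'rV[C]_2 := \row_i [:: dirx R k; diry R k]`_i.

(** The first row is the centre, the second the direction of the [k]-th
    line; the third completes them to a basis of determinant -1. Thus the
    strict transform of the line is the coordinate axis of slope 0. *)
Definition line_mx (k a : nat) : 'M[C]_3 :=
  \matrix_(i < 3) [:: center_vec R k a; vec3 1 0 0; vec3 0 (- formy R k) (formx R k)]`_i.

Lemma det_line_mx k a : (k < 3)%N -> \det (line_mx k a) = -1.
Proof.
move=> /(@form_dir R) h; rewrite det3 !mxE /=.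
apply: (etrans _ (congr1 -%R h)); ring.
Qed.

Lemma frame_line k a : (k < 3)%N -> (a < 3)%N -> is_frame config (line_mx k a,
  Some (idx k a)).
Proof.
move=> hk ha; rewrite /is_frame /= unitmxE det_line_mx // unitrN unitr1 /=.
have [-> ->] := idxE hk ha; apply/eqP; congr (<[_]>%VS).
by rewrite rowK.
Qed.

Section Chart.
Variables (k a : nat) (hk : (k < 3)%N) (ha : (a < 3)%N).
Definition line_chart : frame config :=
  exist (fun c => is_true (is_frame config c)) (line_mx k a,
    Some (idx k a)) (frame_line hk ha).
(** The [k]-th line in the chart at the centre of parameter [a]; it is
    written as a base point plus a multiple of a basis vector to fit
    derivatives along coordinate lines. *)
Definition along (t : C) : 'rV[C]_2 := - a%:R *: delta_mx 0 0 + t *: delta_mx 0 0.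

Lemma along0 t : along t 0 0 = t - a%:R.
Proof. by rewrite !mxE /= !mulr1 addrC. Qed.
Lemma along1 t : along t 0 1 = 0.
Proof. by rewrite !mxE /= !mulr0 addr0. Qed.

Lemma bpoint_along t : bpoint line_chart (along t) = line_pt k t.
Proof.
rewrite /bpoint /= along0 along1 mulr0 [LHS]vec3_eta /line_pt !mulmx3E; congr vec3;
  rewrite !mxE /=; ring.
Qed.

Lemma bdom_along t : (forall a', (a' < 3)%N -> a' != a -> t != a'%:R) ->
  bdom line_chart (along t).
Proof.
move=> ht i /= ne; rewrite bpoint_along; apply/eqP =>
  /(line_pt_inj hk (config_line_lt i))[ki ti].
have [ia|ia] := eqVneq (i %% 3)%N a.
  move/negP: ne; apply; apply/eqP; congr Some; apply/val_inj.
  have [h1 h2] := idxE hk ha.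
  by rewrite /= (divn_eq i 3) (divn_eq (idx k a) 3) h1 h2 -ki ia.
by have := ht _ (ltn_pmod i (isT : 0 < 3)%N) ia; rewrite ti eqxx.
Qed.
End Chart.

Lemma bpoint_dir k u : bpoint origin_chart (u *: line_dir k)
  = vec3 1 (u * dirx R k) (u * diry R k).
Proof. by rewrite /bpoint /= mulmx1; congr vec3; rewrite !mxE. Qed.

Lemma bpoint_dir_inv k u : u != 0 -> bpoint origin_chart (u *: line_dir k)
  = u *: line_pt k u^-1.
Proof.
move=> u0; rewrite bpoint_dir [RHS]vec3_eta; congr vec3; rewrite !mxE //=.
by rewrite divff.
Qed.

Lemma bdom_dir k u : (k < 3)%N -> (forall a, (a < 3)%N -> 1 - a%:R * u != 0) ->
  bdom origin_chart (u *: line_dir k).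
Proof.
move=> hk hu i _; have [->|u0] := eqVneq u 0.
  rewrite bpoint_dir !mul0r; apply/eqP => /(vline_eqP _ _)[].
  - by apply/eqP => /rowP/(_ 0)/eqP; rewrite vec3E !mxE oner_eq0.
  - by apply: center_vec_neq0; exact: config_line_lt.
  move=> r r0 /rowP e; have := e 1; have := e 2%:R;
    rewrite !mxE /= => /esym/eqP e2 /esym/eqP e1.
  move: e1 e2; rewrite !mulf_eq0 (negbTE r0) /= => /eqP e1 /eqP e2.
  have := form_dir R (config_line_lt i); rewrite e1 e2 !mul0r addr0 => /eqP.
  by rewrite eq_sym oner_eq0.
rewrite bpoint_dir_inv // vlineZ //; apply/eqP => /(line_pt_inj hk (config_line_lt
  i))[_ e].
have := hu _ (ltn_pmod i (isT : 0 < 3)%N); rewrite -e mulVf // subrr eqxx //.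
Qed.

Lemma same_point k a (hk : (k < 3)%N) (ha : (a < 3)%N) (t : C) : t != 0 ->
  (forall a', (a' < 3)%N -> t != a'%:R) ->
  [/\ bdom origin_chart (t^-1 *: line_dir k), bdom (line_chart hk ha) (along a t) &
   bpar origin_chart (t^-1 *: line_dir k) = bpar (line_chart hk ha) (along a t)].
Proof.
move=> t0 ht.
have dO : bdom origin_chart (t^-1 *: line_dir k).
  apply: bdom_dir => // a' ha'; rewrite subr_eq0; apply/eqP => e.
  case/eqP: (ht _ ha'); by have := congr1 ( *%R^~ t) e; rewrite /= mul1r divfK.
have dc : bdom (line_chart hk ha) (along a t) by apply: bdom_along => a' ha' _; exact: ht.
have eb : <[bpoint origin_chart (t^-1 *: line_dir k)]>%VS
  = <[bpoint (line_chart hk ha) (along a t)]>%VS.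
  by rewrite bpoint_dir_inv ?invr_eq0 // vlineZ ?invr_eq0 // invrK bpoint_along.
have e1 : (sval (bpar origin_chart (t^-1 *: line_dir k))).1
  = (sval (bpar (line_chart hk ha) (along a t))).1 :=
  etrans (bpar_line dO) (etrans eb (esym (bpar_line dc))).
split; [exact: dO | exact: dc | refine (blowup_pt_eq e1 _)] => i.
move=> /(etrans (esym (bpar_line dO))) e.
by case/negP: (dO i isT); apply/eqP.
Qed.

Lemma Re_norm_sq (w : C) : complex.Re (@Num.norm C C w ^+ 2) = nm w ^+ 2.
Proof. by rewrite nmE expr2 /= mulr0 subr0 -expr2. Qed.

(** The change of frame from the chart at [1:0:0] to the one at a centre is
    given by [anticanonical_none_some], whose homogeneous coordinates on the
    line are u, u (t - a) and 0 with u = 1 / t. *)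
Lemma metric_line_chart (h : chart X -> 'rV[C]_2 ->
  R) k a (hk : (k < 3)%N) (ha : (a < 3)%N) (t : C) :
  smooth_hermitian_metric (anticanonical X) h -> t != 0 ->
  (forall a', (a' < 3)%N -> t != a'%:R) ->
  h origin_chart (t^-1 *: line_dir k) =
    nm (t ^+ 3 / (t - a%:R)) ^+ 2 * h (line_chart hk ha) (along a t).
Proof.
move=> [_ _ hc] t0 ht; have [dO dc e] := same_point hk ha t0 ht.
have pz : patch (line_chart hk ha : chart X) (bpar origin_chart (t^-1 *: line_dir k)).
  by exists (along a t); [exact: dc | exact: esym e].
have eT : transition (origin_chart : chart X) (line_chart hk ha : chart X) (t^-1 *:
  line_dir k) = along a t.
  by rewrite /transition; refine (etrans (congr1 (@coord R 2 X (line_chart hk ha)) e)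
    _); exact: (@coordK R 2 X (line_chart hk ha) _ dc).
have [n1 eL] := @anticanonical_none_some _ _ (@config_inj R) origin_chart (line_chart
  hk ha) _ (idx k a) dO pz erefl erefl.
have h1 := hc (origin_chart : chart X) (line_chart hk ha : chart X) _ dO pz.
apply: (etrans h1); rewrite eT eL.
congr (_ * _); apply: (etrans (Re_norm_sq _)); congr (_ ^+ 2).
have ec : bpoint (line_chart hk ha) (along a t) *m invmx (line_mx k a)
  = vec3 1 (t - a%:R) 0.
  apply: (etrans (bpoint_coords (line_chart hk ha) (along a t))).
  by rewrite along0 along1 mulr0.
have eb : bpoint origin_chart (t^-1 *: line_dir k)
  = t^-1 *: bpoint (line_chart hk ha) (along a t).
  have u0 : t^-1 != 0 by rewrite invr_eq0.
  by rewrite (bpoint_dir_inv k u0) invrK bpoint_along.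
have en i : hom_coord origin_chart (line_chart hk ha) (t^-1 *: line_dir k) i
  = t^-1 * (vec3 1 (t - a%:R) 0) 0 i.
  rewrite /hom_coord eb -scalemxAl mxE; congr (_ * _).
  exact: (congr1 (fun v : 'rV[C]_3 => v 0 i) ec).
have ta : t - a%:R != 0 by rewrite subr_eq0 ht.
have -> : \det (frame_change origin_chart (line_chart hk ha)) = -1.
  have -> : frame_change origin_chart (line_chart hk ha) = invmx (line_mx k a) :=
    mul1mx _.
  by rewrite det_inv (det_line_mx a hk) invrN invr1.
rewrite !en !vec3E mulr1 -(nmN (t ^+ 3 / _)); congr (nm _).
have gen (s : C) : s != 0 -> -1 / (t^-1 ^+ 2 * (t^-1 * s)) = - (t ^+ 3 / s).
  by move=> s0; field; rewrite t0 s0.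
exact: gen.
Qed.
End Ruled.

(** * Sums of logarithmic poles *)

Section Weighted.
Variable R : realType.
Local Notation C := (Cx R).

Lemma continuous_sum (I : eqType) (r : seq I) (f : I -> C -> R) (z : C) :
  (forall i, i \in r -> {for z, continuous (f i)}) ->
  {for z, continuous (fun t => \sum_(i <- r) f i t)}.
Proof.
elim: r => [|i r IH] h.
  apply: near_eq_continuous (@cst_continuous C R 0 z).
  by apply: near_everywhere => t; rewrite big_nil.
have e : \forall t \near z, f i t + \sum_(j <- r) f j t = \sum_(j <- i :: r) f j t.
  by apply: near_everywhere => t; rewrite big_cons.
apply: (near_eq_continuous e).
apply: (@continuousD _ _ _ (f i) (fun t => \sum_(j <- r) f j t)).
  by apply: h; rewrite mem_head.
by apply: IH => j jr; apply: h; rewrite in_cons jr orbT.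
Qed.

Lemma is_lap_cst (k x y : R) : is_lap (fun _ : C => k) x y 0.
Proof.
have d : is_deriv2 (fun=> k) x 0 /\ is_deriv2 (fun=> k) y 0.
  by split; exists (fun=> 0); (try by exact: is_derive_cst); apply: filterE => s;
    exact: is_derive_cst.
by exists 0, 0; split; [exact: d.1 | exact: d.2 | rewrite addr0].
Qed.

Lemma is_lap_sum (I : eqType) (r : seq I) (f : I -> C -> R) (x y : R) :
  (forall i, i \in r -> is_lap (f i) x y 0) -> is_lap (fun t =>
    \sum_(i <- r) f i t) x y 0.
Proof.
elim: r => [|i r IH] h.
  under eq_fun do rewrite big_nil; exact: is_lap_cst.
under eq_fun do rewrite big_cons.
have hr : is_lap (fun t => \sum_(j <- r) f j t) x y 0.
  by apply: IH => j jr; apply: h; rewrite in_cons jr orbT.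
by have := is_lapD (h i (mem_head _ _)) hr; rewrite addr0.
Qed.

Lemma continuous_ln_nm (F : C -> C) (z : C) : F z != 0 -> {for z, continuous F} ->
  {for z, continuous (fun t => ln (nm (F t) ^+ 2))}.
Proof.
move=> F0 cF; have c1 := continuous_nm_comp cF.
have c2 : {for z, continuous (fun t => nm (F t) ^+ 2)} := continuousM c1 c1.
apply: (@continuous_comp _ _ _ (fun t => nm (F t) ^+ 2) (@ln R) z c2).
by apply: continuous_ln; rewrite exprn_gt0 // nm_gt0 F0.
Qed.

Lemma nm_nat n : nm (n%:R : C) = n%:R.
Proof. by rewrite -(rmorph_nat (@real_complex R)) nmR ger0_norm. Qed.

Lemma one_sub_natmul_neq0 (a : nat) (u : C) : (a < 3)%N -> nm u <= 4^-1 ->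
  1 - a%:R * u != 0.
Proof.
move=> ha hu; rewrite subr_eq0; apply/eqP => e; have := nm1 R; rewrite e nmM nm_nat.
have a2 : (a%:R : R) <= 2 by rewrite ler_nat -ltnS.
have := ler_pM (ler0n R a) (nm_ge0 u) a2 hu; lra.
Qed.

Lemma ln_nm_div (a b : C) : a != 0 -> b != 0 ->
  ln (nm (a / b) ^+ 2) = ln (nm a ^+ 2) - ln (nm b ^+ 2).
Proof.
move=> a0 b0; have p (c : C) : c != 0 -> 0 < nm c ^+ 2.
  by move=> c0; rewrite exprn_gt0 // nm_gt0 c0.
by rewrite nmM nmV exprMn exprVn ln_div ?posrE ?p.
Qed.
End Weighted.

(** * Potentials along a line of degree zero *)

Section Weighted.
Variable R : realType.
Local Notation C := (Cx R).
Variables (phi : 'I_3 -> C -> R) (weight0 : C -> R).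
(** The chart at the [a]-th centre contains the points of the line other
    than the remaining centres. *)
Definition avoids (a : 'I_3) (t : C) := forall a' : 'I_3, a' != a -> t != a'%:R.
Hypothesis cphi : forall a t, avoids a t -> {for t, continuous (phi a)}.
Hypothesis lphi : forall a x y, avoids a (x +i* y)%C ->
  exists2 l, is_lap (phi a) x y l & 0 <= l.
Hypothesis cont_weight0 : forall u, nm u <= 4^-1 -> {for u, continuous weight0}.
Hypothesis glue : forall (a : 'I_3) (t : C), (forall a' : 'I_3, t != a'%:R) ->
  weight0 t^-1 = phi a t - ln (nm (t ^+ 3 / (t - a%:R)) ^+ 2).

Let pole (a : 'I_3) (t : C) : R := ln (nm (t - a%:R) ^+ 2).
Let others (a : 'I_3) := [seq a' : 'I_3 <- enum 'I_3 | a' != a].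
(** Minus the logarithm of the squared norm of the trivialising section; in
    the chart at one centre this section is the product of the two remaining
    transversals, up to a constant. *)
Let potential_at (a : 'I_3) (t : C) : R := phi a t - \sum_(a' <- others a) pole a' t.
(** The same potential in terms of the weight around the point at infinity
    of the line, away from all three centres. *)
Let far (t : C) : R := weight0 t^-1 + ln (nm (t ^+ 3) ^+ 2) - \sum_(a <- enum 'I_3)
  pole a t.
(** The same potential in the coordinate u = 1 / t. *)
Let near_origin (u : C) : R := weight0 u - \sum_(a <- enum 'I_3) ln (nm (1 - a%:R * u)
  ^+ 2).

Lemma potential_at_far a (t : C) : (forall a' : 'I_3, t != a'%:R) ->
  potential_at a t = far t.
Proof.
move=> ht; have t0 : t != 0 := ht ord0.
have ta : t - a%:R != 0 by rewrite subr_eq0 ht.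
rewrite /potential_at /far /others (glue a ht) ln_nm_div ?expf_neq0 // -/(pole a t)
  big_filter !big_enum_cond /=.
rewrite [in RHS](bigD1 a) //=; set S := \sum_(_ | _) _.
ring.
Qed.

Lemma far_near_origin (t : C) : (forall a' : 'I_3, t != a'%:R) ->
  far t = near_origin t^-1.
Proof.
move=> ht; have t0 : t != 0 := ht ord0.
have e a : pole a t = ln (nm t ^+ 2) + ln (nm (1 - a%:R * t^-1) ^+ 2).
  have h : t - a%:R = t * (1 - a%:R * t^-1) by rewrite mulrBr mulr1 mulrCA divff // mulr1.
  have h0 : 1 - a%:R * t^-1 != 0.
    have := ht a; rewrite -subr_eq0 h mulf_eq0 negb_or => /andP[_ //].
  rewrite /pole h nmM exprMn lnM // posrE exprn_gt0 // nm_gt0  //.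
rewrite /far /near_origin; under eq_bigr do rewrite e.
rewrite big_split /= big_const_seq count_predT size_enum_ord iter_addr_0.
have -> : ln (nm (t ^+ 3) ^+ 2) = ln (nm t ^+ 2) *+ 3.
  by rewrite nmX exprAC lnXn // exprn_gt0 // nm_gt0 t0.
rewrite opprD addrA; congr (_ - _); exact: addrK.
Qed.

(** A chart that contains the point [t]. *)
Let sel (t : C) : 'I_3 := if [pick a : 'I_3 | t == a%:R] is Some a then a else ord0.
Let potential t := potential_at (sel t) t.

Lemma avoids_sel t : avoids (sel t) t.
Proof.
move=> a'; rewrite /sel; case: pickP => [a /eqP-> ne|h _]; last by rewrite h.
by rewrite eqr_nat eq_sym.
Qed.

Lemma potential_near t : \forall w \near t, potential_at (sel t) w = potential w.
Proof.
have [d d0 hd] := punctured_disc_avoids t [seq (a%:R : C) | a : 'I_3 <- enum 'I_3].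
apply/nbhsC; exists d => // w hw; have [->//|wt] := eqVneq w t.
have nE (a' : 'I_3) : w != a'%:R.
  apply: contraNneq (hd w wt hw) => ->.
  by apply: (map_f (fun a : 'I_3 => (a%:R : C))); rewrite mem_enum.
by rewrite /potential !potential_at_far.
Qed.

Lemma potential_cont : continuous potential.
Proof.
move=> t; apply: (near_eq_continuous (potential_near t)).
have h := @avoids_sel t.
apply: (@continuousB R R^o C (phi (sel t)) (fun t' =>
  \sum_(a' <- others (sel t)) pole a' t')).
  exact: cphi.
apply: continuous_sum => a'; rewrite mem_filter => /andP[ne _].
apply: (@continuous_ln_nm R (fun t => t - a'%:R)); first by rewrite subr_eq0; exact: h.
by apply: cont_subc; exact: cvg_id.
Qed.

Lemma potential_lap x y : exists2 l, is_lap potential x y l & 0 <= l.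
Proof.
have h := @avoids_sel (x +i* y)%C; have [l hl l0] := lphi h; exists l => //.
apply: is_lap_near (potential_near _) _.
rewrite -[l]addr0 -[X in _ + X](mulr0 (-1)).
have hs : is_lap (fun t' => \sum_(a' <- others (sel (x +i* y)%C)) pole a' t') x y 0.
  apply: is_lap_sum => a'; rewrite mem_filter => /andP[ne _].
  by apply: is_lap_ln; exact: h.
have := is_lapD hl (is_lapZ (-1) hs).
by under eq_fun do rewrite mulN1r.
Qed.

Lemma near_origin_cont u : nm u <= 4^-1 -> {for u, continuous near_origin}.
Proof.
move=> hu; apply: (@continuousB R R^o C weight0 (fun u =>
  \sum_(a <- enum 'I_3) ln (nm (1 - a%:R * u) ^+ 2))).
  exact: cont_weight0.
apply: continuous_sum => a _; apply: (@continuous_ln_nm R (fun t => 1 - a%:R * t)).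
  exact: one_sub_natmul_neq0.
apply: (@continuousB C C^o C (fun _ => 1) (fun t => a%:R * t));
  first exact: cst_continuous.
exact: (@mulrl_continuous C a%:R u).
Qed.

Lemma far_off (t : C) : 4 < nm t -> forall a : 'I_3, t != a%:R.
Proof.
move=> ht a; apply/eqP => e; move: ht; rewrite e nm_nat.
by rewrite ltr_nat ltnNge -ltnS; case: a {e} => -[|[|[|]]].
Qed.

(** Continuity on a closed disc bounds the potential there, and continuity
    of the other expression near u = 0 bounds it outside. *)
Lemma potential_bounded : exists B, forall t, potential t <= B.
Proof.
have [B1 h1] : exists B, forall z, nm z <= 4 -> potential z <= B.
  have [||B hB] := @bounded_on_disc R potential 0 4; [by [] | by move=> z _;
    exact: potential_cont |].
  by exists B => z hz; apply: hB; rewrite subr0.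
have [B2 h2] : exists B, forall z, nm z <= 4^-1 -> near_origin z <= B.
  have [||B hB] := @bounded_on_disc R near_origin 0 4^-1; first by rewrite invr_ge0.
    by move=> z; rewrite subr0; exact: near_origin_cont.
  by exists B => z hz; apply: hB; rewrite subr0.
exists (Num.max B1 B2) => t; rewrite le_max; have [h|h] := leP (nm t) 4;
  first by rewrite h1.
have ht := far_off h.
rewrite /potential potential_at_far // far_near_origin // h2 ?orbT // nmV lef_pV2
  ?posrE ?ltW //.
exact: lt_trans h.
Qed.

(** The potential is a bounded subharmonic function on the plane, hence
    constant. *)
Theorem weight_constant u : nm u < 4^-1 -> near_origin u = near_origin 0.
Proof.
have [B hB] := potential_bounded.
have L := liouville potential_cont potential_lap hB.
have cst v : v != 0 -> nm v < 4^-1 -> near_origin v = potential 0.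
  move=> v0 hv; have h : 4 < nm v^-1.
    by rewrite nmV -[4]invrK ltf_pV2 ?posrE ?invr_gt0 // nm_gt0 v0.
  have ht := far_off h.
  rewrite -[v in LHS]invrK -far_near_origin // -(potential_at_far (sel v^-1)) //
    -/(potential _).
  by apply/eqP; rewrite eq_le !L.
move=> hu; have W00 : near_origin 0 = potential 0.
  refine (@continuous_eq R R R^o near_origin (fun=> potential 0) 0 _ _ _).
  - by apply: near_origin_cont; rewrite nm0 invr_ge0.
  - exact: cst_continuous.
  - apply/nbhsC; exists 4^-1; first by rewrite invr_gt0.
    by move=> w; rewrite subr0 => hw w0; exact: cst.
by have [->//|u0] := eqVneq u 0; rewrite W00; exact: cst.
Qed.
End Weighted.

(** * Absence of semi-positive metrics *)

Section Final.
Variable R : realType.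
Local Notation C := (Cx R).
Local Notation config := (@config R).
Local Notation X := (blowup (@config_inj R)).
Variable h : chart X -> 'rV[C]_2 -> R.
Hypothesis hm : smooth_hermitian_metric (anticanonical X) h.
Hypothesis sp : semipositive_curvature h.

Lemma origin_disc k (u : C) : (k < 3)%N -> nm u <= 4^-1 ->
  bdom (origin_chart R) (u *: line_dir R k).
Proof.
by move=> hk hu; apply: bdom_dir => // a ha; exact: one_sub_natmul_neq0.
Qed.

Lemma metric_gt0 (c : frame config) z : bdom c z -> 0 < h c z.
Proof. by have [h0 _ _] := hm; exact: h0. Qed.

Lemma metric_smooth (c : frame config) : smooth_on (bdom c) (h c).
Proof. by have [_ hs _] := hm; exact: hs. Qed.

Lemma log_weight_continuous (c : frame config) (z0 v : 'rV[C]_2) (t : C) : bdom c (z0 +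
  t *: v) ->
  {for t, continuous (fun s : C => - ln (h c (z0 + s *: v)))}.
Proof.
move=> dt; have ch := weight_continuous_line (@metric_smooth c) dt.
have cl : {for t, continuous (fun s : C => ln (h c (z0 + s *: v)))}.
  apply: (@continuous_comp _ _ _ (fun s : C => h c (z0 + s *: v)) (@ln R) t ch).
  by apply: continuous_ln; exact: metric_gt0.
exact: (@continuousN R R^o C _ _ cl).
Qed.

(** The potential of the semi-positive metric along the [k]-th line is
    constant. *)
Lemma metric_on_line k (u : C) : (k < 3)%N -> nm u < 4^-1 ->
  ln (h (origin_chart R) (u *: line_dir R k)) + \sum_(a <- enum 'I_3) ln (nm (1 - a%:R
    * u) ^+ 2)
  = ln (h (origin_chart R) 0).
Proof.
move=> hk hu.
pose phi (a : 'I_3) (t : C) := - ln (h (@line_chart R k a hk (ltn_ord a)) (@along R a t)).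
pose weight0 (u : C) := - ln (h (origin_chart R) (u *: line_dir R k)).
have bd (a : 'I_3) (t : C) : avoids a t -> bdom (@line_chart R k a hk (ltn_ord a))
  (@along R a t).
  move=> ho; apply: bdom_along => a' ha' ne.
  exact: (ho (Ordinal ha') ne).
have c1 a t : avoids a t -> {for t, continuous (phi a)}.
  by move=> ho; apply: log_weight_continuous; exact: bd.
have c2 a x y : avoids a (x +i* y)%C -> exists2 l, is_lap (phi a) x y l & 0 <= l.
  move=> ho; have b := bd _ _ ho.
  apply: (is_lap_log_weight (@metric_gt0 _) (@metric_smooth _) (@bdom_open _ _ _) b) =>
    xi.
  exact: (sp b).
have c3 v : nm v <= 4^-1 -> {for v, continuous weight0}.
  move=> hv; have b : bdom (origin_chart R) (0 + v *: line_dir R k) by rewrite add0r;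
    exact: origin_disc.
  apply: (near_eq_continuous _ (log_weight_continuous b)).
  by apply: near_everywhere => w; rewrite add0r.
have c4 (a : 'I_3) (t : C) : (forall a' : 'I_3, t != a'%:R) ->
    weight0 t^-1 = phi a t - ln (nm (t ^+ 3 / (t - a%:R)) ^+ 2).
  move=> ht; have t0 : t != 0 := ht ord0.
  have ta : t - a%:R != 0 by rewrite subr_eq0 ht.
  have hta a' : (a' < 3)%N -> t != a'%:R by move=> ha'; exact: (ht (Ordinal ha')).
  rewrite /weight0 (metric_line_chart hk (ltn_ord a) hm t0 hta) lnM ?posrE;
    first by rewrite opprD addrC.
    by rewrite exprn_gt0 // nm_gt0  mulf_neq0 ?expf_neq0 ?invr_eq0.
  by apply: metric_gt0; apply: bd => a' _; exact: ht.
have := weight_constant c1 c2 c3 c4 hu; rewrite /weight0 scale0r.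
rewrite [X in _ = _ - X -> _]big1; last by move=> a _; rewrite mulr0 subr0 nm1 expr1n ln1.
by move=> e; lra.
Qed.

Let F : 'rV[R]_(2 + 2) -> R := h (origin_chart R) \o @real_to_cplx R 2.
Let P0 : 'rV[R]_(2 + 2) := cplx_to_real (0 : 'rV[C]_2).
Let F0 : R := h (origin_chart R) 0.

Lemma metric_real_dir k (s : R) : F (P0 + (s - 0) *: cplx_to_real (line_dir R k)) =
  h (origin_chart R) ((s%:C)%C *: line_dir R k).
Proof.
rewrite /F /= subr0; congr (h _ _); rewrite -[RHS]real_to_cplxK; congr (real_to_cplx _).
by have := cplx_to_real_line 0 (line_dir R k) (s%:C)%C;
  rewrite add0r /= scale0r addr0 => ->.
Qed.

Lemma metric_real_line k (s : R) : (k < 3)%N -> `|s| < 4^-1 ->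
  F (P0 + (s - 0) *: cplx_to_real (line_dir R k)) * ((1 - s) ^+ 2 * (1 - 2 * s) ^+ 2)
    = F0.
Proof.
move=> hk hs; have hu : nm (s%:C)%C < 4^-1 by rewrite nmR.
have := metric_on_line hk hu; rewrite metric_real_dir.
have eF (a : nat) : nm (1 - a%:R * (s%:C)%C) ^+ 2 = (1 - a%:R * s) ^+ 2.
  have -> : 1 - a%:R * (s%:C)%C = ((1 - a%:R * s)%:C)%C :> C.
    by rewrite rmorphB rmorph1 rmorphM rmorph_nat.
  by rewrite nmR real_normK ?num_real.
under eq_bigr do rewrite eF.
rewrite big_enum /= !big_ord_recl big_ord0 /= addr0.
have [s1 s2] := (ltr_normlP _ _ hs).
have h0 : 0 < h (origin_chart R) ((s%:C)%C *: line_dir R k).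
  by apply: metric_gt0; apply: origin_disc => //; exact: ltW.
have F00 : 0 < F0.
  by apply: metric_gt0; rewrite -(scale0r (line_dir R k)); apply: origin_disc;
    rewrite // nm0 invr_ge0.
rewrite mul0r subr0 expr1n ln1 add0r mul1r => e.
have q1 : 0 < (1 - s) ^+ 2 by rewrite exprn_gt0 // subr_gt0; lra.
have q2 : 0 < (1 - 2 * s) ^+ 2 by rewrite exprn_gt0 // subr_gt0; lra.
have hx := mulr_gt0 h0 (mulr_gt0 q1 q2).
apply: (ln_inj _ _ _); rewrite ?posrE //.
rewrite -[RHS]e (lnM h0 (mulr_gt0 q1 q2)); congr (_ + _).
exact: lnM.
Qed.

(** The derivative of (1 - s)^2 (1 - 2 s)^2 at 0 is -6, and its product with
    the weight along the line is constant. *)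
Lemma metric_derivative_dir k : (k < 3)%N -> 'd F P0 (cplx_to_real (line_dir R k))
  = 6 * F0.
Proof.
move=> hk; set v := cplx_to_real _.
have b0 : bdom (origin_chart R) 0.
  by rewrite -(scale0r (line_dir R k)); apply: origin_disc; rewrite // nm0 invr_ge0.
have dF : differentiable F P0 := metric_smooth [::] b0.
rewrite -deriveE //.
have hv := (is_derive_lineP F P0 v 0 _).1 (DeriveDef (diff_derivable dF) erefl).
set d := 'D_v F P0 in hv *.
have l1 (a : R) : is_derive (0 : R) (1 : R) (fun s : R => 1 - a * s) (- a).
  have h2 : is_derive (0 : R) (1 : R) (fun s => a * s) _ :=
    is_deriveZ a (is_derive_id (0 : R) (1 : R)).
  have h3 : is_derive (0 : R) (1 : R) (fun s => 1 - a * s) _ :=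
    is_deriveB (is_derive_cst (1 : R) (0 : R) (1 : R)) h2.
  by apply: (is_derive_eq h3); rewrite /GRing.scale /= mulr1 sub0r.
have l11 : is_derive (0 : R) (1 : R) (fun s : R => 1 - s) (-1).
  by have := l1 1; under eq_fun do rewrite mul1r.
have hP : is_derive (0 : R) (1 : R) (fun s : R => (1 - s) ^+ 2 * (1 - 2 * s) ^+ 2) _ :=
  is_deriveM (is_deriveM l11 l11) (is_deriveM (l1 2) (l1 2)).
have hM : is_derive (0 : R) (1 : R) (fun s => F (P0 +
  (s - 0) *: v) * ((1 - s) ^+ 2 * (1 - 2 * s) ^+ 2)) _ :=
  is_deriveM hv hP.
have hK : is_derive (0 : R) (1 : R) (fun s => F (P0 +
  (s - 0) *: v) * ((1 - s) ^+ 2 * (1 - 2 * s) ^+ 2)) 0.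
  apply: near_eq_is_derive (is_derive_cst (F0 : R) (0 : R) (1 : R)).
  apply/nbhsR; exists 4^-1; first by rewrite invr_gt0.
  by move=> s hs; rewrite subr0 in hs; exact: esym (metric_real_line hk hs).
have e1 := @derive_val _ _ _ _ _ _ _ hM.
have e2 := @derive_val _ _ _ _ _ _ _ hK.
have eF : F (P0 + (0 - 0) *: v) = F0.
  by rewrite (metric_real_dir k 0) scale0r.
have := etrans (esym e1) e2; rewrite eF /GRing.scale /= !fctE => e.
have : d - 6 * F0 = 0 by rewrite -[RHS]e; ring.
by move/eqP; rewrite subr_eq0 => /eqP.
Qed.

Lemma sum_line_dir : \sum_(k < 3) cplx_to_real (line_dir R k) = 0 :> 'rV[R]_(2 + 2).
Proof.
apply/rowP => j; rewrite !big_ord_recl big_ord0 !mxE.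
by case: (fintype.split j) => -[[|[|//]]] i; rewrite !mxE /=; ring.
Qed.

(** The differential at the common point is linear, and the three directions
    on which it takes the same positive value have sum zero. *)
Lemma no_semipositive_metric : False.
Proof.
have F00 : 0 < F0.
  by apply: metric_gt0; rewrite -(scale0r (line_dir R 0)); apply: origin_disc;
    rewrite // nm0 invr_ge0.
have := linear0 ('d F P0); rewrite -sum_line_dir linear_sum /=.
under eq_bigr => k _ do rewrite (metric_derivative_dir (ltn_ord k)).
rewrite sumr_const card_ord => /eqP; rewrite mulrn_eq0 /= mulf_eq0 (gt_eqF F00) orbF.
by rewrite pnatr_eq0.
Qed.
End Final.

Theorem corollary1p3 (R : realType) :
  exists (p : 'I_9 -> P2 R) (p_inj : injective p),
    nef (anticanonical (blowup p_inj)) /\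
    ~ (exists h : chart (blowup p_inj) -> 'rV[Cx R]_2 -> R,
         smooth_hermitian_metric (anticanonical (blowup p_inj)) h /\
         semipositive_curvature h).
Proof.
exists (@config R), (@config_inj R); split; first exact: nef_blowup.
by move=> [h [hm sp]]; exact: (no_semipositive_metric hm sp).
Qed.
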